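(* Let $s>\frac52$, $T>0$, and let $F(\alpha,\beta,\overline{\alpha},\overline{\beta})$ be a polynomial in $\alpha,\beta,\overline{\alpha},\overline{\beta}$ with complex coefficients. Let $\phi\in H^s(\mathbb{T})$ and assume that $u\in C([0,T];H^s(\mathbb{T}))$ is a solution to $$\partial_t u+i\partial_x^2u=F(u,\partial_xu,\overline{u},\overline{\partial_xu}),\qquad u|_{t=0}=\phi.$$ (i) If $\int_{\mathbb{T}}\operatorname{Im}F_\beta(\phi,\partial_x\phi,\overline{\phi},\overline{\partial_x\phi})\,dx>0$, then $P_-\phi\in H^{s+\delta}(\mathbb{T})$ for any $\delta\in(0,\frac12)$. (ii) If $\int_{\mathbb{T}}\operatorname{Im}F_\beta(\phi,\partial_x\phi,\overline{\phi},\overline{\partial_x\phi})\,dx<0$, then $P_+\phi\in H^{s+\delta}(\mathbb{T})$ for any $\delta\in(0,\frac12)$. The same conclusion holds for a solution $u\in C([-T,0];H^s(\mathbb{T}))$ with $P_-\phi$ and $P_+\phi$ interchanged.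
   Context: $\mathbb{T}=\mathbb{R}/2\pi\mathbb{Z}$, $\int_{\mathbb{T}}f\,dx:=\frac1{2\pi}\int_{-\pi}^{\pi}f(x)\,dx$, $\widehat f(k)=\int_{\mathbb{T}}f(x)e^{-ikx}dx$, and $H^s(\mathbb{T})$ is the $L^2$-based Sobolev space of complex-valued functions. With $\mathbb{N}$ the positive integers, $P_+f(x)=\sum_{k\in\mathbb{N}}\widehat f(k)e^{ikx}$ and $P_-f(x)=\sum_{k\in\mathbb{N}}\widehat f(-k)e^{-ikx}$. For $\beta=a+ib$ with $a,b\in\mathbb{R}$, $F_\beta=\frac{\partial F}{\partial\beta}:=\frac12\big(\frac{\partial F}{\partial a}-i\frac{\partial F}{\partial b}\big)$. Solution: for $s>\frac32$, $T>0$, $\phi\in H^s(\mathbb{T})$, $u$ is a solution in $H^s(\mathbb{T})$ on $[0,T]$ if $u\in L^\infty([0,T];H^s(\mathbb{T}))$ and for every $\chi\in C_c^\infty([0,T)\times\mathbb{T})$, $$-\int_0^T\!\!\int_{\mathbb{T}}u\,\partial_t\chi\,dx\,dt-\int_{\mathbb{T}}\phi(x)\chi(0,x)\,dx+i\int_0^T\!\!\int_{\mathbb{T}}u\,\partial_x^2\chi\,dx\,dt=\int_0^T\!\!\int_{\mathbb{T}}F(u,\partial_xu,\overline u,\overline{\partial_xu})\chi\,dx\,dt.$$ A solution on $[-T,0]$ is defined in the similar manner (with $\chi\in C_c^\infty((-T,0]\times\mathbb{T})$, time integrals over $[-T,0]$, and the initial term having the sign $+\int_{\mathbb{T}}\phi(x)\chi(0,x)dx$).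 *)

(* Defs.v *)
From mathcomp Require Import all_boot all_order all_algebra.
From mathcomp Require Import all_classical all_reals all_analysis.
From mathcomp Require mpoly.
Import Order.TTheory GRing.Theory Num.Theory.
Import numFieldNormedType.Exports.
From mathcomp Require Import complex.

Set Implicit Arguments.
Unset Strict Implicit.
Unset Printing Implicit Defensive.

Local Open Scope classical_set_scope.
Local Open Scope ring_scope.
Local Open Scope complex_scope.

Section ComplexValuedFunctions.
Context {R : realType}.
Local Notation C := R[i].

(* All analytic operations on complex-valued functions of real variables are
   taken on the real and the imaginary part. *)

Definition cintegral (D : set R) (f : R -> C) : C :=
  (\int[lebesgue_measure]_(x in D) Re (f x)) +i*
  (\int[lebesgue_measure]_(x in D) Im (f x)).

Definition cderive1 (f : R -> C) (x : R) : C :=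
  (derive1 (fun y => Re (f y)) x) +i* (derive1 (fun y => Im (f y)) x).

Definition csum (a : nat -> C) : C :=
  limn (fun n => \sum_(1 <= k < n) Re (a k)) +i*
  limn (fun n => \sum_(1 <= k < n) Im (a k)).

Definition expi (x : R) : C := cos x +i* sin x.

Definition abs2 (z : C) : R := Re z ^+ 2 + Im z ^+ 2.

(* d/d(beta) = (d/da - i d/db) / 2 at z, where beta = a + i b. Here 'i%C is 0 +i* 1;
   in ring_scope, 'i would be the opaque Num.imaginary. *)
Definition wirtinger (G : C -> C) (z : C) : C :=
  2^-1 * (cderive1 (fun a => G (a +i* Im z)) (Re z)
          - 'i%C * cderive1 (fun b => G (Re z +i* b)) (Im z)).

(* F (alpha, beta, conj alpha, conj beta) *)
Definition polyval (F : mpoly.mpoly 4 C) (alpha beta : C) : C :=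
  mpoly.meval
    (fun i : 'I_4 => nth 0 [:: alpha; beta; conjc alpha; conjc beta] i) F.

Definition F_beta (F : mpoly.mpoly 4 C) (alpha beta : C) : C :=
  wirtinger (polyval F alpha) beta.

End ComplexValuedFunctions.

(* Functions on the torus R / 2 pi Z are 2 pi-periodic functions on R; elements
   of L^2 and H^s are represented by such functions, not quotiented by almost
   everywhere equality. *)
Section Torus.
Context {R : realType}.
Local Notation C := R[i].

Definition periodic (f : R -> C) : Prop := forall x, f (x + 2 * pi) = f x.

Definition rmean (f : R -> R) : R :=
  (2 * pi)^-1 * \int[lebesgue_measure]_(x in `[- pi, pi]) f x.

Definition mean (f : R -> C) : C :=
  ((2 * pi)^-1)%:C * cintegral `[- pi, pi] f.

Definition fourier (f : R -> C) (k : int) : C :=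
  mean (fun x => f x * expi (- (k%:~R * x))).

Definition L2 (f : R -> C) : Prop :=
  [/\ periodic f,
      measurable_fun setT (fun y => Re (f y)),
      measurable_fun setT (fun y => Im (f y)) &
      (\int[lebesgue_measure]_(x in `[(- pi)%R, pi]) (abs2 (f x))%:E < +oo)%E].

Definition Hs_norm (s : R) (f : R -> C) : \bar R :=
  sqrte (\esum_(k in [set: int])
           ((1 + k%:~R ^+ 2) `^ s * abs2 (fourier f k))%:E).

(* H^s for s >= 0 *)
Definition Hs (s : R) (f : R -> C) : Prop :=
  L2 f /\ (Hs_norm s f < +oo)%E.

(* The series are taken pointwise; they converge absolutely for f in H^s,
   s > 1/2. *)
Definition P_plus (f : R -> C) (x : R) : C :=
  csum (fun k => fourier f k%:Z * expi (k%:R * x)).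

Definition P_minus (f : R -> C) (x : R) : C :=
  csum (fun k => fourier f (- k%:Z) * expi (- (k%:R * x))).

Definition smooth_torus (psi : R -> C) : Prop :=
  periodic psi /\
  forall n x, derivable (derive1n n (fun y => Re (psi y))) x 1 /\
              derivable (derive1n n (fun y => Im (psi y))) x 1.

Definition weak_derivative (f g : R -> C) : Prop :=
  L2 g /\
  forall psi, smooth_torus psi ->
    mean (fun x => g x * psi x) = - mean (fun x => f x * cderive1 psi x).

(* A representative of the distributional derivative, which is unique up to a
   null set; 0 if the distributional derivative is not in L^2. *)
Definition dx (f : R -> C) : R -> C :=
  xget (fun=> 0) [set g | weak_derivative f g].

End Torus.

Section Evolution.
Context {R : realType}.
Local Notation C := R[i].

(* u in C(I; H^s); only the values u t with t in I matter. *)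
Definition C_Hs (I : set R) (s : R) (u : R -> R -> C) : Prop :=
  (forall t, I t -> Hs s (u t)) /\
  forall t, I t ->
    Hs_norm s (fun x => u t' x - u t x) @[t' --> within I (nbhs t)] --> 0%E.

(* Bochner measurability: u is an almost everywhere limit of simple functions
   with values in H^s. *)
Definition strongly_measurable (I : set R) (s : R) (u : R -> R -> C) : Prop :=
  exists (m : nat -> nat) (A : nat -> nat -> set R) (g : nat -> nat -> R -> C),
    [/\ forall n j, measurable (A n j),
        forall n j, Hs s (g n j) &
        {ae lebesgue_measure, forall t, I t ->
          Hs_norm s (fun x => u t x
                       - \sum_(j < m n) (\1_(A n j) t)%:C * g n j x)
            @[n --> \oo] --> 0%E}].

Definition Linfty_Hs (I : set R) (s : R) (u : R -> R -> C) : Prop :=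
  [/\ {ae lebesgue_measure, forall t, I t -> Hs s (u t)},
      strongly_measurable I s u &
      exists M : R,
        {ae lebesgue_measure, forall t, I t -> (Hs_norm s (u t) <= M%:E)%E}].

Definition partial (b : bool) (g : R -> R -> R) : R -> R -> R :=
  fun t x => if b then derive1 (g^~ x) t else derive1 (g t) x.

(* All iterated partial derivatives, in any order, exist and are continuous. *)
Definition smooth2 (g : R -> R -> R) : Prop :=
  forall w : seq bool, let h := foldr partial g w in
    continuous (fun p : R * R => h p.1 p.2) /\
    forall t x, derivable (h^~ x) t 1 /\ derivable (h t) x 1.

Definition smooth_spacetime (chi : R -> R -> C) : Prop :=
  [/\ forall t, periodic (chi t),
      smooth2 (fun t x => Re (chi t x)) &
      smooth2 (fun t x => Im (chi t x))].

(* The elements of C_c^oo([0, T) x T), smooth up to t = 0, are the restrictions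
   to [0, T) of these functions. *)
Definition test_forward (T : R) (chi : R -> R -> C) : Prop :=
  smooth_spacetime chi /\
  exists2 T0, T0 < T & forall t x, T0 <= t -> chi t x = 0.

Definition test_backward (T : R) (chi : R -> R -> C) : Prop :=
  smooth_spacetime chi /\
  exists2 T0, T0 < T & forall t x, t <= - T0 -> chi t x = 0.

Definition dt (chi : R -> R -> C) (t x : R) : C := cderive1 (chi^~ x) t.

Definition dxx (chi : R -> R -> C) (t x : R) : C :=
  cderive1 (cderive1 (chi t)) x.

Definition spacetime_integral (I : set R) (f : R -> R -> C) : C :=
  cintegral I (fun t => mean (f t)).

Definition solution_forward (s T : R) (F : mpoly.mpoly 4 C) (phi : R -> C)
    (u : R -> R -> C) : Prop :=
  Linfty_Hs `[0, T] s u /\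
  forall chi, test_forward T chi ->
    - spacetime_integral `[0, T] (fun t x => u t x * dt chi t x)
    - mean (fun x => phi x * chi 0 x)
    + 'i%C * spacetime_integral `[0, T] (fun t x => u t x * dxx chi t x)
    = spacetime_integral `[0, T]
        (fun t x => polyval F (u t x) (dx (u t) x) * chi t x).

Definition solution_backward (s T : R) (F : mpoly.mpoly 4 C) (phi : R -> C)
    (u : R -> R -> C) : Prop :=
  Linfty_Hs `[- T, 0] s u /\
  forall chi, test_backward T chi ->
    - spacetime_integral `[- T, 0] (fun t x => u t x * dt chi t x)
    + mean (fun x => phi x * chi 0 x)
    + 'i%C * spacetime_integral `[- T, 0] (fun t x => u t x * dxx chi t x)
    = spacetime_integral `[- T, 0]
        (fun t x => polyval F (u t x) (dx (u t) x) * chi t x).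

End Evolution.

(* Main.v *)
Require Import Defs.
From HB Require Import structures.
From mathcomp Require Import all_boot all_order all_algebra.
From mathcomp Require Import all_classical all_reals all_analysis.
From mathcomp Require Import measurable_realfun.
From mathcomp Require mpoly.
Import Order.TTheory GRing.Theory Num.Theory.
Import numFieldNormedType.Exports.
From mathcomp Require Import complex.
From mathcomp Require Import zify ring lra.
Set Implicit Arguments.
Unset Strict Implicit.
Unset Printing Implicit Defensive.
Local Open Scope classical_set_scope.
Local Open Scope ring_scope.
Local Open Scope complex_scope.

Import (canonicals) mpoly.

(** Write [r] for the second [x]-derivative of the truncation of [u] to frequencies
   at most [N].  Up to terms that are bounded or vanish as [N] grows,
     [r_t = - i r_xx + c r_x + d (conj r)_x],   [c = F_beta],  [d = F_(conj beta)].
   The gauge [z = e^Lam r] with [2 i Lam_x = - (c - c_0)] replaces [c] by its mean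
   [c_0], and the normal form
     [v_k = z_k + sum_j (e^Lam d)_(k-j) j / (k^2 + j^2) (conj r)_j]
   removes the last term: it is not resonant, since the phases [k^2] and [- j^2] of
   [r] and [conj r] have opposite signs.  Hence [v_k' = (i k^2 + i k c_0) v_k + H_k]
   with [H] bounded in [H^(s-2)].  As [Re (i k c_0) = - k Im c_0], the modes with
   [k Im c_0 < 0] grow like [exp (gamma |k| t)], and since they stay bounded up to a
   positive time, [|k| |v_k(0)|^2] is summable against the [H^(s-2)] weight; this is
   the gain of half a derivative.  All estimates are algebra in weighted [l^2]
   spaces of Fourier coefficients, and the exponential is truncated at order [N + 2]
   so that only trigonometric polynomials occur. *)

(** Truncation does not commute with the nonlinearity: the truncated forcing differs from [F] of the
    truncated solution by an error of which only the single coefficients are known to be small, and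
    two x-derivatives fall on it. Every bound is therefore stated for a finite list of modes, with
    [N] large depending on that list and a constant depending on neither; the weighted norms
    themselves are bounded through such lists. The threshold [s > 5/2] means [s - 2 > 1/2], so the
    space of [r] is an algebra with summable coefficients. A coefficient such as [F_beta(u, u_x)]
    has one derivative more than [r], and its time derivative, by the equation, one less.
    Integration in x repairs this loss in the gauge, and the kernel [j / (k^2 + j^2)] repairs it in
    the normal form. Undoing the gauge mixes frequencies of both signs. A mode without a known gain
    reaches a growing mode [k] only through a gauge frequency of size at least [|k|], and the gauge
    is two derivatives smoother than [r], so the half derivative can be put on it. *)

Definition win (N : nat) : seq int := [seq i%:Z - N%:Z | i <- iota 0 N.*2.+1].

Lemma mem_win N (k : int) : (k \in win N) = (absz k <= N)%N.
Proof.
apply/mapP/idP => [ [i + ->]|kN].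
  by rewrite mem_iota => /andP[_ hi]; lia.
exists (absz (k + N%:Z)); last by lia.
by rewrite mem_iota; lia.
Qed.

Lemma uniq_win N : uniq (win N).
Proof. by rewrite map_inj_uniq ?iota_uniq// => i j; lia. Qed.

(** Finite sums over modes run over lists that only have to contain the support; this makes the
    choice of the list immaterial. *)
Lemma big_supp (V : nmodType) (s s' : seq int) (h : int -> V) :
  uniq s -> uniq s' -> (forall k, h k != 0 -> (k \in s) && (k \in s')) ->
  \sum_(k <- s) h k = \sum_(k <- s') h k.
Proof.
move=> us us' hs.
have E (t : seq int) : \sum_(k <- t) h k = \sum_(k <- [seq k <- t | h k != 0]) h k.
  by rewrite big_filter [RHS]big_mkcond; apply: eq_bigr => k _; case: eqP => //= ->.
rewrite E [RHS]E; apply: perm_big; apply: uniq_perm; rewrite ?filter_uniq//.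
move=> k; rewrite !mem_filter.
by case: (boolP (h k != 0)) => //= /hs /andP[-> ->].
Qed.

Local Obligation Tactic := idtac.

(** * Trigonometric polynomials *)

Section LaurentDef.
Variable K : comNzRingType.

(* Trigonometric polynomials through their Fourier coefficients: the product is the
   convolution. *)
Record laurent := Laurent {
  lcoef :> int -> K ;
  lsupp : exists N : nat, forall k : int, (N < absz k)%N -> lcoef k = 0 }.

HB.instance Definition _ := gen_eqMixin laurent.
HB.instance Definition _ := gen_choiceMixin laurent.

Lemma laurentP (f g : laurent) : (forall k, f k = g k) -> f = g.
Proof.
case: f g => [f hf] [g hg] /= /funext E; case: _ / E in hg *.
by congr Laurent; exact: Prop_irrelevance.
Qed.

(** Some bound on the frequencies, picked by choice; it need not be the exact degree. *)
Definition ldeg (f : laurent) : nat := projT1 (cid (lsupp f)).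

Lemma ldegP (f : laurent) k : (ldeg f < absz k)%N -> f k = 0.
Proof. by rewrite /ldeg; case: cid => /= N; exact. Qed.

Lemma ldeg_mem (f : laurent) k : f k != 0 -> (absz k <= ldeg f)%N.
Proof. by apply: contraNT; rewrite -ltnNge => /ldegP ->. Qed.

Program Definition lzero := @Laurent (fun=> 0) _.
Next Obligation. by exists 0%N. Qed.

Program Definition ladd (f g : laurent) := @Laurent (fun k => f k + g k) _.
Next Obligation.
move=> f g; exists (ldeg f + ldeg g)%N => k hk.
by rewrite !ldegP ?addr0//; lia.
Qed.

Program Definition lopp (f : laurent) := @Laurent (fun k => - f k) _.
Next Obligation. by move=> f; exists (ldeg f) => k hk; rewrite ldegP ?oppr0. Qed.

Lemma laddA : associative ladd.
Proof. by move=> f g h; apply: laurentP => k /=; rewrite addrA. Qed.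
Lemma laddC : commutative ladd.
Proof. by move=> f g; apply: laurentP => k /=; rewrite addrC. Qed.
Lemma ladd0 : left_id lzero ladd.
Proof. by move=> f; apply: laurentP => k /=; rewrite add0r. Qed.
Lemma laddN : left_inverse lzero lopp ladd.
Proof. by move=> f; apply: laurentP => k /=; rewrite addNr. Qed.

HB.instance Definition _ := GRing.isZmodule.Build laurent laddA laddC ladd0 laddN.

Program Definition lcst (c : K) := @Laurent (fun k => if k == 0 then c else 0) _.
Next Obligation. by move=> c; exists 0%N => k; case: eqP => // ->. Qed.

Definition lconv (f g : laurent) (k : int) : K :=
  \sum_(j <- win (ldeg g)) f (k - j) * g j.

Lemma lconvE (s : seq int) (f g : laurent) k : uniq s ->
  (forall j, g j != 0 -> f (k - j) != 0 -> j \in s) ->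
  lconv f g k = \sum_(j <- s) f (k - j) * g j.
Proof.
move=> us gs; apply: big_supp => // [|j]; first exact: uniq_win.
have [->|g0] := eqVneq (g j) 0; first by rewrite mulr0 eqxx.
have [->|f0 _] := eqVneq (f (k - j)) 0; first by rewrite mul0r eqxx.
by rewrite mem_win ldeg_mem//= gs.
Qed.

Program Definition lmul (f g : laurent) := @Laurent (lconv f g) _.
Next Obligation.
move=> f g; exists (ldeg f + ldeg g)%N => k hk; rewrite /lconv big_seq big1// => j.
rewrite mem_win => hj; rewrite ldegP ?mul0r//; lia.
Qed.

Lemma lmulC : commutative lmul.
Proof.
move=> f g; apply: laurentP => k /=.
pose s := [seq k - j | j <- win (ldeg g)].
rewrite (@lconvE s g f k).
- rewrite /lconv [RHS]big_map; apply: eq_bigr => j _.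
  by rewrite mulrC; congr (g _ * f _); lia.
- by rewrite map_inj_uniq ?uniq_win// => i j; lia.
- move=> j _ gj; apply/mapP; exists (k - j); last by lia.
  by rewrite mem_win ldeg_mem.
Qed.

Lemma lmulA : associative lmul.
Proof.
move=> f g h; apply: laurentP => k /=.
(* Large enough to contain every index that contributes for this [k], so that both iterated sums fit
   one window. *)
pose D := (ldeg f + ldeg g + ldeg h + absz k)%N.
rewrite (@lconvE (win D)) ?uniq_win//; last first.
  by move=> j _ /ldeg_mem; rewrite mem_win; lia.
transitivity (\sum_(j <- win D) \sum_(i <- win (ldeg h)) f (k - j) * (g (j - i) * h i)).
  by apply: eq_bigr => j _; rewrite /= /lconv big_distrr.
rewrite exchange_big /= /lconv big_seq [RHS]big_seq; apply: eq_bigr => i.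
rewrite mem_win => hi /=.
rewrite (@lconvE [seq j - i | j <- win D] f g (k - i)).
- rewrite big_distrl [RHS]big_map; apply: eq_bigr => j _ /=.
  by rewrite mulrA; congr (f _ * _ * _); lia.
- by rewrite map_inj_uniq ?uniq_win// => p j; lia.
- move=> j /ldeg_mem gj _; apply/mapP; exists (j + i); last by lia.
  by rewrite mem_win; lia.
Qed.

Lemma lmul1 : left_id (lcst 1) lmul.
Proof.
move=> f; rewrite lmulC; apply: laurentP => k /=.
rewrite (@lconvE [:: 0]) //; last first.
  by move=> j /=; rewrite mem_seq1; case: (j == 0); rewrite ?eqxx.
by rewrite big_seq1 /= mulr1 subr0.
Qed.

Lemma lmulD : left_distributive lmul ladd.
Proof.
move=> f g h; apply: laurentP => k /=; rewrite /lconv -big_split.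
by apply: eq_bigr => j _; rewrite mulrDl.
Qed.

Lemma lone0 : lcst 1 != lzero.
Proof. by apply/eqP => /(congr1 (fun f : laurent => f 0)) /= /eqP; rewrite oner_eq0. Qed.

HB.instance Definition _ :=
  GRing.Zmodule_isComNzRing.Build laurent lmulA lmulC lmul1 lmulD lone0.

Lemma coeflD (f g : laurent) k : (f + g) k = f k + g k. Proof. by []. Qed.
Lemma coeflN (f : laurent) k : (- f) k = - f k. Proof. by []. Qed.
Lemma coeflB (f g : laurent) k : (f - g) k = f k - g k. Proof. by []. Qed.

Lemma coeflM (s : seq int) (f g : laurent) k : uniq s ->
  (forall j, g j != 0 -> f (k - j) != 0 -> j \in s) ->
  (f * g) k = \sum_(j <- s) f (k - j) * g j.
Proof. exact: lconvE. Qed.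

Lemma coefl_cst c k : lcst c k = if k == 0 then c else 0. Proof. by []. Qed.

Lemma coefl_cstM c (f : laurent) k : (lcst c * f) k = c * f k.
Proof.
rewrite mulrC (@coeflM [:: 0])//; first by rewrite big_seq1 /= subr0 mulrC.
by move=> j /=; rewrite mem_seq1; case: (j == 0); rewrite ?eqxx.
Qed.

Fact lcst_is_zmod_morphism : zmod_morphism lcst.
Proof. by move=> a b; apply: laurentP => k; rewrite coeflB /=; case: ifP; rewrite ?subr0. Qed.
HB.instance Definition _ := GRing.isZmodMorphism.Build K laurent lcst lcst_is_zmod_morphism.
Fact lcst_is_monoid_morphism : monoid_morphism lcst.
Proof.
by split=> // a b; apply: laurentP => k; rewrite coefl_cstM /=; case: ifP; rewrite ?mulr0.
Qed.
HB.instance Definition _ :=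
  GRing.isMonoidMorphism.Build K laurent lcst lcst_is_monoid_morphism.

Program Definition lmono (l : int) := @Laurent (fun k => if k == l then 1 else 0) _.
Next Obligation. by move=> l; exists (absz l) => k hk; case: eqP => // E; subst; lia. Qed.

Program Definition lmult (m : int -> K) (f : laurent) := @Laurent (fun k => m k * f k) _.
Next Obligation. by move=> m f; exists (ldeg f) => k hk; rewrite ldegP ?mulr0. Qed.

Program Definition ltrunc (N : nat) (h : int -> K) :=
  @Laurent (fun k => if (absz k <= N)%N then h k else 0) _.
Next Obligation. by move=> N h; exists N => k; rewrite ltnNge; case: (_ <= _)%N. Qed.

Lemma lmultD m (f g : laurent) : lmult m (f + g) = lmult m f + lmult m g.
Proof. by apply: laurentP => k; rewrite !coeflD /= mulrDr. Qed.

End LaurentDef.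

(** Induction along the ring structure instead of along monomials: bounds, derivatives, evaluation
    and measurability of the nonlinearity are all stable under sums and products. *)
Lemma mpoly_ring_ind n (K : comNzRingType) (P : mpoly.mpoly n K -> Prop) :
  (forall c, P (mpoly.mpolyC n c)) ->
  (forall i, P (mpoly.mpolyX K (mpoly.mnm1 i))) ->
  (forall p q, P p -> P q -> P (p + q)) ->
  (forall p q, P p -> P q -> P (p * q)) ->
  forall p, P p.
Proof.
move=> PC PX PD PM.
have PXn i d : P (mpoly.mpolyX K (mpoly.mnm1 i) ^+ d).
  elim: d => [|d Pd]; last by rewrite exprS; exact: PM.
  by rewrite expr0 -(mpoly.mpolyC1 n K); exact: PC.
elim/mpoly.mpolyind => [|c m p _ _ Pp].
  by rewrite -(mpoly.mpolyC0 n K); exact: PC.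
apply: PD => //; rewrite -mpoly.mul_mpolyC; apply: (PM); first exact: PC.
rewrite mpoly.mpolyXE_id; apply: big_ind => [|p1 q1 P1 Q1|i _]; last exact: PXn.
  by rewrite -(mpoly.mpolyC1 n K); exact: PC.
by apply: PM.
Qed.

Lemma eq_ler (R : numDomainType) (x y : R) : x = y -> x <= y.
Proof. by move=> ->. Qed.

(** * Weighted l^2 spaces of coefficients *)

Section ComplexModulus.
Variable R : realType.
Local Notation C := R[i].
Implicit Types z w : C.

(* The norm [`|z|] of [R[i]] is itself an element of [R[i]]. *)
Definition cn z : R := Num.sqrt (Re z ^+ 2 + Im z ^+ 2).

Lemma cn_ge0 z : 0 <= cn z. Proof. exact: sqrtr_ge0. Qed.

Lemma cn_sq z : cn z ^+ 2 = Re z ^+ 2 + Im z ^+ 2.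
Proof. by rewrite sqr_sqrtr// addr_ge0// sqr_ge0. Qed.

Lemma cn_sqE z : cn z ^+ 2 = abs2 z. Proof. exact: cn_sq. Qed.

Lemma cnE z : cn z = Normc.normc z. Proof. by case: z. Qed.
Lemma cnM z w : cn (z * w) = cn z * cn w. Proof. by rewrite !cnE Normc.normcM. Qed.
Lemma cnD z w : cn (z + w) <= cn z + cn w. Proof. by rewrite !cnE le_normcD. Qed.
Lemma cnN z : cn (- z) = cn z. Proof. by rewrite !cnE normcN. Qed.
Lemma cn0 : cn 0 = 0. Proof. by rewrite cnE Normc.normc0. Qed.
Lemma cn1 : cn 1 = 1. Proof. by rewrite cnE Normc.normc1. Qed.
Lemma cnV z : cn z^-1 = (cn z)^-1. Proof. by rewrite !cnE Normc.normcV. Qed.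
Lemma cnB z w : cn (z - w) <= cn z + cn w.
Proof. by rewrite (le_trans (cnD _ _))// cnN. Qed.
Lemma cnR (x : R) : cn x%:C = `|x|.
Proof. by rewrite /cn /= expr0n addr0 sqrtr_sqr. Qed.

Lemma cnJ z : cn z^* = cn z.
Proof. by case: z => a b; rewrite /cn /= sqrrN. Qed.

Lemma cn_i : cn 'i%C = 1.
Proof. by rewrite /cn /= expr0n add0r expr1n sqrtr1. Qed.

Lemma ge_cn_Re z : `|Re z| <= cn z.
Proof. by rewrite -sqrtr_sqr ler_wsqrtr// lerDl sqr_ge0. Qed.

Lemma ge_cn_Im z : `|Im z| <= cn z.
Proof. by rewrite -sqrtr_sqr ler_wsqrtr// lerDr sqr_ge0. Qed.

Lemma cn_le_ReIm z : cn z <= `|Re z| + `|Im z|.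
Proof.
rewrite -[leRHS]ger0_norm ?addr_ge0// -sqrtr_sqr ler_wsqrtr// sqrrD !real_normK ?num_real//.
by rewrite addrAC lerDl mulrn_wge0// mulr_ge0.
Qed.

Lemma cn_eq0 z : cn z = 0 -> z = 0.
Proof. by rewrite cnE => /Normc.eq0_normc. Qed.

Lemma cn_sum I (r : seq I) (P : pred I) (F : I -> C) :
  cn (\sum_(i <- r | P i) F i) <= \sum_(i <- r | P i) cn (F i).
Proof.
elim/big_ind2: _ => [|x1 x2 y1 y2 h1 h2|//]; first by rewrite cn0.
by rewrite (le_trans (cnD _ _))// lerD.
Qed.

Lemma cn_prodX z n : cn (z ^+ n) = cn z ^+ n.
Proof. by elim: n => [|n IH]; rewrite ?expr0 ?cn1// !exprS cnM IH. Qed.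

Lemma cn_int (k : int) : cn k%:~R = `|k%:~R|.
Proof. by rewrite -cnR; congr cn; rewrite rmorph_int. Qed.

End ComplexModulus.

Section FiniteSums.
Variable R : realType.

(** Lagrange's identity: twice the difference of the two sides is the double sum of
    [b i * b j * (x i - x j) ^+ 2]. *)
Lemma wcauchy_schwarz (I : Type) (s : seq I) (P : pred I) (b x : I -> R) :
  (forall i, 0 <= b i) ->
  (\sum_(i <- s | P i) b i * x i) ^+ 2 <=
  (\sum_(i <- s | P i) b i) * \sum_(i <- s | P i) b i * x i ^+ 2.
Proof.
move=> b0; rewrite -subr_ge0 -(pmulr_rge0 _ (ltr0Sn R 1)).
suff -> : 2 * ((\sum_(i <- s | P i) b i) * (\sum_(i <- s | P i) b i * x i ^+ 2) -
   (\sum_(i <- s | P i) b i * x i) ^+ 2) =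
   \sum_(i <- s | P i) \sum_(j <- s | P j) b i * b j * (x i - x j) ^+ 2.
  by apply: sumr_ge0 => i _; apply: sumr_ge0 => j _; rewrite mulr_ge0 ?sqr_ge0 ?mulr_ge0.
pose S := \sum_(i <- s | P i) b i.
pose S1 := \sum_(i <- s | P i) b i * x i.
pose S2 := \sum_(i <- s | P i) b i * x i ^+ 2.
rewrite -/S -/S1 -/S2.
transitivity (\sum_(i <- s | P i) (b i * x i ^+ 2 * S - b i * x i * (2 * S1) + b i * S2)).
  rewrite big_split sumrB -!big_distrl /= -/S -/S1 -/S2; ring.
apply: eq_bigr => i _; rewrite /S /S1 /S2 !big_distrr /= -sumrB -big_split /=.
by apply: eq_bigr => j _; ring.
Qed.

(** The weighted form with weights [x i ^+ 2] and values [y i / x i]; a term with [x i = 0]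
    contributes 0 to the sum of products. *)
Lemma cauchy_schwarz (I : Type) (s : seq I) (P : pred I) (x y : I -> R) :
  (\sum_(i <- s | P i) x i * y i) ^+ 2 <=
  (\sum_(i <- s | P i) x i ^+ 2) * \sum_(i <- s | P i) y i ^+ 2.
Proof.
have := @wcauchy_schwarz I s P (fun i => x i ^+ 2) (fun i => y i / x i) (fun i => sqr_ge0 _).
have -> : \sum_(i <- s | P i) x i ^+ 2 * (y i / x i) = \sum_(i <- s | P i) x i * y i.
  apply: eq_bigr => i _; have [->|x0] := eqVneq (x i) 0; first by rewrite !mul0r expr0n mul0r.
  by field.
move=> /le_trans; apply; rewrite ler_wpM2l ?sumr_ge0// => [i _|]; first exact: sqr_ge0.
apply: ler_sum => i _; have [->|x0] := eqVneq (x i) 0.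
  by rewrite expr0n mul0r sqr_ge0.
by rewrite expr_div_n mulrCA divff ?mulr1// sqrf_eq0.
Qed.

End FiniteSums.

Lemma uniq_shift (s : seq int) (j : int) : uniq s -> uniq [seq k - j | k <- s].
Proof. by move=> us; rewrite map_inj_uniq// => p q; lia. Qed.

Lemma uniq_refl (s : seq int) (k : int) : uniq s -> uniq [seq k - j | j <- s].
Proof. by move=> us; rewrite map_inj_uniq// => p q; lia. Qed.

Section Bracket.
Variable R : realType.

(** The bracket [1 + |k|]. Unlike the square root of [1 + k^2] it satisfies Peetre's inequality with
    constant 1 ([jb_add]), so no constants accumulate when derivatives are distributed. *)
Definition jb (k : int) : R := (absz k).+1%:R.

Lemma jb_ge1 k : 1 <= jb k. Proof. by rewrite /jb ler1n. Qed.
Lemma jb_gt0 k : 0 < jb k. Proof. by rewrite /jb ltr0n. Qed.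
Lemma jb_ge0 k : 0 <= jb k. Proof. exact: ltW (jb_gt0 k). Qed.
Lemma jbN k : jb (- k) = jb k. Proof. by rewrite /jb abszN. Qed.
Lemma jb_add k j : jb k <= jb (k - j) * jb j.
Proof. by rewrite /jb -natrM ler_nat; nia. Qed.
Lemma jb_int k : `|k%:~R| <= jb k.
Proof. by rewrite -intr_norm -abszE -pmulrn ler_nat. Qed.
Lemma jb_int1 k : jb k = 1 + `|k%:~R|.
Proof. by rewrite -intr_norm -abszE -pmulrn /jb -natr1 addrC. Qed.
Lemma jbz_gt0 k (m : int) : 0 < jb k ^ m. Proof. exact/exprz_gt0/jb_gt0. Qed.
Lemma jbz_ge0 k (m : int) : 0 <= jb k ^ m. Proof. exact/ltW/jbz_gt0. Qed.

Lemma jb_addn (m : nat) k j : jb k ^ m%:Z <= jb (k - j) ^ m%:Z * jb j ^ m%:Z.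
Proof.
rewrite -!exprnP -exprMn lerXn2r ?nnegrE ?mulr_ge0 ?jb_ge0//; exact: jb_add.
Qed.

(** Peetre's inequality for a negative power: one factor may carry order -1 if the other carries
    order 1. *)
Lemma jb_addN k j : jb k ^ (-1) <= jb (k - j) ^ 1 * jb j ^ (-1).
Proof.
rewrite expr1z -!invr_expz !expr1z ler_pdivlMr ?jb_gt0// mulrC ler_pdivrMr ?jb_gt0//.
by have := jb_add j k; rewrite -(jbN (j - k)) opprB.
Qed.

Lemma jb_mono k (m m' : int) : m <= m' -> jb k ^ m <= jb k ^ m'.
Proof. by move=> mm; rewrite ler_weXz2l// jb_ge1. Qed.

End Bracket.

(** What is used of [(1 + k^2)^(s - 2)]: [wt_add] makes the weighted space an algebra, and [wt_sum]
    embeds it into [l^1], which is where [s - 2 > 1/2] enters. *)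
Record weight (R : realType) := Weight {
  wt :> int -> R ;
  CW : R ;
  SW : R ;
  wt_ge1 : forall k, 1 <= wt k ;
  wt_even : forall k, wt (- k) = wt k ;
  CW_ge0 : 0 <= CW ;
  wt_add : forall k j, wt k <= CW * (wt (k - j) + wt j) ;
  SW_ge0 : 0 <= SW ;
  wt_sum : forall s : seq int, uniq s -> \sum_(k <- s) (wt k)^-1 <= SW }.

Section WeightedSequences.
Variables (R : realType) (W : weight R).
Let W_ge1 := wt_ge1 W.
Let CW_ge0 := CW_ge0 W.
Let W_add := wt_add W.
Let SW_ge0 := SW_ge0 W.
Let W_sum := @wt_sum R W.
Local Notation CW := (CW W).
Local Notation SW := (SW W).

Let W_gt0 k : 0 < W k. Proof. exact: lt_le_trans ltr01 (W_ge1 k). Qed.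
Let W_ge0 k : 0 <= W k. Proof. exact: ltW. Qed.

(** A bound on the weighted [l^2] norm, tested on all finite lists of modes, so that no convergence
    has to be established. *)
Definition nbs (M : R) (h : int -> R) : Prop :=
  0 <= M /\ forall s : seq int, uniq s -> \sum_(k <- s) W k * h k ^+ 2 <= M ^+ 2.

Lemma nbs_ge0 M h : nbs M h -> 0 <= M. Proof. by case. Qed.

Lemma nbs_le M M' h h' : nbs M h -> (forall k, `|h' k| <= `|h k|) -> M <= M' -> nbs M' h'.
Proof.
move=> [M0 hM] hh MM; split=> [|s us]; first exact: le_trans MM.
apply: (@le_trans _ _ (M ^+ 2)); last by rewrite ler_sqr ?nnegrE// (le_trans M0).
apply: le_trans (hM s us); apply: ler_sum => k _; rewrite ler_wpM2l//.
by rewrite -[leLHS]real_normK ?num_real// -[leRHS]real_normK ?num_real// ler_sqr ?nnegrE.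
Qed.

Lemma nbs_scale M h a : nbs M h -> nbs (`|a| * M) (fun k => a * h k).
Proof.
move=> [M0 hM]; split=> [|s us]; first by rewrite mulr_ge0.
rewrite exprMn real_normK ?num_real//; apply: le_trans (ler_wpM2l (sqr_ge0 a) (hM s us)).
by rewrite big_distrr /= ler_sum// => k _; rewrite exprMn mulrCA.
Qed.

Lemma nbsD M1 M2 h1 h2 : nbs M1 h1 -> nbs M2 h2 -> nbs (M1 + M2) (fun k => h1 k + h2 k).
Proof.
move=> [M10 H1] [M20 H2]; split=> [|s us]; first exact: addr_ge0.
have {H1}H1 := H1 s us; have {H2}H2 := H2 s us.
have cs : \sum_(k <- s) W k * h1 k * h2 k <= M1 * M2.
  have := @cauchy_schwarz R _ s xpredT (fun k => Num.sqrt (W k) * h1 k)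
            (fun k => Num.sqrt (W k) * h2 k).
  have sW k (h : int -> R) : (Num.sqrt (W k) * h k) ^+ 2 = W k * h k ^+ 2.
    by rewrite exprMn sqr_sqrtr.
  under eq_bigr do rewrite mulrACA -expr2 sqr_sqrtr// mulrA.
  under [X in _ <= X * _]eq_bigr do rewrite sW.
  under [X in _ <= _ * X]eq_bigr do rewrite sW.
  move=> h; apply: le_trans (ler_norm _) _.
  rewrite -(@ler_sqr _ `|_|) ?nnegrE ?mulr_ge0// real_normK ?num_real//.
  apply: le_trans h _; rewrite exprMn ler_pM//; apply: sumr_ge0 => k _;
  by rewrite mulr_ge0// sqr_ge0.
have -> : \sum_(k <- s) W k * (h1 k + h2 k) ^+ 2 = \sum_(k <- s) W k * h1 k ^+ 2 +
   2 * (\sum_(k <- s) W k * h1 k * h2 k) + \sum_(k <- s) W k * h2 k ^+ 2.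
  by rewrite big_distrr /= -!big_split /=; apply: eq_bigr => k _; ring.
by rewrite sqrrD; lra.
Qed.

(** Cauchy-Schwarz against the inverse weight, whose sum is at most [SW]. *)
Lemma nbs_l1 M h s : nbs M h -> uniq s -> \sum_(k <- s) `|h k| <= Num.sqrt SW * M.
Proof.
move=> [M0 hM] us; rewrite -ler_sqr ?nnegrE ?sumr_ge0 ?mulr_ge0 ?sqrtr_ge0//.
rewrite exprMn sqr_sqrtr//.
have := @wcauchy_schwarz R _ s xpredT (fun k => (W k)^-1) (fun k => W k * `|h k|) _.
under eq_bigr do rewrite mulKf ?gt_eqF//.
under [X in _ <= _ * X]eq_bigr => k _.
  rewrite exprMn real_normK ?num_real// [W k ^+ 2]expr2 -mulrA mulKf ?gt_eqF//; over.
move=> h1; apply: le_trans (h1 _) _ => [k|]; first by rewrite invr_ge0.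
rewrite ler_pM ?W_sum ?hM ?sumr_ge0// => k _; first by rewrite invr_ge0.
by rewrite mulr_ge0// sqr_ge0.
Qed.

Lemma nbs_coef M h k : nbs M h -> `|h k| <= M.
Proof.
move=> [M0 /(_ [:: k] isT)]; rewrite big_seq1 => hk.
rewrite -ler_sqr ?nnegrE// real_normK ?num_real//; apply: le_trans hk.
by rewrite ler_peMl// sqr_ge0.
Qed.

(** The constant of Young's inequality [nbs_conv]. The 8 is a product of three factors 2: from
    squaring a sum of two parts, from bounding a sum of two weights by twice the larger one, and
    from adding the two symmetric contributions. *)
Definition KW : R := Num.sqrt (8 * CW * SW).

Lemma KW_ge0 : 0 <= KW. Proof. exact: sqrtr_ge0. Qed.

(* Young's inequality: the weight of [k] sits on the larger of the weights of
   [k - j] and [j], and the other factor is summable. *)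
Lemma nbs_conv M1 M2 (a b h : int -> R) (s : seq int) : uniq s ->
  (forall k, 0 <= a k) -> (forall k, 0 <= b k) -> nbs M1 a -> nbs M2 b ->
  (forall k, `|h k| <= \sum_(j <- s) a (k - j) * b j) ->
  nbs (KW * M1 * M2) h.
Proof.
move=> us a0 b0 na nb hk; have [M10 ha] := na; have [M20 hb] := nb.
split=> [|t ut]; first by rewrite !mulr_ge0 ?KW_ge0.
have al k : \sum_(j <- s) a (k - j) <= Num.sqrt SW * M1.
  have := nbs_l1 na (uniq_refl k us); rewrite big_map.
  by under eq_bigr do rewrite ger0_norm//.
have al' j : \sum_(k <- t) a (k - j) <= Num.sqrt SW * M1.
  have := nbs_l1 na (uniq_shift j ut); rewrite big_map.
  by under eq_bigr do rewrite ger0_norm//.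
have be : \sum_(j <- s) b j <= Num.sqrt SW * M2.
  by have := nbs_l1 nb us; under eq_bigr do rewrite ger0_norm//.
pose B := Num.sqrt SW.
have B0 : 0 <= B by exact: sqrtr_ge0.
pose T1 k := \sum_(j <- s) W (k - j) * a (k - j) ^+ 2 * b j.
pose T2 k := \sum_(j <- s) a (k - j) * (W j * b j ^+ 2).
have key k : W k * h k ^+ 2 <= 4 * CW * (B * M2 * T1 k + B * M1 * T2 k).
  pose P j := W j <= W (k - j).
  pose S1 := \sum_(j <- s | P j) b j * a (k - j).
  pose S2 := \sum_(j <- s | ~~ P j) a (k - j) * b j.
  have hS : `|h k| <= S1 + S2.
    apply: le_trans (hk k) _; rewrite (bigID P) /= lerD2r.
    by apply: ler_sum => j _; rewrite mulrC.
  have hh : h k ^+ 2 <= 2 * S1 ^+ 2 + 2 * S2 ^+ 2.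
    rewrite -real_normK ?num_real//.
    apply: (@le_trans _ _ ((S1 + S2) ^+ 2)).
      by rewrite ler_sqr ?nnegrE// (le_trans _ hS).
    by have := sqr_ge0 (S1 - S2); rewrite sqrrB sqrrD; lra.
  have h1 : W k * S1 ^+ 2 <= 2 * CW * (B * M2 * T1 k).
    have c1 := @wcauchy_schwarz R _ s P b (fun j => a (k - j)) b0.
    apply: le_trans (ler_wpM2l (W_ge0 k) c1) _.
    have c2 : \sum_(j <- s | P j) b j <= B * M2.
      by apply: le_trans be; rewrite [leRHS](bigID P) /= lerDl sumr_ge0.
    have c3 : W k * (\sum_(j <- s | P j) b j * a (k - j) ^+ 2) <= 2 * CW * T1 k.
      rewrite /T1 !big_distrr /= [leRHS](bigID P) /= -[leLHS]addr0 lerD//; last first.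
        by apply: sumr_ge0 => j _; rewrite !mulr_ge0 ?sqr_ge0.
      apply: ler_sum => j Pj.
      have -> : W k * (b j * a (k - j) ^+ 2) = W k * (a (k - j) ^+ 2 * b j) by ring.
      have -> : 2 * CW * (W (k - j) * a (k - j) ^+ 2 * b j) =
                (2 * CW * W (k - j)) * (a (k - j) ^+ 2 * b j) by ring.
      rewrite ler_wpM2r ?mulr_ge0 ?sqr_ge0//.
      apply: le_trans (W_add k j) _; rewrite [2 * _]mulrC -mulrA ler_wpM2l//.
      by move: Pj; rewrite /P; lra.
    rewrite mulrCA; have := ler_pM _ _ c2 c3; rewrite [_ * (2 * CW * _)]mulrCA; apply.
      exact: sumr_ge0.
    by rewrite mulr_ge0// sumr_ge0// => j _; rewrite mulr_ge0// sqr_ge0.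
  have h2 : W k * S2 ^+ 2 <= 2 * CW * (B * M1 * T2 k).
    have c1 := @wcauchy_schwarz R _ s (predC P) (fun j => a (k - j)) b (fun j => a0 _).
    apply: le_trans (ler_wpM2l (W_ge0 k) c1) _.
    have c2 : \sum_(j <- s | ~~ P j) a (k - j) <= B * M1.
      by apply: le_trans (al k); rewrite [leRHS](bigID P) /= lerDr sumr_ge0.
    have c3 : W k * (\sum_(j <- s | ~~ P j) a (k - j) * b j ^+ 2) <= 2 * CW * T2 k.
      rewrite /T2 !big_distrr /= [leRHS](bigID P) /= -[leLHS]add0r lerD//.
        by apply: sumr_ge0 => j _; rewrite !mulr_ge0 ?sqr_ge0.
      apply: ler_sum => j Pj.
      have -> : 2 * CW * (a (k - j) * (W j * b j ^+ 2)) =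
                (2 * CW * W j) * (a (k - j) * b j ^+ 2) by ring.
      rewrite ler_wpM2r ?mulr_ge0 ?sqr_ge0//.
      apply: le_trans (W_add k j) _; rewrite [2 * _]mulrC -mulrA ler_wpM2l//.
      by move: Pj; rewrite /P -ltNge; lra.
    rewrite mulrCA; have := ler_pM _ _ c2 c3; rewrite [_ * (2 * CW * _)]mulrCA; apply.
      by apply: sumr_ge0.
    by rewrite mulr_ge0// sumr_ge0// => j _; rewrite mulr_ge0// sqr_ge0.
  have := ler_wpM2l (W_ge0 k) hh; rewrite mulrDr; nra.
apply: le_trans (ler_sum _ (fun k _ => key k)) _.
rewrite -big_distrr /= big_split /= -!big_distrr /=.
have s1 : \sum_(k <- t) T1 k <= B * M2 * M1 ^+ 2.
  rewrite /T1 exchange_big /=.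
  apply: (@le_trans _ _ (\sum_(j <- s) b j * M1 ^+ 2)).
    apply: ler_sum => j _; rewrite -big_distrl /= mulrC ler_wpM2l//.
    by have := ha _ (uniq_shift j ut); rewrite big_map.
  by rewrite -big_distrl /= ler_wpM2r// sqr_ge0.
have s2 : \sum_(k <- t) T2 k <= B * M1 * M2 ^+ 2.
  rewrite /T2 exchange_big /=.
  apply: (@le_trans _ _ (\sum_(j <- s) B * M1 * (W j * b j ^+ 2))).
    apply: ler_sum => j _; rewrite -big_distrl /= ler_wpM2r ?al'//.
    by rewrite mulr_ge0 ?sqr_ge0.
  by rewrite -big_distrr /= ler_wpM2l ?mulr_ge0// hb.
have BB : B ^+ 2 = SW by rewrite sqr_sqrtr.
have -> : (KW * M1 * M2) ^+ 2 = 4 * CW * (2 * (B ^+ 2 * M1 ^+ 2 * M2 ^+ 2)).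
  by rewrite BB /KW !exprMn sqr_sqrtr ?mulr_ge0//; ring.
rewrite ler_wpM2l ?mulr_ge0//.
have := ler_wpM2l (mulr_ge0 B0 M20) s1; have := ler_wpM2l (mulr_ge0 B0 M10) s2.
by move=> u v; apply: le_trans (lerD v u) _; apply: eq_ler; ring.
Qed.

Lemma nbs_opp M h : nbs M h -> nbs M (fun k => h (- k)).
Proof.
move=> [M0 hM]; split=> // s us.
have := hM [seq - k | k <- s]; rewrite big_map.
under eq_bigr do rewrite wt_even.
by apply; rewrite map_inj_uniq// => p q; lia.
Qed.

Local Notation C := R[i].
Local Notation jb := (jb R).
Implicit Types (f g h : int -> C) (m : int).

(** [m] counts derivatives on top of the weight and may be negative. With the weight of [H^(s-2)],
    level 2 is [H^s], level 0 is the space of [r], and level -1 is [H^(s-3)]. *)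
Definition nb m (M : R) f : Prop := nbs M (fun k => jb k ^ m * cn (f k)).

Lemma nb_ge0 m M f : nb m M f -> 0 <= M. Proof. exact: nbs_ge0. Qed.

Lemma nb_mono m m' M M' f g : nb m M f -> m' <= m -> M <= M' ->
  (forall k, cn (g k) <= cn (f k)) -> nb m' M' g.
Proof.
move=> hf mm MM gf; apply: (nbs_le hf) => // k.
rewrite !ger0_norm ?mulr_ge0 ?jbz_ge0 ?cn_ge0//.
by rewrite ler_pM ?jbz_ge0 ?cn_ge0 ?jb_mono.
Qed.

Lemma nb_eq m M f g : (forall k, cn (g k) = cn (f k)) -> nb m M f -> nb m M g.
Proof. by move=> e hf; apply: (nb_mono hf) => // k; rewrite e. Qed.

Lemma nbD m M1 M2 f g : nb m M1 f -> nb m M2 g -> nb m (M1 + M2) (fun k => f k + g k).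
Proof.
move=> hf hg; apply: (nbs_le (nbsD hf hg)) => // k.
rewrite !ger0_norm ?addr_ge0 ?mulr_ge0 ?jbz_ge0 ?cn_ge0// -mulrDr.
by rewrite ler_wpM2l ?jbz_ge0 ?cnD.
Qed.

Lemma nb_coef m M f k : nb m M f -> cn (f k) <= M * jb k ^ (- m).
Proof.
move=> /(nbs_coef k); rewrite ger0_norm ?mulr_ge0 ?jbz_ge0 ?cn_ge0//.
by rewrite -invr_expz ler_pdivlMr ?jbz_gt0// mulrC.
Qed.

Lemma nb_mult m m' (a : R) (c : int -> C) M f : 0 <= a ->
  (forall k, jb k ^ m' * cn (c k) <= a * jb k ^ m) ->
  nb m M f -> nb m' (a * M) (fun k => c k * f k).
Proof.
move=> a0 hc hf; have := nbs_scale a hf; rewrite ger0_norm// => /nbs_le; apply => // k.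
rewrite !ger0_norm ?mulr_ge0 ?jbz_ge0 ?cn_ge0// cnM mulrA [leRHS]mulrA.
by rewrite ler_wpM2r ?cn_ge0.
Qed.

Lemma nb_scale m M f (c : C) : nb m M f -> nb m (cn c * M) (fun k => c * f k).
Proof. by apply: nb_mult; rewrite ?cn_ge0// => k; rewrite mulrC. Qed.

Lemma nb_conj m M f : nb m M f -> nb m M (fun k => (f (- k))^*).
Proof.
move=> /nbs_opp /nbs_le; apply => // k.
by rewrite cnJ jbN.
Qed.

Lemma nb_conv m1 m2 m M1 M2 f g h s : uniq s ->
  (forall k j, jb k ^ m <= jb (k - j) ^ m1 * jb j ^ m2) ->
  nb m1 M1 f -> nb m2 M2 g ->
  (forall k, cn (h k) <= \sum_(j <- s) cn (f (k - j)) * cn (g j)) ->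
  nb m (KW * M1 * M2) h.
Proof.
move=> us hm hf hg hh; apply: nbs_conv us _ _ hf hg _ => k.
- by rewrite mulr_ge0 ?jbz_ge0 ?cn_ge0.
- by rewrite mulr_ge0 ?jbz_ge0 ?cn_ge0.
rewrite ger0_norm ?mulr_ge0 ?jbz_ge0 ?cn_ge0//.
apply: le_trans (ler_wpM2l (jbz_ge0 R _ _) (hh k)) _.
rewrite big_distrr; apply: ler_sum => j _ /=.
by rewrite mulrACA ler_wpM2r ?mulr_ge0 ?cn_ge0.
Qed.

Lemma nbM_gen m1 m2 m M1 M2 (f g : laurent C) :
  (forall k j, jb k ^ m <= jb (k - j) ^ m1 * jb j ^ m2) ->
  nb m1 M1 f -> nb m2 M2 g -> nb m (KW * M1 * M2) (f * g : laurent C).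
Proof.
move=> hm hf hg; apply: (nb_conv (uniq_win (ldeg g)) hm hf hg) => k.
rewrite (_ : (f * g : laurent C) k = lconv f g k)// /lconv.
by apply: le_trans (cn_sum _ _ _) _; apply: ler_sum => j _; rewrite cnM.
Qed.

Lemma nbM (m : nat) M1 M2 (f g : laurent C) :
  nb m%:Z M1 f -> nb m%:Z M2 g -> nb m%:Z (KW * M1 * M2) (f * g : laurent C).
Proof. exact: nbM_gen (@jb_addn R m). Qed.

(** Level -1 is the level of the time derivative of a coefficient of the equation: such a
    coefficient sits at level 1, and a time derivative costs two x-derivatives. *)
Lemma nbMN M1 M2 (f g : laurent C) :
  nb 1 M1 f -> nb (-1) M2 g -> nb (-1) (KW * M1 * M2) (f * g : laurent C).
Proof. exact: nbM_gen (@jb_addN R). Qed.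

Definition nb1 : R := Num.sqrt (W 0).

Lemma nb_one m : nb m nb1 (1 : laurent C).
Proof.
split; first exact: sqrtr_ge0.
move=> s us; rewrite sqr_sqrtr//.
apply: (@le_trans _ _ (\sum_(k <- s) if k == 0 then W 0 else 0)).
  apply: ler_sum => k _; rewrite [lcoef 1 k]coefl_cst; case: eqP => [->|_]; last by rewrite cn0 mulr0 expr0n mulr0.
  by rewrite cn1 mulr1 /jb absz0 exp1rz expr1n mulr1.
rewrite -big_mkcond -big_filter /=.
have [s0|s0] := boolP (0 \in s).
  rewrite (perm_big [:: 0]) ?big_seq1//; apply: uniq_perm; rewrite ?filter_uniq// => k.
  by rewrite mem_filter mem_seq1; case: eqP => // ->.
rewrite (_ : [seq _ <- _ | _] = [::]) ?big_nil//; apply/eqP; rewrite -(negbK (_ == _)) -has_filter.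
by apply/hasPn => k ks; apply: contraNneq s0 => <-.
Qed.

End WeightedSequences.

Lemma ler_sum_sub (R : numDomainType) (T : eqType) (s t : seq T) (h : T -> R) :
  uniq s -> uniq t -> {subset s <= t} -> (forall k, 0 <= h k) ->
  \sum_(k <- s) h k <= \sum_(k <- t) h k.
Proof.
move=> us ut st h0; rewrite [leRHS](bigID (mem s)) /= -[X in X + _]big_filter.
rewrite [X in _ <= X + _](perm_big s); first by rewrite lerDl sumr_ge0.
apply: uniq_perm; rewrite ?filter_uniq// => k; rewrite mem_filter /=.
by case: (boolP (k \in s)) => // /st ->.
Qed.

(** Each absolute value is taken at most twice, once for each sign. *)
Lemma sum_absz_le (R : numDomainType) (g : nat -> R) (B : R) (s : seq int) :
  (forall n, 0 <= g n) -> (forall D, \sum_(n <- iota 0 D) g n <= B) ->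
  uniq s -> \sum_(k <- s) g (absz k) <= 2 * B.
Proof.
move=> g0 gB us; rewrite (bigID (fun k : int => 0 <= k)) /= mulrDl !mul1r.
have H (P : pred int) : {in P &, injective absz} -> \sum_(k <- s | P k) g (absz k) <= B.
  move=> inj; rewrite -big_filter -(big_map absz xpredT g).
  set t := map _ _; pose D := (\max_(n <- t) n).+1.
  apply: le_trans (gB D); apply: ler_sum_sub => //; rewrite ?iota_uniq//.
    rewrite map_inj_in_uniq ?filter_uniq// => x y.
    by rewrite !mem_filter => /andP[Px _] /andP[Py _]; exact: inj.
  by move=> n nt; rewrite mem_iota /= add0n ltnS; exact: leq_bigmax_seq.
by apply: lerD; apply: H => x y; rewrite /in_mem /=; lia.
Qed.

(** * The Sobolev weight *)

Section Weight.
Variable R : realType.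

(** A discrete integral test. With [a = n + 1] and [b = n + 2], the bounds [ln b - ln a >= 1 / b]
    and [exp y >= 1 + y] make the general term of the series smaller than a telescoping
    difference. *)
Lemma powR_telescope (th : R) (n : nat) : 0 < th ->
  th * n.+2%:R `^ (- (1 + th)) <= n.+1%:R `^ (- th) - n.+2%:R `^ (- th).
Proof.
move=> th0; set a : R := n.+1%:R; set b : R := n.+2%:R.
have a0 : 0 < a by rewrite ltr0n.
have b0 : 0 < b by rewrite ltr0n.
have ab : a = b - 1 by rewrite /a /b -[n.+2%:R]natr1 addrK.
have lnab : b^-1 <= ln b - ln a.
  rewrite -lerN2 opprB -ln_div ?posrE//.
  have -> : a / b = 1 + (- b^-1) by rewrite ab; field; rewrite gt_eqF.
  rewrite le_ln1Dx// ltrN2 invf_lt1// /b ltr1n//.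
have E : a `^ (- th) = b `^ (- th) * expR (th * (ln b - ln a)).
  rewrite /powR !gt_eqF// -expRD; congr expR; ring.
have -> : b `^ (- (1 + th)) = b `^ (- th) * b^-1.
  rewrite -(powR_inv1 (ltW b0)) -powRD ?(gt_eqF b0) ?implybT//; congr powR; ring.
rewrite E -[X in _ - X]mulr1 -mulrBr mulrCA ler_wpM2l ?powR_ge0//.
have := expR_ge1Dx (th * (ln b - ln a)).
have : th * b^-1 <= th * (ln b - ln a) by rewrite ler_wpM2l// ltW.
by move=> h1 h2; rewrite lerBrDl; apply: le_trans h2; rewrite lerD2l.
Qed.

Lemma pseries_le (th : R) (D : nat) : 0 < th ->
  \sum_(n <- iota 0 D) n.+1%:R `^ (- (1 + th)) <= 1 + th^-1.
Proof.
move=> th0.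
have H : forall n, th * \sum_(i <- iota 0 n.+1) i.+1%:R `^ (- (1 + th)) <=
    th + 1 - n.+1%:R `^ (- th).
  elim=> [|n IH]; first by rewrite big_seq1 !powR1 mulr1 addrK.
  rewrite -addn1 iotaD big_cat big_seq1 /= mulrDr.
  by have := lerD IH (powR_telescope n th0); rewrite addrA subrK addn1 add0n.
case: D => [|n]; first by rewrite big_nil addr_ge0// invr_ge0 ltW.
rewrite -(ler_pM2l th0); apply: le_trans (H n) _.
have := powR_ge0 (n.+1%:R : R) (- th); rewrite mulrDr divff ?gt_eqF//; lra.
Qed.

Definition jap2 (k : int) : R := 1 + k%:~R ^+ 2.

Lemma jap2_ge1 k : 1 <= jap2 k. Proof. by rewrite lerDl sqr_ge0. Qed.
Lemma jap2_gt0 k : 0 < jap2 k. Proof. exact: lt_le_trans ltr01 (jap2_ge1 k). Qed.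

Lemma jap2_ge k : jb R k ^+ 2 <= 2 * jap2 k.
Proof.
rewrite jb_int1 /jap2 -[k%:~R ^+ 2]real_normK ?num_real//.
have := sqr_ge0 (`|k%:~R : R| - 1); nra.
Qed.

Definition sobw (sg : R) (k : int) : R := jap2 k `^ sg.

Lemma sobw_gt0 sg k : 0 < sobw sg k. Proof. by rewrite powR_gt0 ?jap2_gt0. Qed.
Lemma sobw_ge0 sg k : 0 <= sobw sg k. Proof. exact/ltW/sobw_gt0. Qed.

Lemma sobw_ge1 sg k : 0 <= sg -> 1 <= sobw sg k.
Proof. by move=> sg0; rewrite -(powRr0 (jap2 k)) ler_powR ?jap2_ge1. Qed.

Lemma sobw_mono sg sg' k : sg <= sg' -> sobw sg k <= sobw sg' k.
Proof. by move=> h; rewrite ler_powR ?jap2_ge1. Qed.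

Lemma sobwD sg sg' k : sobw (sg + sg') k = sobw sg k * sobw sg' k.
Proof. by rewrite /sobw powRD// (gt_eqF (jap2_gt0 k)) /= implybT. Qed.

Lemma sobw_nat (n : nat) k : sobw n%:R k = jap2 k ^+ n.
Proof. by rewrite /sobw powR_mulrn// ltW ?jap2_gt0. Qed.

Lemma sobwN sg k : sobw sg (- k) = sobw sg k.
Proof. by rewrite /sobw /jap2 rmorphN sqrrN. Qed.

(** [1 + k^2] is at most four times the larger of the two other brackets; the power is monotone, and
    a maximum is at most the sum. *)
Lemma sobw_add sg k j : 0 <= sg ->
  sobw sg k <= 4 `^ sg * (sobw sg (k - j) + sobw sg j).
Proof.
move=> sg0; pose M := Num.max (jap2 (k - j)) (jap2 j).
have h : jap2 k <= 4 * M.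
  have e : (k%:~R : R) = (k - j)%:~R + j%:~R by rewrite -rmorphD subrK.
  have : jap2 k <= 2 * jap2 (k - j) + 2 * jap2 j.
    rewrite /jap2 e; have := sqr_ge0 ((k - j)%:~R - j%:~R : R).
    rewrite sqrrB sqrrD; lra.
  have : jap2 (k - j) <= M by rewrite le_max lexx.
  have : jap2 j <= M by rewrite le_max lexx orbT.
  lra.
have M0 : 0 <= M by rewrite le_max (ltW (jap2_gt0 _)).
apply: (@le_trans _ _ ((4 * M) `^ sg)).
  by rewrite ge0_ler_powR ?nnegrE ?mulr_ge0// ltW ?jap2_gt0.
rewrite powRM// ler_wpM2l ?powR_ge0// /M.
by case: (leP (jap2 (k - j)) (jap2 j)) => _; rewrite ?lerDl ?lerDr sobw_ge0.
Qed.

(** Since [(1 + |k|)^2 <= 2 (1 + k^2)], the sum is dominated by the two-sided series of exponent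
    [2 * sg > 1]. *)
Lemma sobw_sum sg (s : seq int) : 2^-1 < sg -> uniq s ->
  \sum_(k <- s) (sobw sg k)^-1 <= 2 * (2 `^ sg * (1 + (2 * sg - 1)^-1)).
Proof.
move=> hsg us; pose g n : R := 2 `^ sg * n.+1%:R `^ (- (1 + (2 * sg - 1))).
have th0 : 0 < 2 * sg - 1 by lra.
have sg0 : 0 <= sg by lra.
apply: (@le_trans _ _ (\sum_(k <- s) g (absz k))).
  apply: ler_sum => k _; rewrite /g powRN.
  have -> : 1 + (2 * sg - 1) = 2 * sg by ring.
  rewrite ler_pdivlMr ?powR_gt0 ?ltr0n// mulrC ler_pdivrMr ?sobw_gt0//.
  rewrite /sobw powRrM powR_mulrn ?ler0n// -powRM ?ler0n ?(ltW (jap2_gt0 _))//.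
  rewrite ge0_ler_powR ?nnegrE ?mulr_ge0 ?exprn_ge0 ?ler0n ?(ltW (jap2_gt0 _))//.
  exact: jap2_ge.
apply: sum_absz_le => // [n|D]; first by rewrite mulr_ge0 ?powR_ge0.
by rewrite -big_distrr /= ler_wpM2l ?powR_ge0// pseries_le.
Qed.

Let half_ge0 (sg : R) : 2^-1 < sg -> 0 <= sg.
Proof. by move=> h; apply: ltW; apply: lt_trans h; rewrite invr_gt0. Qed.

Let sobw_sum_ge0 (sg : R) : 2^-1 < sg -> 0 <= 2 * (2 `^ sg * (1 + (2 * sg - 1)^-1)).
Proof. by move=> h; rewrite !mulr_ge0 ?powR_ge0// addr_ge0// invr_ge0; lra. Qed.

Definition sobolev_weight (sg : R) (hsg : 2^-1 < sg) : weight R :=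
  @Weight R (sobw sg) (4 `^ sg) (2 * (2 `^ sg * (1 + (2 * sg - 1)^-1)))
    (fun k => sobw_ge1 k (half_ge0 hsg)) (sobwN sg) (powR_ge0 _ _)
    (fun k j => sobw_add k j (half_ge0 hsg)) (sobw_sum_ge0 hsg) (fun s us => sobw_sum hsg us).

End Weight.

(** * Truncated exponentials *)

Section TruncatedExponential.

(** The coefficients [w] are left abstract because the same identities serve twice: for
    trigonometric polynomials, and for the real numbers that majorize their norms. *)
Definition texp (S : nzRingType) (w : nat -> S) (n : nat) (x : S) : S :=
  \sum_(m < n.+1) w m * x ^+ m.

Lemma texpS (S : nzRingType) (w : nat -> S) n (x : S) :
  texp w n.+1 x = texp w n x + w n.+1 * x ^+ n.+1.
Proof. by rewrite /texp big_ord_recr. Qed.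

Lemma texpx0 (S : nzRingType) (w : nat -> S) n : texp w n 0 = w 0%N.
Proof.
by rewrite /texp big_ord_recl expr0 mulr1 big1 ?addr0// => i _; rewrite expr0n mulr0.
Qed.

Variables (S : comNzRingType) (w : nat -> S).
(** Satisfied by [1 / m!]; it turns the binomial formula into the addition formula. *)
Hypothesis ww : forall i j, w i * w j = 'C(i + j, i)%:R * w (i + j)%N.

Lemma texp_add n (x y : S) :
  texp w n (x + y) =
  \sum_(i < n.+1) \sum_(j < n.+1 | (i + j <= n)%N) w i * w j * (y ^+ i * x ^+ j).
Proof.
pose F m i := w m * (x ^+ (m - i) * y ^+ i *+ 'C(m, i)).
transitivity (\sum_(m < n.+1) \sum_(i < n.+1 | (i <= m)%N) F m i).
  apply: eq_bigr => m _; rewrite exprDn big_distrr /=.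
  by rewrite (big_ord_widen n.+1 (fun i => F m i)).
rewrite (exchange_big_dep xpredT) //=; apply: eq_bigr => i _.
transitivity (\sum_(i <= m < n.+1) F m i).
  by rewrite [RHS]big_geq_mkord.
rewrite -{1}[nat_of_ord i]add0n big_addn big_mkord.
rewrite (big_ord_widen n.+1 (fun j => F (j + i)%N i)) ?leq_subr//.
apply: eq_big => [j|j _]; first by have := ltn_ord i; lia.
by rewrite /F addnK addnC ww -mulr_natl; ring.
Qed.

(** After truncation the functional equation of the exponential fails exactly by the products of
    total degree above [n]. Over the reals with [w m = 1 / m!] this defect tends to 0. *)
Lemma texpM_sub n (x y : S) :
  texp w n y * texp w n x - texp w n (x + y) =
  \sum_(i < n.+1) \sum_(j < n.+1 | (n < i + j)%N) w i * w j * (y ^+ i * x ^+ j).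
Proof.
rewrite texp_add big_distrl /= -sumrB; apply: eq_bigr => i _.
rewrite big_distrr /= (bigID (fun j : 'I_n.+1 => (i + j <= n)%N)) /= addrAC -sumrB.
rewrite big1 ?add0r => [|j _]; last by ring.
by apply: eq_big => [j|j _]; [rewrite -ltnNge|ring].
Qed.
End TruncatedExponential.

Section RealTruncatedExponential.
Variable R : realType.

Definition ifact (m : nat) : R := (m`!%:R)^-1.

Lemma ifact_ge0 m : 0 <= ifact m. Proof. by rewrite invr_ge0. Qed.

Lemma ifactM (K : numFieldType) i j : (i`!%:R)^-1 * (j`!%:R)^-1 =
  'C(i + j, i)%:R * ((i + j)`!%:R)^-1 :> K.
Proof.
have h : ('C(i + j, i) * (i`! * j`!) = (i + j)`!)%N.
  by rewrite -(bin_fact (leq_addr j i)) addKn.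
rewrite -h !natrM; field.
by rewrite !pnatr_eq0 -!lt0n !fact_gt0 bin_gt0 leq_addr.
Qed.

Lemma texpE n (x : R) : texp ifact n x = series (exp_coeff x) n.+1.
Proof.
rewrite /texp /series /= big_mkord; apply: eq_bigr => i _.
by rewrite /exp_coeff /= mulrC.
Qed.

Lemma texp_cvg (x : R) : texp ifact n x @[n --> \oo] --> expR x.
Proof.
have h : series (exp_coeff x) n @[n --> \oo] --> expR x by exact: is_cvg_series_exp_coeff.
rewrite -(cvg_shiftS (series (exp_coeff x))) in h.
by under eq_fun do rewrite texpE.
Qed.

Lemma texp_le (x : R) n : 0 <= x -> texp ifact n x <= expR x.
Proof.
move=> x0; rewrite -(cvg_lim (@Rhausdorff R) (@texp_cvg x)).
apply: (@nondecreasing_cvgn_le R (fun n => texp ifact n x)); last first.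
  by apply/cvg_ex; exists (expR x); exact: texp_cvg.
by apply/nondecreasing_seqP => m; rewrite texpS lerDl mulr_ge0 ?ifact_ge0 ?exprn_ge0.
Qed.

Lemma texpM_cvg (x : R) :
  texp ifact n x * texp ifact n x - texp ifact n (x + x) @[n --> \oo] --> 0.
Proof.
have e : 0 = expR x * expR x - expR (x + x) by rewrite expRD subrr.
rewrite [X in _ --> X]e; apply: cvgB; last exact: texp_cvg.
by apply: cvgM; exact: texp_cvg.
Qed.

Lemma exp_term_cvg (x : R) : ifact n * x ^+ n @[n --> \oo] --> 0.
Proof.
have := cvg_series_cvg_0 (is_cvg_series_exp_coeff x).
by rewrite (_ : exp_coeff x = fun n => ifact n * x ^+ n)//; apply/funext => n;
  rewrite /exp_coeff /= mulrC.
Qed.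

End RealTruncatedExponential.

Section LaurentExponential.
Variables (R : realType) (W : weight R).
Local Notation C := R[i].
Local Notation KW := (KW W).
Implicit Types (f g L : laurent C).

Definition lfact (m : nat) : laurent C := lcst (m`!%:R)^-1.

Lemma lfactM i j : lfact i * lfact j = 'C(i + j, i)%:R * lfact (i + j)%N.
Proof. by rewrite /lfact -!rmorphM ifactM rmorphM rmorph_nat. Qed.

Lemma cn_ifact m : cn ((m`!%:R)^-1 : C) = ifact R m.
Proof.
rewrite cnV /ifact -[m`!%:R in LHS](rmorph_nat (real_complex R)) cnR ger0_norm//.
Qed.

Lemma nb_cstM m M f c : nb W m M f -> nb W m (cn c * M) (lcst c * f : laurent C).
Proof. by move=> h; apply: nb_eq (nb_scale c h) => k; rewrite coefl_cstM. Qed.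

Lemma nb_pow (m : nat) M L i : nb W m%:Z M L ->
  nb W m%:Z (nb1 W * (KW * M) ^+ i) (L ^+ i : laurent C).
Proof.
move=> hL; elim: i => [|i IH]; first by rewrite !expr0 mulr1; exact: nb_one.
rewrite !exprS (_ : _ * _ = KW * M * (nb1 W * (KW * M) ^+ i)); last by ring.
exact: nbM.
Qed.

Lemma nb_sum m (I : Type) (r : seq I) (P : pred I) (M : I -> R) (f : I -> laurent C) :
  (forall i, P i -> nb W m (M i) (f i)) ->
  nb W m (\sum_(i <- r | P i) M i) (\sum_(i <- r | P i) f i : laurent C).
Proof.
move=> h; elim/big_rec2: _ => [|i y M1 Pi IH]; last exact: nbD (h i Pi) IH.
split=> // s us; rewrite expr0n big1// => k _.
by rewrite /= cn0 mulr0 expr0n mulr0.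
Qed.

Lemma nb_texp_term (m : nat) M L i : nb W m%:Z M L ->
  nb W m%:Z (nb1 W * (ifact R i * (KW * M) ^+ i)) (lfact i * L ^+ i : laurent C).
Proof.
by move=> hL; have := nb_cstM (i`!%:R)^-1 (nb_pow i hL); rewrite cn_ifact mulrCA.
Qed.

Lemma nb_texp (m : nat) M L n : nb W m%:Z M L ->
  nb W m%:Z (nb1 W * texp (ifact R) n (KW * M)) (texp lfact n L : laurent C).
Proof.
move=> hL; rewrite /texp big_distrr /=; apply: nb_sum => i _; exact: nb_texp_term.
Qed.

(** The defect of [texpM_sub] is a sum of powers of [L] with signed coefficients [1 / (i! j!)], so
    its norm is at most the same defect evaluated at the number [X], where all terms are
    nonnegative. *)
Lemma nb_texp_inv (m : nat) M L n : nb W m%:Z M L ->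
  let X := KW * M in
  nb W m%:Z (nb1 W * (texp (ifact R) n X * texp (ifact R) n X - texp (ifact R) n (X + X)))
    (texp lfact n (- L) * texp lfact n L - 1 : laurent C).
Proof.
move=> hL X.
have -> : (1 : laurent C) = texp lfact n (L - L).
  by rewrite subrr texpx0 /lfact fact0 invr1.
rewrite (texpM_sub lfactM) (texpM_sub (fun i j => ifactM R i j)).
rewrite big_distrr /=; apply: nb_sum => i _; rewrite big_distrr /=; apply: nb_sum => j _.
have -> : lfact i * lfact j * ((- L) ^+ i * L ^+ j) =
   lcst ((-1) ^+ i * ((i`!%:R)^-1 * (j`!%:R)^-1)) * L ^+ (i + j).
  rewrite -(mulN1r L) exprMn exprD !rmorphM rmorphXn rmorphN1 -/(lfact i) -/(lfact j); ring.
have := nb_cstM ((-1) ^+ i * ((i`!%:R)^-1 * (j`!%:R)^-1)) (nb_pow (i + j) hL).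
rewrite !cnM cn_prodX cnN cn1 expr1n mul1r !cn_ifact exprD mulrCA.
by rewrite -!mulrA.
Qed.

End LaurentExponential.

Lemma mderiv_var n (K : comNzRingType) (i j : 'I_n) :
  mpoly.mderiv j (mpoly.mpolyX K (mpoly.mnm1 i)) = mpoly.mpolyC n (i == j)%:R.
Proof.
rewrite mpoly.mderivX mpoly.mnm1E -mpoly.mul_mpolyC.
case: eqP => [->|_]; last by rewrite mpoly.mpolyC0 mul0r.
rewrite (_ : mpoly.mnm_sub _ _ = mpoly.mnm0) ?mpoly.mpolyX0 ?mulr1//.
by apply/mpoly.mnmP => l; rewrite mpoly.mnmBE subnn mpoly.mnm0E.
Qed.

(** * Derivatives of trigonometric polynomials *)

Section LaurentOperators.
Variable R : realType.
Local Notation C := R[i].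
Local Notation L := (laurent C).
Implicit Types (f g : L) (k : int).

Definition ldx (f : L) : L := lmult (fun k => 'i%C * k%:~R) f.
(* The mode [0] is dropped, because [0^-1 = 0]. *)
Definition lint (f : L) : L := lmult (fun k => ('i%C * k%:~R)^-1) f.

Lemma coefl_ldx f k : ldx f k = 'i%C * k%:~R * f k. Proof. by []. Qed.

Lemma ldxD f g : ldx (f + g) = ldx f + ldx g. Proof. exact: lmultD. Qed.
Lemma ldx_cst c : ldx (lcst c) = 0.
Proof.
apply: laurentP => k; rewrite coefl_ldx /=.
by case: eqP => [->|_]; rewrite ?mulr0// mul0r.
Qed.

Lemma ldxM f g : ldx (f * g) = ldx f * g + f * ldx g.
Proof.
apply: laurentP => k; rewrite coeflD coefl_ldx.
have h (f' g' : L) : (forall j, f j = 0 -> f' j = 0) -> (forall j, g j = 0 -> g' j = 0) ->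
    (f' * g') k = \sum_(j <- win (ldeg g)) f' (k - j) * g' j.
  move=> _ gg; apply: coeflM => [|j]; first exact: uniq_win.
  move=> gj _; rewrite mem_win; apply: ldeg_mem; apply: contra gj => /eqP gj.
  by rewrite gg.
have z (f' : L) j : f' j = 0 -> ldx f' j = 0 by rewrite coefl_ldx => ->; rewrite mulr0.
rewrite !h; do ?[by []|exact: z]; rewrite big_distrr -big_split /=.
apply: eq_bigr => j _.
have -> : (k%:~R : C) = (k - j)%:~R + j%:~R by rewrite -rmorphD subrK.
ring.
Qed.

Lemma ldx_cstM c f : ldx (lcst c * f) = lcst c * ldx f.
Proof. by rewrite ldxM ldx_cst mul0r add0r. Qed.

Lemma ldx_lint f : ldx (lint f) = f - lcst (f 0).
Proof.
apply: laurentP => k; rewrite coefl_ldx coeflB coefl_cst /=.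
have [->|k0] := eqVneq k 0; first by rewrite mulr0 mul0r subrr.
rewrite subr0 mulrA divff ?mul1r// mulf_neq0 ?intr_eq0//.
by apply/eqP => /(congr1 (@Im R)) /= /eqP; rewrite oner_eq0.
Qed.

Lemma ldx_pow f n : ldx (f ^+ n.+1) = n.+1%:R * f ^+ n * ldx f.
Proof.
elim: n => [|n IH]; first by rewrite expr1 expr0 !mul1r.
rewrite exprS ldxM IH -[n.+2%:R]natr1 exprS; ring.
Qed.

Lemma lfactS m : lfact R m.+1 * m.+1%:R = lfact R m.
Proof.
rewrite /lfact -(rmorph_nat (@lcst C)) -rmorphM; congr lcst.
by rewrite factS natrM invfM mulrAC mulVf ?mul1r// pnatr_eq0.
Qed.

(** Differentiation lowers the order of truncation by one. As the gauge is differentiated twice, the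
    orders [n + 2], [n + 1] and [n] occur side by side in [gauge_identity]. *)
Lemma ldx_texp f n : ldx (texp (lfact R) n.+1 f) = texp (lfact R) n f * ldx f.
Proof.
have ld m g : ldx (lfact R m * g) = lfact R m * ldx g by exact: ldx_cstM.
have l0 : ldx (lfact R 0) = 0 by exact: ldx_cst.
elim: n => [|n IH]; rewrite texpS ldxD ld ldx_pow.
  have -> : texp (lfact R) 0 f = lfact R 0 by rewrite /texp big_ord1 expr0 mulr1.
  by rewrite l0 -(lfactS 0); ring.
by rewrite IH [in RHS]texpS -(lfactS n.+1); ring.
Qed.

Lemma ldx_mmap n (X : 'I_n -> L) (F : mpoly.mpoly n C) :
  ldx (mpoly.mmap (@lcst C) X F) =
  \sum_(i < n) mpoly.mmap (@lcst C) X (mpoly.mderiv i F) * ldx (X i).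
Proof.
elim/mpoly_ring_ind: F => [c|i|p q hp hq|p q hp hq].
- by rewrite mpoly.mmapC ldx_cst big1// => i _; rewrite mpoly.mderivC mpoly.mmap0 mul0r.
- rewrite mpoly.mmapX mpoly.mmap1U (bigD1 i)//= big1 => [|j ji].
    by rewrite mderiv_var eqxx mpoly.mmapC rmorph1 mul1r addr0.
  by rewrite mderiv_var eq_sym (negbTE ji) mpoly.mpolyC0 mpoly.mmap0 mul0r.
- rewrite mpoly.mmapD ldxD hp hq -big_split /=; apply: eq_bigr => i _.
  by rewrite mpoly.mderivD mpoly.mmapD mulrDl.
- rewrite rmorphM /= ldxM hp hq big_distrl big_distrr -big_split /=.
  apply: eq_bigr => i _; rewrite mpoly.mderivM mpoly.mmapD !rmorphM /=; ring.
Qed.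

End LaurentOperators.

(** * Differentiation in time *)

Section TimeDerivative.
Variable R : realType.
Local Notation C := R[i].
Local Notation L := (laurent C).

Definition is_cder (f f' : R -> C) : Prop :=
  (forall t : R, is_derive t (1 : R) (fun t => Re (f t)) (Re (f' t))) /\
  (forall t : R, is_derive t (1 : R) (fun t => Im (f t)) (Im (f' t))).

Lemma cReD (z w : C) : Re (z + w) = Re z + Re w. Proof. by case: z w => ? ? []. Qed.
Lemma cImD (z w : C) : Im (z + w) = Im z + Im w. Proof. by case: z w => ? ? []. Qed.
Lemma cReM (z w : C) : Re (z * w) = Re z * Re w - Im z * Im w.
Proof. by case: z w => ? ? []. Qed.
Lemma cImM (z w : C) : Im (z * w) = Re z * Im w + Im z * Re w.
Proof. by case: z w => ? ? []. Qed.
Lemma cReN (z : C) : Re (- z) = - Re z. Proof. by case: z. Qed.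
Lemma cImN (z : C) : Im (- z) = - Im z. Proof. by case: z. Qed.
Lemma cReJ (z : C) : Re z^* = Re z. Proof. by case: z. Qed.
Lemma cImJ (z : C) : Im z^* = - Im z. Proof. by case: z. Qed.

Lemma is_cder_ext f f' g g' : f =1 g -> f' =1 g' -> is_cder f f' -> is_cder g g'.
Proof. by move=> /funext <- /funext <-. Qed.

Lemma is_cder_cst (c : C) : is_cder (fun=> c) (fun=> 0).
Proof. by split=> t; exact: is_derive_cst. Qed.

Lemma is_cderD f f' g g' : is_cder f f' -> is_cder g g' ->
  is_cder (fun t => f t + g t) (fun t => f' t + g' t).
Proof.
move=> [f1 f2] [g1 g2]; split=> t.
  rewrite (_ : (fun t => _) = (fun t => Re (f t)) + (fun t => Re (g t))); last first.
    by apply/funext => u /=; rewrite cReD.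
  by rewrite cReD; exact: is_deriveD.
rewrite (_ : (fun t => _) = (fun t => Im (f t)) + (fun t => Im (g t))); last first.
  by apply/funext => u /=; rewrite cImD.
by rewrite cImD; exact: is_deriveD.
Qed.

Lemma is_cderM f f' g g' : is_cder f f' -> is_cder g g' ->
  is_cder (fun t => f t * g t) (fun t => f' t * g t + f t * g' t).
Proof.
move=> [f1 f2] [g1 g2]; split=> t.
  have := is_deriveB (is_deriveM (f1 t) (g1 t)) (is_deriveM (f2 t) (g2 t)).
  congr is_derive; last by rewrite cReD !cReM /GRing.scale /=; ring.
  by apply/funext => u; rewrite cReM.
have := is_deriveD (is_deriveM (f1 t) (g2 t)) (is_deriveM (f2 t) (g1 t)).
congr is_derive; last by rewrite cImD !cImM /GRing.scale /=; ring.
by apply/funext => u; rewrite cImM.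
Qed.

Lemma is_cder_scale c f f' : is_cder f f' -> is_cder (fun t => c * f t) (fun t => c * f' t).
Proof.
move=> hf; apply: is_cder_ext (is_cderM (is_cder_cst c) hf) => t //=.
by rewrite mul0r add0r.
Qed.

Lemma is_cder_conj f f' : is_cder f f' -> is_cder (fun t => (f t)^*) (fun t => (f' t)^*).
Proof.
move=> [f1 f2]; split=> t; first by rewrite cReJ; under eq_fun do rewrite cReJ; exact: f1.
by rewrite cImJ; under eq_fun do rewrite cImJ; exact: is_deriveN.
Qed.

Lemma is_cder_sum (I : Type) (s : seq I) (f f' : I -> R -> C) :
  (forall i, is_cder (f i) (f' i)) ->
  is_cder (fun t => \sum_(i <- s) f i t) (fun t => \sum_(i <- s) f' i t).
Proof.
move=> h; elim: s => [|i s IH].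
  by apply: is_cder_ext (is_cder_cst 0) => t; rewrite big_nil.
by apply: is_cder_ext (is_cderD (h i) IH) => t; rewrite big_cons.
Qed.

Lemma is_derive_abs2 f f' : is_cder f f' -> forall t : R,
  is_derive t (1 : R) (fun t => cn (f t) ^+ 2)
    (2 * (Re (f t) * Re (f' t) + Im (f t) * Im (f' t))).
Proof.
move=> [f1 f2] t.
have := is_deriveD (is_deriveM (f1 t) (f1 t)) (is_deriveM (f2 t) (f2 t)).
congr is_derive; last by rewrite /GRing.scale /=; ring.
by apply/funext => u; rewrite cn_sq -!expr2.
Qed.

(* The degree is bounded uniformly in time, so that sums over modes are finite. *)
Definition Dt (f f' : R -> L) : Prop :=
  (exists D, forall t k, (D < absz k)%N -> f t k = 0 /\ f' t k = 0) /\
  forall k, is_cder (fun t => f t k) (fun t => f' t k).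

Lemma Dt_ext f f' g g' : f =1 g -> f' =1 g' -> Dt f f' -> Dt g g'.
Proof. by move=> /funext <- /funext <-. Qed.

Lemma Dt_cst (c : L) : Dt (fun=> c) (fun=> 0).
Proof.
split=> [|k]; last exact: is_cder_cst.
by exists (ldeg c) => t k hk; rewrite ldegP.
Qed.

Lemma DtD f f' g g' : Dt f f' -> Dt g g' -> Dt (fun t => f t + g t) (fun t => f' t + g' t).
Proof.
move=> [ [Df hf] f1] [ [Dg hg] g1]; split=> [|k]; last exact: is_cderD.
exists (Df + Dg)%N => t k hk; rewrite !coeflD.
have [|-> ->] := hf t k; first lia.
by have [|-> ->] := hg t k; [lia|rewrite !addr0].
Qed.

Lemma DtM f f' g g' : Dt f f' -> Dt g g' ->
  Dt (fun t => f t * g t) (fun t => f' t * g t + f t * g' t).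
Proof.
move=> [ [Df hf] f1] [ [Dg hg] g1].
have E (f0 g0 : L) k : (forall j, (Dg < absz j)%N -> g0 j = 0) ->
    (f0 * g0) k = \sum_(j <- win Dg) f0 (k - j) * g0 j.
  move=> h; apply: coeflM; first exact: uniq_win.
  by move=> j gj _; rewrite mem_win leqNgt; apply: contra gj => /h ->.
have hg1 t j : (Dg < absz j)%N -> g t j = 0 by move=> /(hg t) [].
have hg2 t j : (Dg < absz j)%N -> g' t j = 0 by move=> /(hg t) [].
split=> [|k].
  exists (Df + Dg)%N => t k hk.
  have z (f0 g0 : L) : (forall j, (Df < absz j)%N -> f0 j = 0) ->
      (forall j, (Dg < absz j)%N -> g0 j = 0) -> (f0 * g0) k = 0.
    move=> hf0 hg0; rewrite E// big_seq big1// => j; rewrite mem_win => hj.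
    by rewrite hf0 ?mul0r//; lia.
  have hf1 j : (Df < absz j)%N -> f t j = 0 by move=> /(hf t) [].
  have hf2 j : (Df < absz j)%N -> f' t j = 0 by move=> /(hf t) [].
  by rewrite coeflD !z ?addr0//; do ?[exact: hf1|exact: hf2|exact: hg1|exact: hg2].
have h := is_cder_sum (win Dg) (fun j => is_cderM (f1 (k - j)) (g1 j)).
apply: is_cder_ext h => t; cbv beta.
  by apply/esym/E; exact: hg1.
by rewrite coeflD big_split; congr (_ + _); apply/esym/E; [exact: hg1|exact: hg2].
Qed.

Lemma Dt_cstM c f f' : Dt f f' -> Dt (fun t => lcst c * f t) (fun t => lcst c * f' t).
Proof.
move=> hf; apply: Dt_ext (DtM (Dt_cst (lcst c)) hf) => t //=.
by rewrite mul0r add0r.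
Qed.

Lemma Dt_lmult m f f' : Dt f f' -> Dt (fun t => lmult m (f t)) (fun t => lmult m (f' t)).
Proof.
move=> [ [D hf] f1]; split=> [|k]; last exact: is_cder_scale.
by exists D => t k /(hf t) [/= -> ->]; rewrite mulr0.
Qed.

Lemma Dt_pow f f' n : Dt f f' ->
  Dt (fun t => f t ^+ n.+1) (fun t => n.+1%:R * f t ^+ n * f' t).
Proof.
move=> hf; elim: n => [|n IH].
  by apply: Dt_ext hf => t; rewrite ?expr1 ?expr0 ?mul1r.
apply: Dt_ext (DtM hf IH) => t; first by rewrite -exprS.
by rewrite -[n.+2%:R]natr1 exprS; ring.
Qed.

Lemma Dt_texp f f' n : Dt f f' ->
  Dt (fun t => texp (lfact R) n.+1 (f t)) (fun t => texp (lfact R) n (f t) * f' t).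
Proof.
move=> hf; elim: n => [|n IH].
  apply: Dt_ext (DtD (Dt_cst (lfact R 0)) (Dt_cstM (1`!%:R)^-1 (Dt_pow 0 hf))) => t.
    by rewrite texpS /texp big_ord1 expr0 mulr1.
  rewrite add0r expr0 mulr1 /texp big_ord1 expr0 mulr1 /lfact fact0 /= invr1.
  by rewrite !mul1r.
apply: Dt_ext (DtD IH (Dt_cstM (n.+2`!%:R)^-1 (Dt_pow n.+1 hf))) => t.
  by rewrite [RHS]texpS.
rewrite [in RHS]texpS -/(lfact R n.+2) -(lfactS R n.+1); ring.
Qed.

Lemma Dt_mmap n (X X' : 'I_n -> R -> L) (F : mpoly.mpoly n C) :
  (forall i, Dt (X i) (X' i)) ->
  Dt (fun t => mpoly.mmap (@lcst C) (X^~ t) F)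
     (fun t => \sum_(i < n) mpoly.mmap (@lcst C) (X^~ t) (mpoly.mderiv i F) * X' i t).
Proof.
move=> hX; elim/mpoly_ring_ind: F => [c|i|p q hp hq|p q hp hq].
- apply: Dt_ext (Dt_cst (lcst c)) => t; first by rewrite mpoly.mmapC.
  by rewrite big1// => i _; rewrite mpoly.mderivC mpoly.mmap0 mul0r.
- apply: Dt_ext (hX i) => t; first by rewrite mpoly.mmapX mpoly.mmap1U.
  rewrite (bigD1 i)//= big1 => [|j ji].
    by rewrite mderiv_var eqxx mpoly.mmapC rmorph1 mul1r addr0.
  by rewrite mderiv_var eq_sym (negbTE ji) mpoly.mpolyC0 mpoly.mmap0 mul0r.
- apply: Dt_ext (DtD hp hq) => t; first by rewrite mpoly.mmapD.
  rewrite -big_split /=; apply: eq_bigr => i _.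
  by rewrite mpoly.mderivD mpoly.mmapD mulrDl.
- apply: Dt_ext (DtM hp hq) => t; first by rewrite rmorphM.
  rewrite big_distrl big_distrr -big_split /=.
  apply: eq_bigr => i _; rewrite mpoly.mderivM mpoly.mmapD !rmorphM /=; ring.
Qed.

End TimeDerivative.

(** * Gauge transformation and normal form *)

Section Families.
Variables (R : realType) (W : weight R) (P : Type) (D : set P).
Local Notation C := R[i].
Local Notation L := (laurent C).
Implicit Types (f g : P -> L) (m : int).

(** The parameter will be a pair of a truncation level and a time, so that this is boundedness
    uniform in both. *)
Definition bl m f : Prop := exists M, forall p, D p -> nb W m M (f p).

Lemma bl_eq m f g : (forall p, f p = g p) -> bl m f -> bl m g.
Proof. by move=> /funext ->. Qed.

Lemma bl_mono m m' f : m' <= m -> bl m f -> bl m' f.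
Proof. by move=> mm [M h]; exists M => p /h hp; exact: (nb_mono hp). Qed.

Lemma blD m f g : bl m f -> bl m g -> bl m (fun p => f p + g p).
Proof. by move=> [M h] [M' h']; exists (M + M') => p Dp; apply: nbD (h _ Dp) (h' _ Dp). Qed.

Lemma blM (m : nat) f g : bl m%:Z f -> bl m%:Z g -> bl m%:Z (fun p => f p * g p).
Proof.
by move=> [M h] [M' h']; exists (KW W * M * M') => p Dp; exact: nbM (h _ Dp) (h' _ Dp).
Qed.

Lemma blMN f g : bl 1 f -> bl (-1) g -> bl (-1) (fun p => f p * g p).
Proof.
by move=> [M h] [M' h']; exists (KW W * M * M') => p Dp; exact: nbMN (h _ Dp) (h' _ Dp).
Qed.

Lemma bl_cstM m f (c : P -> C) : (exists c0, forall p, D p -> cn (c p) <= c0) ->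
  bl m f -> bl m (fun p => lcst (c p) * f p).
Proof.
move=> [c0 hc] [M h]; exists (c0 * M) => p Dp.
apply: (nb_mono (nb_cstM (c p) (h p Dp))) => //.
by rewrite ler_wpM2r ?hc// (nb_ge0 (h p Dp)).
Qed.

Lemma bl_cst1M m f c : bl m f -> bl m (fun p => lcst c * f p).
Proof. by apply: bl_cstM; exists (cn c). Qed.

Lemma bl_opp m f : bl m f -> bl m (fun p => - f p).
Proof. by move=> [M h]; exists M => p Dp; apply: nb_eq (h p Dp) => k; rewrite cnN. Qed.

Lemma bl_one m : bl m (fun=> 1).
Proof. by exists (nb1 W) => p _; exact: nb_one. Qed.

Lemma bl_cst m c : bl m (fun=> lcst c).
Proof. by apply: bl_eq (bl_cst1M c (bl_one m)) => p; rewrite mulr1. Qed.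

Lemma bl_sum m I (r : seq I) (f : I -> P -> L) : (forall i, bl m (f i)) ->
  bl m (fun p => \sum_(i <- r) f i p).
Proof.
move=> h; elim: r => [|i r IH].
  exists (cn 0 * nb1 W) => p _; rewrite big_nil.
  by apply: nb_eq (nb_scale 0 (nb_one W m)) => k; rewrite mul0r.
by apply: bl_eq (blD (h i) IH) => p; rewrite big_cons.
Qed.

Lemma cn_ik (k : int) : cn ('i%C * k%:~R : C) = `|k%:~R|.
Proof. by rewrite cnM cn_i mul1r cn_int. Qed.

Lemma bl_dx m f : bl m f -> bl (m - 1) (fun p => ldx (f p)).
Proof.
move=> [M h]; exists (1 * M) => p Dp; apply: nb_mult (h p Dp) => // k.
rewrite cn_ik mul1r -[in leRHS](subrK 1 m) [leRHS]expfzDr ?gt_eqF ?jb_gt0// expr1z.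
by rewrite ler_wpM2l ?jbz_ge0// jb_int.
Qed.

(** The 2 comes from [1 + |k| <= 2 |k|] for [k] nonzero; the zero mode is dropped by [lint]. *)
Lemma bl_int m f : bl m f -> bl (m + 1) (fun p => lint (f p)).
Proof.
move=> [M h]; exists (2 * M) => p Dp; apply: nb_mult (h p Dp) => // k.
rewrite cnV cn_ik expfzDr ?gt_eqF ?jb_gt0// expr1z [2 * _]mulrC -mulrA.
rewrite ler_wpM2l ?jbz_ge0//; have [->|k0] := eqVneq k 0.
  by rewrite normr0 invr0 mulr0.
have k1 : 1 <= `|k%:~R : R| by rewrite -intr_norm ler1z; lia.
by rewrite ler_pdivrMr ?(lt_le_trans ltr01 k1)// jb_int1; lra.
Qed.

Lemma bl_coef m f : bl m f -> exists c, forall p k, D p -> cn (f p k) <= c * jb R k ^ (- m).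
Proof. by move=> [M h]; exists M => p k Dp; exact: nb_coef (h p Dp). Qed.

Lemma bl_mmap (m : nat) n (X : P -> 'I_n -> L) (F : mpoly.mpoly n C) :
  (forall i, bl m%:Z (X^~ i)) -> bl m%:Z (fun p => mpoly.mmap (@lcst C) (X p) F).
Proof.
move=> hX; elim/mpoly_ring_ind: F => [c|i|p q hp hq|p q hp hq].
- by apply: bl_eq (bl_cst m c) => p; rewrite mpoly.mmapC.
- by apply: bl_eq (hX i) => p; rewrite mpoly.mmapX mpoly.mmap1U.
- by apply: bl_eq (blD hp hq) => r; rewrite mpoly.mmapD.
- by apply: bl_eq (blM hp hq) => r; rewrite rmorphM.
Qed.

(** The order may grow with the parameter: the full exponential majorizes all truncations at
    once. *)
Lemma bl_texp (m : nat) f (n : P -> nat) : bl m%:Z f ->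
  bl m%:Z (fun p => texp (lfact R) (n p) (f p)).
Proof.
move=> [M h]; exists (nb1 W * expR (KW W * M)) => p Dp.
apply: (nb_mono (nb_texp (n p) (h p Dp))) => //.
by rewrite ler_wpM2l ?sqrtr_ge0// texp_le// mulr_ge0 ?KW_ge0// (nb_ge0 (h p Dp)).
Qed.

End Families.

(** A Fatou property for coefficientwise limits. On a fixed list the error [e] is taken so small
    that its weighted contribution is at most 1; [2 * M + 1] leaves room for
    [(x + y)^2 <= 2 x^2 + 2 y^2]. *)
Lemma nb_lim (R : realType) (W : weight R) m M (f : int -> R[i]) :
  (forall e, 0 < e -> exists2 g, nb W m M g & forall k, cn (f k - g k) <= e) ->
  nb W m (2 * M + 1) f.
Proof.
move=> hf; have M0 : 0 <= M by have [g /nb_ge0] := hf 1 ltr01.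
split=> [|s us]; first by rewrite addr_ge0 ?mulr_ge0.
pose c := 1 + \sum_(k <- s) W k * (jb R k ^ m) ^+ 2.
have W0 k : 0 <= W k by exact: le_trans ler01 (wt_ge1 W k).
have c0 : 0 < c by rewrite /c ltr_wpDr// sumr_ge0// => k _; rewrite mulr_ge0 ?sqr_ge0.
pose e := (2 * c)^-1.
have e0 : 0 < e by rewrite invr_gt0 mulr_gt0.
have [g [_ hg] fg] := hf e e0.
apply: (@le_trans _ _ (2 * \sum_(k <- s) W k * (jb R k ^ m * cn (g k)) ^+ 2 +
   2 * e ^+ 2 * \sum_(k <- s) W k * (jb R k ^ m) ^+ 2)).
  rewrite !big_distrr -big_split /=; apply: ler_sum => k _.
  have h1 : cn (f k) <= cn (g k) + e.
    by rewrite -{1}(subrK (g k) (f k)) addrC (le_trans (cnD _ _))// lerD2l.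
  have h2 : cn (f k) ^+ 2 <= 2 * cn (g k) ^+ 2 + 2 * e ^+ 2.
    have : cn (f k) ^+ 2 <= (cn (g k) + e) ^+ 2.
      by rewrite ler_sqr ?nnegrE ?addr_ge0 ?cn_ge0// ltW.
    have := sqr_ge0 (cn (g k) - e); rewrite sqrrB sqrrD; lra.
  rewrite (_ : W k * _ = W k * (jb R k ^ m) ^+ 2 * cn (f k) ^+ 2); last by ring.
  apply: le_trans (ler_wpM2l (mulr_ge0 (W0 k) (sqr_ge0 (jb R k ^ m))) h2) _.
  by apply: eq_ler; ring.
have h1 := hg s us.
have h2 : 2 * e ^+ 2 * \sum_(k <- s) W k * (jb R k ^ m) ^+ 2 <= 1.
  apply: (@le_trans _ _ (2 * e ^+ 2 * c)); first by apply: ler_wpM2l; [rewrite mulr_ge0 ?sqr_ge0|rewrite /c lerDr].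
  have -> : 2 * e ^+ 2 * c = e by rewrite /e; field; rewrite gt_eqF.
  rewrite /e invf_le1 ?mulr_gt0//.
  have : 1 <= c by rewrite /c lerDl sumr_ge0// => k _; rewrite mulr_ge0 ?sqr_ge0.
  lra.
rewrite sqrrD exprMn; have := sqr_ge0 M; nra.
Qed.

(** The algebra behind [gauge_identity]: [K] stands for [ik], [l], [lxx] and [lt] for the
    derivatives of [lam], and [p], [p1], [p2] for the three truncations of its exponential. The
    hypothesis is the equation that defines the gauge. *)
Lemma gauge_ring (S : comNzRingType) (K p p1 p2 l lxx r rx rxx c c0 dd rhox G E lt : S) :
  2 * K * l = - (c - c0) ->
  p1 * lt * r + p * (- K * rxx + c * rx + dd * rhox + G + E) =
  - K * (p2 * l * l * r + p1 * lxx * r + p1 * l * rx + (p1 * l * rx + p * rxx))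
  + c0 * (p1 * l * r + p * rx) + p * dd * rhox
  + (p * G + p1 * lt * r + K * (p2 * l * l + p1 * lxx) * r - c0 * (p1 * l * r))
  + (p * E + (p * (c - c0) * rx + - p1 * (c - c0) * rx)).
Proof.
move=> h; have -> : c = c0 - 2 * K * l by rewrite h; ring.
ring.
Qed.

Lemma ldx2_ring (S : comNzRingType) (x0 a0 x1 a1 x2 a2 x3 a3 y1 y2 y3 w1 w2 w3 : S) :
  (x0 * y1 + a0 * y2) + (x1 * y2 + a1 * y3) + (x2 * w1 + a2 * w2) + (x3 * w2 + a3 * w3) =
  a1 * y3 + a3 * w3 + (x0 * y1 + a0 * y2 + x1 * y2 + x2 * w1 + a2 * w2 + x3 * w2).
Proof. ring. Qed.

Section CoreIdentities.
Variable R : realType.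
Local Notation C := R[i].
Local Notation L := (laurent C).

(** [v] plays the conjugate of [u] but is kept independent, so that the derivatives in [beta] and in
    its conjugate are the formal ones at the indices 1 and 3. *)
Definition lvec (u v : L) (i : 'I_4) : L := nth 0 [:: u; ldx u; v; ldx v] i.

Definition lval (u v : L) (F : mpoly.mpoly 4 C) : L := mpoly.mmap (@lcst C) (lvec u v) F.

Definition ord4 (n : nat) (h : (n < 4)%N) : 'I_4 := Ordinal h.
Local Notation d_ n := (mpoly.mderiv (@ord4 n isT)).

Lemma sum4 (V : nmodType) (h : 'I_4 -> V) :
  \sum_(i < 4) h i = h (@ord4 0 isT) + h (@ord4 1 isT) + h (@ord4 2 isT) + h (@ord4 3 isT).
Proof.
rewrite !big_ord_recl big_ord0 addr0 !addrA.
by congr (h _ + h _ + h _ + h _); apply: val_inj.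
Qed.

Lemma ldx_lval u v F : ldx (lval u v F) =
  lval u v (d_ 0 F) * ldx u + lval u v (d_ 1 F) * ldx (ldx u) +
  lval u v (d_ 2 F) * ldx v + lval u v (d_ 3 F) * ldx (ldx v).
Proof. by rewrite /lval ldx_mmap sum4. Qed.

(* The part of the second x-derivative of [F(u, u_x, v, v_x)] that contains no
   third derivative. *)
Definition lval2_low u v F : L :=
  ldx (lval u v (d_ 0 F)) * ldx u + lval u v (d_ 0 F) * ldx (ldx u) +
  ldx (lval u v (d_ 1 F)) * ldx (ldx u) +
  ldx (lval u v (d_ 2 F)) * ldx v + lval u v (d_ 2 F) * ldx (ldx v) +
  ldx (lval u v (d_ 3 F)) * ldx (ldx v).

Lemma ldx2_lval u v F : ldx (ldx (lval u v F)) =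
  lval u v (d_ 1 F) * ldx (ldx (ldx u)) + lval u v (d_ 3 F) * ldx (ldx (ldx v)) +
  lval2_low u v F.
Proof. by rewrite ldx_lval !ldxD !ldxM; exact: ldx2_ring. Qed.

(* [texp n.+2 Lam] is the gauge, with [2 i kap Lam_x = - (c - c_0)] killing the
   non-constant part of the coefficient of [r_x]. *)
Lemma gauge_identity (ik mu c0 : C) (n : nat) (c dd r rt rx rhox G Exx lam lamt : L) :
  2 * ik * mu = -1 ->
  lam = lcst mu * lint c -> c0 = c 0 ->
  rx = ldx r ->
  rt = lcst (- ik) * ldx (ldx r) + c * rx + dd * rhox + G + Exx ->
  let p := texp (lfact R) n.+2 lam in
  let p1 := texp (lfact R) n.+1 lam in
  let p2 := texp (lfact R) n lam in
  p1 * lamt * r + p * rt =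
    lcst (- ik) * ldx (ldx (p * r)) + lcst c0 * ldx (p * r) + p * dd * rhox
    + (p * G + p1 * lamt * r
       + lcst ik * (p2 * ldx lam * ldx lam + p1 * ldx (ldx lam)) * r
       - lcst c0 * (p1 * ldx lam * r))
    + (p * Exx + lfact R n.+2 * lam ^+ n.+2 * (c - lcst c0) * rx).
Proof.
move=> hmu hlam hc0 -> -> p p1 p2.
have lamx : lcst (2 * ik) * ldx lam = - (c - lcst c0).
  rewrite hlam ldx_cstM ldx_lint -hc0 mulrA -rmorphM hmu rmorphN1 mulN1r//.
have pp1 : p = p1 + lfact R n.+2 * lam ^+ n.+2 by exact: texpS.
have px : ldx p = p1 * ldx lam by exact: ldx_texp.
have p1x : ldx p1 = p2 * ldx lam by exact: ldx_texp.
have e3 : lfact R n.+2 * lam ^+ n.+2 = p - p1 by rewrite pp1 addrAC subrr add0r.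
rewrite e3 rmorphN !ldxM px !ldxD !ldxM px p1x !mulrDl.
by apply: gauge_ring; rewrite -lamx rmorphM rmorph_nat.
Qed.

End CoreIdentities.

Lemma coefl_ldx2 (R : realType) (g : laurent R[i]) k : ldx (ldx g) k = - (k%:~R ^+ 2) * g k.
Proof. by rewrite !coefl_ldx mulrA mulrACA -!expr2 sqr_i mulN1r. Qed.

Lemma ungauge_ring (S : comNzRingType) (q g x : S) : x = q * (g * x) - (q * g - 1) * x.
Proof. ring. Qed.

(** With [absz_sub_opp] this covers the modes [j] about which nothing better is known, those too
    high and those of the wrong sign: they reach [k] only through a frequency [k - j] of size at
    least [|k|]. *)
Lemma absz_sub_far (k j : int) (J : nat) :
  (absz k <= J)%N -> (2 * J < absz j)%N -> (absz k <= absz (k - j))%N.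
Proof. lia. Qed.

Lemma absz_sub_opp (k j : int) : 0 <= - (k * j) -> (absz k <= absz (k - j))%N.
Proof. nia. Qed.

(** * Energy estimate for the growing modes *)

Section Core.
Variables (R : realType) (W : weight R).
Local Notation C := R[i].
Local Notation L := (laurent C).
Local Notation d_ n := (mpoly.mderiv (@ord4 n isT)).

Definition truncU (a : int -> R -> C) (N : nat) (t : R) : L := ltrunc N (fun k => a k t).
Definition truncV (a : int -> R -> C) (N : nat) (t : R) : L :=
  ltrunc N (fun k => (a (- k) t)^*).
Definition truncF (F : mpoly.mpoly 4 C) (a : int -> R -> C) (N : nat) (t : R) : L :=
  lval (truncU a N t) (truncV a N t) F.

(** [kap] is the direction of time and [eta] the sign of the mean of [Im F_beta]; the modes with
    [eta * k < 0] are those that grow, at rate at least [gam * |k|]. In [Hf] the truncation error is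
    small in each coefficient, uniformly in the mode and the time, and not in a weighted norm. The
    equation [Ha] holds at every real time, the bounds only on [[0, T1]]. *)
Variables (F : mpoly.mpoly 4 C) (a f : int -> R -> C) (kap eta gam T1 : R).
Hypothesis kap2 : kap ^+ 2 = 1.
Hypothesis eta2 : eta ^+ 2 = 1.
Hypothesis gam0 : 0 < gam.
Hypothesis T10 : 0 < T1.
Hypothesis Ha : forall k,
  is_cder (a k) (fun t => 'i%C * kap%:C * k%:~R ^+ 2 * a k t + f k t).
Hypothesis Hb : exists M, forall t : R, 0 <= t <= T1 -> nb W 2 M (fun k => a k t).
Hypothesis Hf : forall e : R, 0 < e -> exists N0, forall N (t : R) k, (N0 <= N)%N -> 0 <= t <= T1 ->
  cn (f k t - truncF F a N t k) <= e.
Hypothesis Hg : exists N0, forall N (t : R), (N0 <= N)%N -> 0 <= t <= T1 ->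
  gam <= eta * Im (truncF (d_ 1 F) a N t 0).

Local Notation P := (nat * R)%type.
Let D : set P := [set p | 0 <= p.2 <= T1].
Local Notation bl := (bl W D).
Let ik : C := 'i%C * kap%:C.

Let ii : 'i%C * 'i%C = -1 :> C. Proof. by rewrite -expr2 sqr_i. Qed.
Let ik2 : ik * ik = -1.
Proof. by rewrite /ik mulrACA ii -rmorphM -expr2 kap2 rmorph1 mulr1. Qed.

Let U (p : P) := truncU a p.1 p.2.
Let V (p : P) := truncV a p.1 p.2.
Let FX G (p : P) := truncF G a p.1 p.2.
Let fN (p : P) : L := ltrunc p.1 (fun k => f k p.2).
Let gN (p : P) : L := ltrunc p.1 (fun k => (f (- k) p.2)^*).

Let cn_trunc N (h : int -> C) k : cn (ltrunc N h k) <= cn (h k).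
Proof. by rewrite /=; case: ifP => // _; rewrite cn0 cn_ge0. Qed.

Let blU : bl 2 U.
Proof. by have [M hM] := Hb; exists M => p Dp; apply: (nb_mono (hM _ Dp)) => // k; exact: cn_trunc. Qed.

Let blV : bl 2 V.
Proof.
have [M hM] := Hb; exists M => p Dp.
by apply: (nb_mono (nb_conj (hM _ Dp))) => // k; exact: cn_trunc.
Qed.

Let blX i : bl 1 (fun p => lvec (U p) (V p) i).
Proof.
case: i => [] [|[|[|[|//]]]] h; rewrite /lvec /=.
- exact: (bl_mono _ blU).
- exact: (bl_dx blU).
- exact: (bl_mono _ blV).
- exact: (bl_dx blV).
Qed.

Let blF G : bl 1 (FX G). Proof. exact: (bl_mmap (m := 1) G blX). Qed.

(** The forcing inherits level 1 from the truncated nonlinearities, which are polynomials in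
    families of level 1, by passing to the coefficientwise limit. *)
Let Hf1 : exists M, forall t : R, 0 <= t <= T1 -> nb W 1 M (fun k => f k t).
Proof.
have [M hM] := blF F; exists (2 * M + 1) => t ht; apply: nb_lim => e e0.
have [N0 hN] := Hf e0; exists (FX F (N0, t)); first exact: (hM (N0, t)).
by move=> k; exact: hN.
Qed.

Let blf : bl 1 fN.
Proof. by have [M hM] := Hf1; exists M => p Dp; apply: (nb_mono (hM _ Dp)) => // k; exact: cn_trunc. Qed.

Let blg : bl 1 gN.
Proof.
have [M hM] := Hf1; exists M => p Dp.
by apply: (nb_mono (nb_conj (hM _ Dp))) => // k; exact: cn_trunc.
Qed.

(** The error made by exchanging the truncation with the nonlinearity. *)
Let E (p : P) : L := fN p - FX F p.

Let E_small (e : R) : 0 < e -> exists N0, forall N (t : R) k, (N0 <= N)%N -> 0 <= t <= T1 ->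
  cn (E (N, t) k) <= e.
Proof.
move=> e0; have [N1 h1] := Hf e0.
have [c hc] := bl_coef (blF F).
(* Beyond the frequency [N] only the nonlinearity of the truncation is left, and its coefficients
   are at most [c / (1 + |k|)]. *)
pose N2 := absz (Num.ceil (c / e)).
exists (maxn N1 N2) => N t k; rewrite geq_max => /andP[n1 n2] ht.
rewrite /E coeflB /fN /=; case: ifPn => [_|]; first exact: h1.
rewrite -ltnNge => hk; rewrite sub0r cnN.
apply: le_trans (hc (N, t) k ht) _.
rewrite exprN1 ler_pdivrMr ?jb_gt0// mulrC -ler_pdivrMr//.
apply: (@le_trans _ _ N2%:R); last by rewrite /jb ler_nat; lia.
by apply: le_trans (ceil_ge _) _; rewrite -[N2%:R]/(N2%:Z%:~R) ler_int /N2 abszE ler_norm.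
Qed.

Let Ut (p : P) : L := lcst (- ik) * ldx (ldx (U p)) + fN p.
Let Vt (p : P) : L := lcst ik * ldx (ldx (V p)) + gN p.

Let DtU N : Dt (fun t => U (N, t)) (fun t => Ut (N, t)).
Proof.
split=> [|k].
  exists N => t k hk; rewrite /Ut coeflD coefl_cstM coefl_ldx2 /U /fN /=.
  by rewrite leqNgt hk /= !mulr0 addr0.
apply: (@is_cder_ext _ (fun t => if (absz k <= N)%N then a k t else 0)
   (fun t => if (absz k <= N)%N then ik * k%:~R ^+ 2 * a k t + f k t else 0)) => //.
  move=> t; rewrite /Ut coeflD coefl_cstM coefl_ldx2 /U /fN /=.
  by case: (absz k <= N)%N => /=; rewrite ?mulr0 ?addr0//; ring.
by case: (absz k <= N)%N; [exact: Ha|exact: is_cder_cst].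
Qed.

Let DtV N : Dt (fun t => V (N, t)) (fun t => Vt (N, t)).
Proof.
split=> [|k].
  exists N => t k hk; rewrite /Vt coeflD coefl_cstM coefl_ldx2 /V /gN /=.
  by rewrite leqNgt hk /= !mulr0 addr0.
apply: (@is_cder_ext _ (fun t => if (absz k <= N)%N then (a (- k) t)^* else 0)
   (fun t => if (absz k <= N)%N then (ik * (- k)%:~R ^+ 2 * a (- k) t + f (- k) t)^* else 0)) => //.
  have ck : ((- k)%:~R ^+ 2 : C)^* = k%:~R ^+ 2.
    by rewrite rmorphXn (rmorph_int (@conjc R)) rmorphN sqrrN.
  have ci : ik^* = - ik by apply/eqP; rewrite /ik eq_complex /=; apply/andP; split; apply/eqP; ring.
  have e (x y : C) : (ik * (- k)%:~R ^+ 2 * x + y)^* = - ik * k%:~R ^+ 2 * x^* + y^*.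
    by rewrite -ci -ck -(rmorphM (@conjc R)) -(rmorphM (@conjc R)) -(rmorphD (@conjc R)).
  move=> t; rewrite /Vt coeflD coefl_cstM coefl_ldx2 /V /gN e /=.
  by case: (absz k <= N)%N => /=; rewrite ?mulr0 ?addr0//; ring.
by case: (absz k <= N)%N; [apply: is_cder_conj; exact: Ha|exact: is_cder_cst].
Qed.

Let blUt : bl 0 Ut.
Proof.
apply: blD; last exact: (bl_mono _ blf).
by apply: bl_cst1M; exact: (bl_dx (bl_dx blU)).
Qed.

Let blVt : bl 0 Vt.
Proof.
apply: blD; last exact: (bl_mono _ blg).
by apply: bl_cst1M; exact: (bl_dx (bl_dx blV)).
Qed.

Let FXt G (p : P) : L := \sum_(i < 4) FX (mpoly.mderiv i G) p * lvec (Ut p) (Vt p) i.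

Let blFt G : bl (-1) (FXt G).
Proof.
apply: bl_sum => i; apply: blMN; first exact: blF.
case: i => [] [|[|[|[|//]]]] h; rewrite /lvec /=.
- exact: (bl_mono _ blUt).
- exact: (bl_dx blUt).
- exact: (bl_mono _ blVt).
- exact: (bl_dx blVt).
Qed.

Let DtF G N : Dt (fun t => FX G (N, t)) (fun t => FXt G (N, t)).
Proof.
apply: (@Dt_mmap R 4 (fun i t => lvec (U (N, t)) (V (N, t)) i)
  (fun i t => lvec (Ut (N, t)) (Vt (N, t)) i)) => i.
case: i => [] [|[|[|[|//]]]] h; rewrite /lvec /=.
- exact: DtU.
- exact/Dt_lmult/DtU.
- exact: DtV.
- exact/Dt_lmult/DtV.
Qed.

Let c p := FX (d_ 1 F) p.
Let dd p := FX (d_ 3 F) p.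
(** Solves [2 * ik * mu = -1], because [ik] squares to -1. *)
Let mu : C := ik / 2.
Let lam p : L := lcst mu * lint (c p).
Let lamt p : L := lcst mu * lint (FXt (d_ 1 F) p).

Let bllam : bl 2 lam. Proof. by apply: bl_cst1M; exact: (bl_int (blF _)). Qed.
(** Integration in x pays for the derivative in time: [FXt] is at level -1 and its primitive at
    level 0. *)
Let bllamt : bl 0 lamt. Proof. by apply: bl_cst1M; exact: (bl_int (blFt _)). Qed.
Let Dtlam N : Dt (fun t => lam (N, t)) (fun t => lamt (N, t)).
Proof. by apply: Dt_cstM; apply: Dt_lmult; exact: DtF. Qed.

Let g0 (p : P) : L := texp (lfact R) p.1.+2 (lam p).
Let g1 (p : P) : L := texp (lfact R) p.1.+1 (lam p).
Let g2 (p : P) : L := texp (lfact R) p.1 (lam p).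

Let blg0 : bl 2 g0. Proof. exact: (bl_texp (m := 2) (fun p : P => p.1.+2) bllam). Qed.
Let blg1 : bl 2 g1. Proof. exact: (bl_texp (m := 2) (fun p : P => p.1.+1) bllam). Qed.
Let blg2 : bl 2 g2. Proof. exact: (bl_texp (m := 2) (fun p : P => p.1) bllam). Qed.

Let r p : L := ldx (ldx (U p)).
Let rho p : L := ldx (ldx (V p)).
Let blr : bl 0 r. Proof. exact: (bl_dx (bl_dx blU)). Qed.
Let blrho : bl 0 rho. Proof. exact: (bl_dx (bl_dx blV)). Qed.

Let z p : L := g0 p * r p.
Let zt p : L := g1 p * lamt p * r p + g0 p * ldx (ldx (Ut p)).
Let blz : bl 0 z. Proof. by apply: (blM (m := 0)) => //; exact: (bl_mono _ blg0). Qed.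
Let Dtz N : Dt (fun t => z (N, t)) (fun t => zt (N, t)).
Proof.
apply: DtM; first exact: (Dt_texp N.+1 (Dtlam N)).
by apply: Dt_lmult; apply: Dt_lmult; exact: DtU.
Qed.

(** The two remainders of [gauge_identity]: [hh] is bounded at level 0, while [ee] tends to 0, but
    only mode by mode and with a loss of [k^2]. *)
Let hh p : L := g0 p * lval2_low (U p) (V p) F + g1 p * lamt p * r p
   + lcst ik * (g2 p * ldx (lam p) * ldx (lam p) + g1 p * ldx (ldx (lam p))) * r p
   - lcst (c p 0) * (g1 p * ldx (lam p) * r p).
Let ee p : L := g0 p * ldx (ldx (E p))
   + lfact R p.1.+2 * lam p ^+ p.1.+2 * (c p - lcst (c p 0)) * ldx (r p).
Let Q p : L := g0 p * dd p.
Let Qt p : L := g1 p * lamt p * dd p + g0 p * FXt (d_ 3 F) p.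

Let ztE p : zt p = lcst (- ik) * ldx (ldx (z p)) + lcst (c p 0) * ldx (z p)
   + Q p * ldx (rho p) + hh p + ee p.
Proof.
apply: (@gauge_identity R ik mu (c p 0) p.1 (c p) (dd p) (r p) (ldx (ldx (Ut p)))
  (ldx (r p)) (ldx (rho p)) (lval2_low (U p) (V p) F) (ldx (ldx (E p))) (lam p) (lamt p)) => //.
- have e2 : 2 * (ik / 2) = ik by field.
  by rewrite /mu mulrAC e2 ik2.
rewrite {1}/Ut ldxD ldx_cstM ldxD ldx_cstM.
have -> : fN p = FX F p + E p by rewrite /E addrC subrK.
by rewrite !ldxD /FX /truncF ldx2_lval !addrA.
Qed.

(* The denominator [k^2 + j^2] is the difference of the phases of mode [k] of [r] and
   mode [j] of [rho]. *)
Let nk (k j : int) : C := (kap * j%:~R / (k%:~R ^+ 2 + j%:~R ^+ 2))%:C.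
Let theta p : L := ldx (ldx (gN p)).
Let bltheta : bl (-1) theta. Proof. exact: (bl_dx (bl_dx blg)). Qed.

Let eps p k : C := \sum_(j <- win p.1) Q p (k - j) * nk k j * rho p j.
Let epst p k : C := \sum_(j <- win p.1)
  (Qt p (k - j) * nk k j * rho p j + Q p (k - j) * nk k j * ldx (ldx (Vt p)) j).

Let blQ : bl 1 Q.
Proof. by apply: (blM (m := 1)); [exact: (bl_mono _ blg0)|exact: blF]. Qed.

Let blQt : bl (-1) Qt.
Proof.
apply: blD.
  apply: (@bl_eq _ _ _ _ _ (fun p => dd p * (g1 p * lamt p))) => [p|]; first by rewrite mulrC.
  apply: blMN; first exact: blF.
  apply: blMN; first exact: (bl_mono _ blg1).
  exact: (bl_mono _ bllamt).
by apply: blMN; [exact: (bl_mono _ blg0)|exact: blFt].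
Qed.

Let DtQ N : Dt (fun t => Q (N, t)) (fun t => Qt (N, t)).
Proof. by apply: DtM; [exact: (Dt_texp N.+1 (Dtlam N))|exact: DtF]. Qed.

Let Dteps N k : is_cder (fun t => eps (N, t) k) (fun t => epst (N, t) k).
Proof.
apply: (@is_cder_sum _ _ (win N) (fun j t => Q (N, t) (k - j) * nk k j * rho (N, t) j)
  (fun j t => Qt (N, t) (k - j) * nk k j * rho (N, t) j +
              Q (N, t) (k - j) * nk k j * ldx (ldx (Vt (N, t))) j)) => j.
have [_ /(_ (k - j)) hQ] := DtQ N.
have [_ /(_ j) hr] := Dt_lmult (fun k => 'i%C * k%:~R) (Dt_lmult (fun k => 'i%C * k%:~R) (DtV N)).
apply: is_cder_ext (is_cderM (is_cderM hQ (is_cder_cst (nk k j))) hr) => t //=.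
by rewrite mulr0 addr0.
Qed.

(** The term with [eps] is the price of having [v] instead of [z] in the transport term
    [i k c_0]. *)
Let H0 p k : C := hh p k - 'i%C * c p 0 * k%:~R * eps p k
  + \sum_(j <- win p.1)
     (Qt p (k - j) * nk k j * rho p j + Q p (k - j) * nk k j * theta p j).

Let v p k : C := z p k + eps p k.
Let vt p k : C := zt p k + epst p k.

Let Dtv N k : is_cder (fun t => v (N, t) k) (fun t => vt (N, t) k).
Proof. by apply: is_cderD; [case: (Dtz N)|exact: Dteps]. Qed.

Let rho_supp p j : rho p j != 0 -> j \in win p.1.
Proof.
rewrite /rho coefl_ldx2 /V /= mem_win; case: ifP => //.
by rewrite mulr0 eqxx.
Qed.

Let vtE p k : k != 0 ->
  vt p k = (ik * k%:~R ^+ 2 + 'i%C * c p 0 * k%:~R) * v p k + (H0 p k + ee p k).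
Proof.
move=> k0.
have hQr : (Q p * ldx (rho p)) k = \sum_(j <- win p.1) Q p (k - j) * ('i%C * j%:~R * rho p j).
  apply: coeflM => [|j]; first exact: uniq_win.
  by move=> rj _; apply: rho_supp; apply: contra rj => /eqP; rewrite coefl_ldx => ->; rewrite mulr0.
have he : epst p k = \sum_(j <- win p.1)
     (Qt p (k - j) * nk k j * rho p j + Q p (k - j) * nk k j * theta p j)
   + \sum_(j <- win p.1) Q p (k - j) * nk k j * (- ik * j%:~R ^+ 2) * rho p j.
  rewrite -big_split; apply: eq_bigr => j _.
  rewrite /Vt !ldxD !ldx_cstM coeflD coefl_cstM [ldx (ldx (ldx (ldx _))) j]coefl_ldx2 -/(rho p) -/(theta p).
  rewrite -[RHS]/(_ + _); ring.
(* The cancellation for which [nk] is made: [i j = ik (k^2 + j^2) nk]. The [j^2] part is consumed by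
   the phase of [rho], and the [k^2] part gives [eps] the phase of mode [k]. *)
have hkey : (Q p * ldx (rho p)) k +
    \sum_(j <- win p.1) Q p (k - j) * nk k j * (- ik * j%:~R ^+ 2) * rho p j =
    ik * k%:~R ^+ 2 * eps p k.
  rewrite hQr -big_split /eps big_distrr; apply: eq_bigr => j _; rewrite -[LHS]/(_ + _).
  have hn : 'i%C * j%:~R = ik * (k%:~R ^+ 2 + j%:~R ^+ 2) * nk k j.
    have n0 : k%:~R ^+ 2 + j%:~R ^+ 2 != 0 :> R.
      by rewrite gt_eqF// ltr_wpDr ?sqr_ge0// lt0r sqr_ge0 andbT sqrf_eq0 intr_eq0.
    have hR : j%:~R = kap * (k%:~R ^+ 2 + j%:~R ^+ 2) *
        (kap * j%:~R / (k%:~R ^+ 2 + j%:~R ^+ 2)) :> R.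
      have gen (y q : R) : q != 0 -> kap * q * (kap * y / q) = kap ^+ 2 * y by move=> q0; field.
      by rewrite gen// kap2 mul1r.
    rewrite -(rmorph_int (real_complex R) j) -(rmorph_int (real_complex R) k).
    rewrite {1}hR /ik /nk (rmorphM (real_complex R) (kap * _)) rmorphM rmorphD !rmorphXn; ring.
  by rewrite hn -[RHS]/(_ * _); ring.
have e5 (x1 x2 x3 x4 x5 : L) : (x1 + x2 + x3 + x4 + x5) k = x1 k + x2 k + x3 k + x4 k + x5 k.
  by [].
rewrite /vt ztE e5 !coefl_cstM coefl_ldx2 coefl_ldx he /v /H0.
have -> : forall x1 x2 x3 x4 x5 x6 x7 : C, x1 + x2 + x3 + x4 + x5 + (x6 + x7) =
  x1 + x2 + (x3 + x7) + x4 + x5 + x6 by move=> *; ring.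
by rewrite hkey; ring.
Qed.

(** Young's inequality with a kernel that moves derivatives to the factors. The zero mode is left
    out, since growing modes are nonzero. *)
Let kconv (mA mB : int) (A B : P -> L) (ka : int -> int -> C) (cc : R) :
  0 <= cc -> (forall k j, k != 0 -> cn (ka k j) <= cc * (jb R (k - j) ^ mA * jb R j ^ mB)) ->
  bl mA A -> bl mB B -> exists M, forall p, D p ->
    nb W 0 M (fun k => if k == 0 then 0 else \sum_(j <- win p.1) A p (k - j) * ka k j * B p j).
Proof.
move=> cc0 hka [MA hA] [MB hB]; exists (cc * (KW W * MA * MB)) => p Dp.
pose al k := jb R k ^ mA * cn (A p k).
pose be k := jb R k ^ mB * cn (B p k).
have al0 k : 0 <= al k by rewrite mulr_ge0 ?jbz_ge0 ?cn_ge0.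
have be0 k : 0 <= be k by rewrite mulr_ge0 ?jbz_ge0 ?cn_ge0.
have h0 k : 0 <= \sum_(j <- win p.1) al (k - j) * be j.
  by apply: sumr_ge0 => j _; rewrite mulr_ge0.
have h := @nbs_conv _ W MA MB al be (fun k => \sum_(j <- win p.1) al (k - j) * be j) _
  (uniq_win p.1) al0 be0 (hA p Dp) (hB p Dp) (fun k => eq_ler (ger0_norm (h0 k))).
have := nbs_scale cc h; rewrite ger0_norm// => /nbs_le; apply => // k.
rewrite expr0z mul1r ger0_norm ?cn_ge0// ger0_norm ?mulr_ge0//.
have [_|k0] := eqVneq k 0; first by rewrite cn0 mulr_ge0.
apply: le_trans (cn_sum _ _ _) _; rewrite big_distrr; apply: ler_sum => j _ /=.
rewrite !cnM /al /be; have := hka k j k0.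
move=> /(ler_wpM2l (cn_ge0 (A p (k - j)))) /(ler_wpM2r (cn_ge0 (B p j))) /le_trans; apply.
by apply: eq_ler; ring.
Qed.

Let cn_nk k j : cn (nk k j) = `|j%:~R| / (k%:~R ^+ 2 + j%:~R ^+ 2).
Proof.
have k1 : `|kap| = 1.
  have := real_normK (num_real kap); rewrite kap2 => /eqP; rewrite sqrf_eq1.
  by case/orP => /eqP // h; have := normr_ge0 kap; rewrite h; lra.
by rewrite /nk cnR normrM normfV normrM k1 mul1r [X in _ / X]ger0_norm// addr_ge0 ?sqr_ge0.
Qed.

Let nk_le k j (x cc : R) : k != 0 -> `|j%:~R| * x <= cc * (`|k%:~R| ^+ 2 + `|j%:~R| ^+ 2) ->
  cn (nk k j) * x <= cc.
Proof.
move=> k0 h; rewrite cn_nk mulrAC ler_pdivrMr; last first.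
  by rewrite ltr_wpDr ?sqr_ge0// lt0r sqr_ge0 andbT sqrf_eq0 intr_eq0.
by rewrite -[k%:~R ^+ 2]real_normK ?num_real// -[X in _ + X]real_normK ?num_real.
Qed.

Let int_ge1 (k : int) : k != 0 -> 1 <= `|k%:~R : R|.
Proof. by move=> k0; rewrite -intr_norm ler1z; lia. Qed.

Let jb_sub k j : jb R (k - j) <= 1 + `|k%:~R| + `|j%:~R|.
Proof. by rewrite jb_int1 -addrA lerD2l rmorphB ler_normB. Qed.

(** [|k j|] is at most [k^2 + j^2]. So the correction [eps] is one derivative smoother than [r]. *)
Let nk1 k j : k != 0 -> cn (k%:~R * nk k j) <= 1.
Proof.
move=> k0; rewrite cnM cn_int mulrC; apply: nk_le => //.
by have := sqr_ge0 (`|k%:~R : R| - `|j%:~R|); have := sqr_ge0 (`|k%:~R : R| + `|j%:~R|);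
   rewrite sqrrB sqrrD; lra.
Qed.

(** The kernel gains one derivative and spends it on the factor at level -1: on [Qt] here, and on
    [theta] by [nk3]. This brings the time derivative of the correction back to level 0. *)
Let nk2 k j : k != 0 -> cn (nk k j) <= 4 * (jb R (k - j) ^ (-1) * jb R j ^ 0).
Proof.
move=> k0; rewrite expr0z mulr1 -invr_expz expr1z ler_pdivlMr ?jb_gt0//.
apply: nk_le => //; have := jb_sub k j; have := int_ge1 k0.
have := normr_ge0 (j%:~R : R); have := sqr_ge0 (`|k%:~R : R| - `|j%:~R|).
set x := `|k%:~R : R|; set y := `|j%:~R : R|; set w := jb R _; nra.
Qed.

Let nk3 k j : k != 0 -> cn (nk k j) <= 4 * (jb R (k - j) ^ 0 * jb R j ^ (-1)).
Proof.
move=> k0; rewrite expr0z mul1r -invr_expz expr1z ler_pdivlMr ?jb_gt0//.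
apply: nk_le => //; rewrite jb_int1; have := int_ge1 k0.
have := normr_ge0 (j%:~R : R); have := sqr_ge0 (`|k%:~R : R| - `|j%:~R|).
set x := `|k%:~R : R|; set y := `|j%:~R : R|; nra.
Qed.

Let blQ0 : bl 0 Q. Proof. exact: (bl_mono _ blQ). Qed.

Let keps_bd : exists M, forall p, D p ->
  nb W 0 M (fun k => if k == 0 then 0 else k%:~R * eps p k).
Proof.
have hk k j : k != 0 -> cn (k%:~R * nk k j) <= 1 * (jb R (k - j) ^ 0 * jb R j ^ 0).
  by move=> k0; rewrite !expr0z !mulr1 nk1.
have [M hM] := kconv ler01 hk blQ0 blrho.
exists M => p Dp; apply: nb_eq (hM p Dp) => k; case: eqP => // _.
by congr cn; rewrite /eps big_distrr; apply: eq_bigr => j _; rewrite -[LHS]/(_ * _); ring.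
Qed.

Let c0_bd : exists c0, forall p, D p -> cn (c p 0) <= c0.
Proof.
have [c0 hc] := bl_coef (blF (d_ 1 F)); exists (c0 * jb R 0 ^ (-1)) => p Dp; exact: hc.
Qed.

Let blM0 (x y : P -> L) : bl 0 x -> bl 0 y -> bl 0 (fun p => x p * y p).
Proof. exact: (@blM R W P D 0). Qed.

Let blpoly (x0 x1 x2 x3 a0 a2 y1 y2 w1 w2 : P -> L) :
  bl 0 x0 -> bl 0 x1 -> bl 0 x2 -> bl 0 x3 -> bl 0 a0 -> bl 0 a2 ->
  bl 0 y1 -> bl 0 y2 -> bl 0 w1 -> bl 0 w2 ->
  bl 0 (fun p => x0 p * y1 p + a0 p * y2 p + x1 p * y2 p + x2 p * w1 p + a2 p * w2 p
                 + x3 p * w2 p).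
Proof.
move=> *; do 5!(apply: blD; last by apply: blM0; assumption).
by apply: blM0; assumption.
Qed.

Let bllow : bl 0 (fun p => lval2_low (U p) (V p) F).
Proof.
have bFx G : bl 0 (fun p => ldx (FX G p)) by exact: (bl_dx (blF G)).
have bF0 G : bl 0 (FX G) by exact: (bl_mono _ (blF G)).
have bUx : bl 0 (fun p => ldx (U p)) by apply: (bl_mono _ (bl_dx blU)).
have bVx : bl 0 (fun p => ldx (V p)) by apply: (bl_mono _ (bl_dx blV)).
exact: (blpoly (bFx (d_ 0 F)) (bFx (d_ 1 F)) (bFx (d_ 2 F)) (bFx (d_ 3 F))
  (bF0 (d_ 0 F)) (bF0 (d_ 2 F)) bUx blr bVx blrho).
Qed.

Let blhh_gen (x0 x1 x2 y l lx lxx s : P -> L) :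
  bl 0 x0 -> bl 0 x1 -> bl 0 x2 -> bl 0 y -> bl 0 l -> bl 0 lx -> bl 0 lxx -> bl 0 s ->
  bl 0 (fun p => x0 p * y p + x1 p * l p * s p
   + lcst ik * (x2 p * lx p * lx p + x1 p * lxx p) * s p
   - lcst (c p 0) * (x1 p * lx p * s p)).
Proof.
move=> h0 h1 h2 hy hl hlx hlxx hs.
apply: blD; [apply: blD; [apply: blD|]|apply: bl_opp].
- exact: (blM0 h0 hy).
- exact: (blM0 (blM0 h1 hl) hs).
- apply: (blM0 _ hs); apply: bl_cst1M; apply: blD; last exact: (blM0 h1 hlxx).
  exact: (blM0 (blM0 h2 hlx) hlx).
- by apply: bl_cstM; [exact: c0_bd|exact: (blM0 (blM0 h1 hlx) hs)].
Qed.

Let blh : bl 0 hh.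
Proof.
have b0 : bl 0 g0 by exact: (bl_mono _ blg0).
have b1 : bl 0 g1 by exact: (bl_mono _ blg1).
have b2 : bl 0 g2 by exact: (bl_mono _ blg2).
have bx : bl 0 (fun p => ldx (lam p)) by apply: (bl_mono _ (bl_dx bllam)).
have bxx : bl 0 (fun p => ldx (ldx (lam p))) by exact: (bl_dx (bl_dx bllam)).
exact: (blhh_gen b0 b1 b2 bllow bllamt bx bxx blr).
Qed.

Let H0_bd : exists M, forall p, D p -> nb W 0 M (fun k => if k == 0 then 0 else H0 p k).
Proof.
have [M1 h1] := blh; have [M2 h2] := keps_bd; have [c1 hc1] := c0_bd.
have [M3 h3] := kconv (ler0n _ 4) nk2 blQt blrho.
have [M4 h4] := kconv (ler0n _ 4) nk3 blQ0 bltheta.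
exists (M1 + cn (-'i%C : C) * c1 * M2 + (M3 + M4)) => p Dp.
have c10 : 0 <= c1 by exact: le_trans (cn_ge0 _) (hc1 p Dp).
have {}h2 : nb W 0 (cn (-'i%C : C) * c1 * M2)
    (fun k => - 'i%C * c p 0 * (if k == 0 then 0 else k%:~R * eps p k)).
  apply: (nb_mono (nb_scale (- 'i%C * c p 0) (h2 p Dp))) => //.
  by rewrite ler_wpM2r ?(nb_ge0 (h2 p Dp))// cnM ler_wpM2l ?cn_ge0 ?hc1.
apply: (nb_mono (nbD (nbD (h1 p Dp) h2) (nbD (h3 p Dp) (h4 p Dp)))) => // k.
case: eqP => [_|_]; first by rewrite cn0 cn_ge0.
apply: eq_ler; congr cn; rewrite /H0 big_split; rewrite -[X in _ + X]/(_ + _); ring.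
Qed.

Let v_bd : exists M, forall p, D p -> nb W 0 M (fun k => if k == 0 then 0 else v p k).
Proof.
have [M1 h1] := blz; have [M2 h2] := keps_bd.
exists (M1 + M2) => p Dp.
have {}h2 : nb W 0 M2 (fun k => if k == 0 then 0 else eps p k).
  apply: (nb_mono (h2 p Dp)) => // k; have [//|k0] := eqVneq k 0.
  by rewrite cnM cn_int ler_peMl ?cn_ge0 ?int_ge1.
apply: (nb_mono (nbD (h1 p Dp) h2)) => // k.
by case: eqP => [_|_ //]; rewrite cn0 cn_ge0.
Qed.

(** Only the size of the coefficients of [h] is known, so its two derivatives are moved to [g],
    which has two to spare, and to the output frequency. The resulting factor of order [k^2] is
    harmless on a fixed finite list of modes. *)
Let mul_ldx2_small M1 (g h : L) (de : R) k : nb W 2 M1 g -> (forall j, cn (h j) <= de) ->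
  cn ((g * ldx (ldx h)) k) <= Num.sqrt (SW W) * M1 * de * jb R k ^+ 2.
Proof.
move=> hg hh'; have de0 : 0 <= de by exact: le_trans (cn_ge0 _) (hh' 0).
rewrite (_ : (g * _) k = lconv g (ldx (ldx h)) k)// /lconv.
set s := win _; have us : uniq s by exact: uniq_win.
apply: le_trans (cn_sum _ _ _) _.
have h1 := nbs_l1 hg (uniq_refl k us); rewrite big_map in h1.
rewrite -mulrA; apply: le_trans (ler_wpM2r _ h1); last by rewrite mulr_ge0 ?sqr_ge0.
rewrite big_distrl; apply: ler_sum => j _; rewrite -[leRHS]/(_ * _).
rewrite ger0_norm ?mulr_ge0 ?jbz_ge0 ?cn_ge0//.
rewrite cnM coefl_ldx2 cnM cnN cn_prodX cn_int.
have h2 : `|j%:~R| ^+ 2 <= jb R (k - j) ^ 2 * jb R k ^+ 2.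
  rewrite -exprnP -exprMn lerXn2r ?nnegrE ?mulr_ge0 ?jb_ge0//.
  apply: le_trans (jb_int R j) _; apply: le_trans (jb_add R j k) _.
  by rewrite -(jbN R (j - k)) opprB.
have -> : jb R (k - j) ^ 2 * cn (g (k - j)) * (de * jb R k ^+ 2) =
  cn (g (k - j)) * ((jb R (k - j) ^ 2 * jb R k ^+ 2) * de) by ring.
by rewrite ler_wpM2l ?cn_ge0// ler_pM ?sqr_ge0 ?cn_ge0.
Qed.

(** The first part is small by [E_small]. The second is one term of the exponential series, and it
    vanishes because the order of the gauge grows with [N]. *)
Let ee_small (e : R) : 0 < e -> exists N0, forall N (t : R) k, (N0 <= N)%N -> 0 <= t <= T1 ->
  cn (ee (N, t) k) <= e * jb R k ^+ 2.
Proof.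
move=> e0; have [M0 h0] := blg0; have [Ml hl] := bllam.
have blc : bl 1 (fun p => c p - lcst (c p 0)).
  apply: blD; first exact: blF.
  apply: bl_opp; apply: (bl_eq (f := fun p => lcst (c p 0) * 1)) => [p|]; first by rewrite mulr1.
  by apply: bl_cstM; [exact: c0_bd|exact: bl_one].
have [Mc hc] := blc; have [Mr hr] := bl_dx blr.
have D0 : D (0%N, 0) by rewrite /D /= lexx ltW.
have M00 := nb_ge0 (h0 _ D0); have Ml0 := nb_ge0 (hl _ D0).
have Mc0 := nb_ge0 (hc _ D0); have Mr0 := nb_ge0 (hr _ D0).
pose X := KW W * Ml.
pose A := Num.sqrt (SW W) * M0; have A0 : 0 <= A by rewrite mulr_ge0 ?sqrtr_ge0.
pose B := KW W * (KW W * nb1 W * Mc) * Mr.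
have B0 : 0 <= B by rewrite !mulr_ge0 ?KW_ge0 ?sqrtr_ge0.
have eA : 0 < e / 2 / (A + 1) by rewrite !divr_gt0// ltr_wpDl.
have [N1 hN1] := E_small eA.
have [N2 _ hN2] : exists2 N2, True & forall n, (N2 <= n)%N -> ifact R n * X ^+ n <= e / 2 / (B + 1).
  have /cvgrPdist_le /(_ (e / 2 / (B + 1))) := exp_term_cvg X.
  rewrite !divr_gt0 ?ltr_wpDl// => /(_ isT) [N2 _ h2]; exists N2 => // n /h2 /=.
  by rewrite sub0r normrN => /(le_trans (ler_norm _)).
exists (maxn N1 N2) => N t k; rewrite geq_max => /andP[n1 n2] ht.
have Dp : D (N, t) by [].
have j1 : 1 <= jb R k ^+ 2 by rewrite exprn_ege1// jb_ge1.
rewrite /ee coeflD; apply: le_trans (cnD _ _) _.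
rewrite [e]splitr mulrDl; apply: lerD.
  apply: le_trans (mul_ldx2_small k (h0 _ Dp) (fun j => hN1 N t j n1 ht)) _.
  rewrite ler_wpM2r ?sqr_ge0// -/A mulrCA ler_piMr ?divr_ge0 ?(ltW e0)//.
  by rewrite ler_pdivrMr ?ltr_wpDl// mul1r lerDl.
have t1 : nb W 1 (nb1 W * (ifact R N.+2 * X ^+ N.+2)) (lfact R N.+2 * lam (N, t) ^+ N.+2).
  exact: (nb_mono (nb_texp_term N.+2 (hl _ Dp))).
have t2 := nbMN (nbM (m := 1) t1 (hc _ Dp)) (hr _ Dp).
apply: le_trans (nb_coef k t2) _; rewrite opprK expr1z.
have -> : KW W * (KW W * (nb1 W * (ifact R N.+2 * X ^+ N.+2)) * Mc) * Mr =
  B * (ifact R N.+2 * X ^+ N.+2) by rewrite /B; ring.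
apply: (@le_trans _ _ (B * (e / 2 / (B + 1)) * jb R k)).
  by rewrite ler_wpM2r ?jb_ge0// ler_wpM2l// hN2// (leq_trans n2)// -addn2 leq_addr.
apply: (@le_trans _ _ (e / 2 * jb R k)).
  rewrite ler_wpM2r ?jb_ge0// mulrCA ler_piMr ?divr_ge0 ?(ltW e0)//.
  by rewrite ler_pdivrMr ?ltr_wpDl// mul1r lerDl.
by rewrite ler_wpM2l ?divr_ge0 ?(ltW e0)// expr2 ler_peMr ?jb_ge0 ?jb_ge1.
Qed.

Let W0 k : 0 <= W k. Proof. exact: le_trans ler01 (wt_ge1 W k). Qed.

Let expRN_le (x : R) : 0 < x -> expR (- x) <= x^-1.
Proof.
move=> x0; rewrite expRN lef_pV2 ?posrE ?expR_gt0//.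
by apply: le_trans (expR_ge1Dx x); rewrite lerDr.
Qed.

(** Completing the square: [g |w|^2 + 2 Re (conj w * H) + |H|^2 / g] equals [|g w + H|^2 / g]. One
    [g] out of [2 * d0] is used up by the decaying exponential weight, and at least another [g] is
    left for this. *)
Let energy_ineq (g h d0 : R) (w H c1 : C) : 0 < g -> g <= d0 -> Re c1 = d0 ->
  - (cn H ^+ 2 / g) <=
  - g * cn w ^+ 2 + 2 * (Re w * Re (c1 * w + H) + Im w * Im (c1 * w + H)).
Proof.
move=> g0' gd hc1; rewrite cReD cImD cReM cImM hc1.
have -> : 2 * (Re w * (d0 * Re w - Im c1 * Im w + Re H) + Im w * (d0 * Im w + Im c1 * Re w + Im H))
  = 2 * d0 * cn w ^+ 2 + 2 * (Re w * Re H + Im w * Im H) by rewrite cn_sq; ring.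
have h1 : g * cn w ^+ 2 <= d0 * cn w ^+ 2 by rewrite ler_wpM2r ?sqr_ge0.
have h2 : 0 <= (g * Re w + Re H) ^+ 2 + (g * Im w + Im H) ^+ 2 by rewrite addr_ge0 ?sqr_ge0.
have h3 : 0 <= g * cn w ^+ 2 + 2 * (Re w * Re H + Im w * Im H) + cn H ^+ 2 / g.
  rewrite (_ : _ + _ = ((g * Re w + Re H) ^+ 2 + (g * Im w + Im H) ^+ 2) / g).
    by rewrite divr_ge0// ltW.
  by rewrite !cn_sq; field; rewrite gt_eqF.
lra.
Qed.

Let eta_abs (k : int) : eta * k%:~R < 0 -> - (eta * k%:~R) = `|k%:~R|.
Proof.
move=> h; rewrite -ltr0_norm// normrM.
suff -> : `|eta| = 1 by rewrite mul1r.
have := real_normK (num_real eta); rewrite eta2 => /eqP; rewrite sqrf_eq1.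
by case/orP => /eqP // h'; have := normr_ge0 eta; rewrite h'; lra.
Qed.

(* [S t = sum_k W_k |k| exp (- gam |k| t) |v_k|^2] has [S' >= - C], and [S T1] is
   bounded because [|k| exp (- gam |k| T1)] is. *)
Let energy : exists CC, forall s : seq int, uniq s ->
  (forall k, k \in s -> eta * k%:~R < 0) -> exists N0, forall N, (N0 <= N)%N ->
  \sum_(k <- s) W k * `|k%:~R| * cn (v (N, 0) k) ^+ 2 <= CC.
Proof.
have [Mv hv] := v_bd; have [MH hH] := H0_bd.
pose B := 2 * MH ^+ 2 + 2 * 1.
(* The first term bounds the energy at [T1], the second is [T1] times the bound on the negative part
   of its derivative. *)
exists ((gam * T1)^-1 * Mv ^+ 2 + T1 * (B / gam)) => s us sk.
have k0 k : k \in s -> k != 0.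
  by move=> /sk; apply: contraTneq => ->; rewrite mulr0 ltxx.
(* [e] is the accuracy required of [ee] on this list: [e^2 K <= 1] limits its weighted square sum to
   1, which is the last term of [B]. *)
pose K := 1 + \sum_(k <- s) W k * (jb R k ^+ 2) ^+ 2.
have K0 : 0 < K by rewrite /K ltr_wpDr// sumr_ge0// => k _; rewrite mulr_ge0 ?sqr_ge0.
pose e := Num.min 1 K^-1.
have e0 : 0 < e by rewrite lt_min ltr01 invr_gt0.
have e1 : e ^+ 2 * K <= 1.
  apply: (@le_trans _ _ (K^-1 * K)); last by rewrite mulVf ?gt_eqF.
  rewrite ler_wpM2r ?(ltW K0)//; apply: (@le_trans _ _ e); last by rewrite /e ge_min lexx orbT.
  by rewrite expr2 ler_piMr ?(ltW e0)// /e ge_min lexx.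
have [N1 hN1] := ee_small e0; have [N2 hN2] := Hg.
exists (maxn N1 N2) => N; rewrite geq_max => /andP[n1 n2].
pose H t k := H0 (N, t) k + ee (N, t) k.
have HB t : 0 <= t <= T1 -> \sum_(k <- s) W k * cn (H t k) ^+ 2 <= B.
  move=> ht; apply: (@le_trans _ _ (2 * (\sum_(k <- s) W k * cn (H0 (N, t) k) ^+ 2) +
     2 * (e ^+ 2 * \sum_(k <- s) W k * (jb R k ^+ 2) ^+ 2))).
    rewrite !big_distrr -big_split; apply: ler_sum => k _; rewrite -[leRHS]/(_ + _).
    have h1 : cn (H t k) <= cn (H0 (N, t) k) + e * jb R k ^+ 2.
      by apply: le_trans (cnD _ _) _; rewrite lerD2l; exact: hN1.
    have h2 : cn (H t k) ^+ 2 <= (cn (H0 (N, t) k) + e * jb R k ^+ 2) ^+ 2.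
      by rewrite ler_sqr ?nnegrE ?addr_ge0 ?mulr_ge0 ?cn_ge0 ?sqr_ge0// ltW.
    have h3 : cn (H t k) ^+ 2 <= 2 * cn (H0 (N, t) k) ^+ 2 + 2 * (e ^+ 2 * (jb R k ^+ 2) ^+ 2).
      have := sqr_ge0 (cn (H0 (N, t) k) - e * jb R k ^+ 2).
      by move: h2; rewrite sqrrB sqrrD -exprMn; lra.
    by apply: le_trans (ler_wpM2l (W0 k) h3) _; apply: eq_ler; rewrite /=; ring.
  rewrite /B; apply: lerD; rewrite ler_wpM2l//.
    have [_ /(_ s us) h] := hH (N, t) ht; apply: le_trans h.
    rewrite big_seq [leRHS]big_seq; apply: ler_sum => k /k0 /negbTE ->.
    by rewrite expr0z mul1r.
  apply: le_trans e1; rewrite ler_wpM2l ?sqr_ge0// /K lerDr//.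
pose S (t : R) := \sum_(k <- s) W k * `|k%:~R| * (expR (- (gam * `|k%:~R|) * t) * cn (v (N, t) k) ^+ 2).
pose S' (t : R) := \sum_(k <- s) W k * `|k%:~R| * (expR (- (gam * `|k%:~R|) * t) *
  (- (gam * `|k%:~R|) * cn (v (N, t) k) ^+ 2 +
   2 * (Re (v (N, t) k) * Re (vt (N, t) k) + Im (v (N, t) k) * Im (vt (N, t) k)))).
have dS (t : R) : is_derive t (1 : R) S (S' t).
  rewrite /S /S'; elim: (s) => [|k s' IH].
    under eq_fun do rewrite big_nil.
    by rewrite big_nil; exact: is_derive_cst.
  under eq_fun do rewrite big_cons.
  rewrite big_cons; apply: is_deriveD => /=.
  have de : is_derive t (1 : R) (fun t => expR (- (gam * `|k%:~R|) * t))
      (- (gam * `|k%:~R|) * expR (- (gam * `|k%:~R|) * t)).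
    have hl : is_derive t (1 : R) (fun t => - (gam * `|k%:~R|) * t) (- (gam * `|k%:~R|)).
      by have := is_deriveZ (- (gam * `|k%:~R|)) (is_derive_id t 1); rewrite /GRing.scale /= mulr1.
    have := is_derive1_comp (is_derive_expR (- (gam * `|k%:~R|) * t)) hl.
    by rewrite [X in is_derive _ _ _ X -> _]mulrC.
  have := is_deriveZ (W k * `|k%:~R|) (is_deriveM de (is_derive_abs2 (Dtv N k) t)).
  by congr is_derive; rewrite /GRing.scale /=; ring.
have S'ge t : 0 <= t <= T1 -> - (B / gam) <= S' t.
  move=> ht; apply: (@le_trans _ _ (\sum_(k <- s) - (W k * cn (H t k) ^+ 2 / gam))).
    rewrite sumrN lerN2 -big_distrl /= ler_pM2r ?invr_gt0//; exact: HB.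
  rewrite /S' big_seq [leRHS]big_seq; apply: ler_sum => k ks.
  have kn0 : 0 < `|k%:~R : R| by rewrite normr_gt0 intr_eq0 k0.
  have gk : 0 < gam * `|k%:~R| by rewrite mulr_gt0.
  set c1 := ik * k%:~R ^+ 2 + 'i%C * c (N, t) 0 * k%:~R.
  have hc1 : Re c1 = - (k%:~R * Im (c (N, t) 0)).
    rewrite /c1 /ik -(rmorph_int (real_complex R)); case: (c (N, t) 0) => x y /=; ring.
  have hd : gam * `|k%:~R| <= - (k%:~R * Im (c (N, t) 0)).
    have h := hN2 N t n2 ht; rewrite -/(c (N, t)) in h.
    rewrite -(eta_abs (sk k ks)).
    have -> : - (k%:~R * Im (c (N, t) 0)) = eta * Im (c (N, t) 0) * - (eta * k%:~R).
      rewrite -[LHS]mul1r -eta2; ring.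
    by rewrite ler_wpM2r// oppr_ge0 ltW// sk.
  have := @energy_ineq _ 0 _ (v (N, t) k) (H t k) c1 gk hd hc1.
  rewrite -vtE ?k0// => h.
  have ex1 : expR (- (gam * `|k%:~R|) * t) <= 1.
    have t0 : 0 <= t by case/andP: ht.
    rewrite -[leRHS]expR0 ler_expR mulNr oppr_le0; apply: mulr_ge0 => //.
    exact: ltW gk.
  apply: (@le_trans _ _ (W k * `|k%:~R| * (expR (- (gam * `|k%:~R|) * t) *
     - (cn (H t k) ^+ 2 / (gam * `|k%:~R|))))); last first.
    by rewrite ler_wpM2l ?mulr_ge0// ler_wpM2l ?expR_ge0.
  rewrite !mulrN lerN2.
  (* The factor [|k|] of the energy cancels the growth rate [gam * |k|] that divides the forcing;
     this is why the gain is half a derivative. *)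
  have -> : W k * `|k%:~R| * (expR (- (gam * `|k%:~R|) * t) *
      (cn (H t k) ^+ 2 / (gam * `|k%:~R|))) =
      expR (- (gam * `|k%:~R|) * t) * (W k * cn (H t k) ^+ 2 / gam).
    by field; rewrite !gt_eqF.
  apply: ler_piMl => //; apply: divr_ge0; last exact: ltW.
  by apply: mulr_ge0 => //; exact: sqr_ge0.
have [t0 t0I hS] : exists2 t0, t0 \in `]0, T1[%R & S T1 - S 0 = S' t0 * (T1 - 0).
  apply: MVT => //.
  by apply: derivable_within_continuous => t _; have [] := dS t.
have S0 : \sum_(k <- s) W k * `|k%:~R| * cn (v (N, 0) k) ^+ 2 = S 0.
  by apply: eq_bigr => k _; rewrite mulr0 expR0 mul1r.
have ST : S T1 <= (gam * T1)^-1 * Mv ^+ 2.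
  have DT : D (N, T1) by rewrite /D /= lexx ltW.
  have [_ /(_ s us) h] := hv (N, T1) DT.
  apply: le_trans (ler_wpM2l _ h); last by rewrite invr_ge0 mulr_ge0// ltW.
  rewrite big_distrr /S big_seq [leRHS]big_seq; apply: ler_sum => k ks.
  rewrite -[leRHS]/(_ * _) (negbTE (k0 k ks)) expr0z mul1r.
  have kn0 : 0 < `|k%:~R : R| by rewrite normr_gt0 intr_eq0 k0.
  have gk : 0 < gam * `|k%:~R| * T1 by rewrite !mulr_gt0.
  have := expRN_le gk; rewrite -mulNr => h1.
  have -> : (gam * T1)^-1 * (W k * cn (v (N, T1) k) ^+ 2) =
     W k * `|k%:~R| * ((gam * `|k%:~R| * T1)^-1 * cn (v (N, T1) k) ^+ 2).
    by field; rewrite !gt_eqF.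
  by rewrite ler_wpM2l ?mulr_ge0// ler_wpM2r ?sqr_ge0.
rewrite S0 -(lerD2r (- S 0)) subrr.
have : - (B / gam) <= S' t0.
  by apply: S'ge; move: t0I; rewrite in_itv /= => /andP[/ltW -> /ltW ->].
move=> /(ler_wpM2r (ltW T10)); rewrite subr0 in hS; rewrite -hS mulNr [_ * T1]mulrC.
lra.
Qed.

(** The correction is harmless: [k * eps] is bounded at level 0, and [|k| |eps|^2 <= |k eps|^2]. *)
Let zenergy : exists CC, forall s : seq int, uniq s ->
  (forall k, k \in s -> eta * k%:~R < 0) -> exists N0, forall N, (N0 <= N)%N ->
  \sum_(k <- s) W k * `|k%:~R| * cn (z (N, 0) k) ^+ 2 <= CC.
Proof.
have [CC hC] := energy; have [M hM] := keps_bd.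
exists (2 * CC + 2 * M ^+ 2) => s us sk; have [N0 hN] := hC s us sk.
exists N0 => N /hN h1.
have D0 : D (N, 0) by rewrite /D /= lexx ltW.
have [_ /(_ s us) h2] := hM _ D0.
apply: le_trans (lerD (ler_wpM2l (ler0n _ 2) h1) (ler_wpM2l (ler0n _ 2) h2)).
rewrite !big_distrr -big_split big_seq [leRHS]big_seq; apply: ler_sum => k ks /=.
have k0 : k != 0 by move/sk: ks; apply: contraTneq => ->; rewrite mulr0 ltxx.
rewrite (negbTE k0) mul1r cnM cn_int.
set x := `|k%:~R : R|; have x1 : 1 <= x by exact: int_ge1.
have zv : cn (z (N, 0) k) <= cn (v (N, 0) k) + cn (eps (N, 0) k).
  by rewrite {1}(_ : z (N, 0) k = v (N, 0) k - eps (N, 0) k) ?cnB// /v addrK.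
have h3 : cn (z (N, 0) k) ^+ 2 <= 2 * cn (v (N, 0) k) ^+ 2 + 2 * cn (eps (N, 0) k) ^+ 2.
  have : cn (z (N, 0) k) ^+ 2 <= (cn (v (N, 0) k) + cn (eps (N, 0) k)) ^+ 2.
    by rewrite ler_sqr ?nnegrE ?addr_ge0 ?cn_ge0.
  have := sqr_ge0 (cn (v (N, 0) k) - cn (eps (N, 0) k)); rewrite sqrrB sqrrD; lra.
have xx : x * cn (eps (N, 0) k) ^+ 2 <= (x * cn (eps (N, 0) k)) ^+ 2.
  by rewrite exprMn ler_wpM2r ?sqr_ge0// expr2 ler_peMr// (le_trans ler01).
have := ler_wpM2l (mulr_ge0 (W0 k) (le_trans ler01 x1)) h3.
move=> /le_trans; apply; have := ler_wpM2l (mulr_ge0 (ler0n _ 2) (W0 k)) xx => h4.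
have -> : W k * x * (2 * cn (v (N, 0) k) ^+ 2 + 2 * cn (eps (N, 0) k) ^+ 2) =
  2 * (W k * x * cn (v (N, 0) k) ^+ 2) + 2 * W k * (x * cn (eps (N, 0) k) ^+ 2) by ring.
by rewrite lerD2l; apply: le_trans h4 _; apply: eq_ler; ring.
Qed.

(* [qq] inverts the gauge only up to [qq * g0 - 1], a tail of the exponential series. *)
Let qq (p : P) : L := texp (lfact R) p.1.+2 (- lam p).
Let blqq : bl 2 qq.
Proof. exact: (bl_texp (m := 2) (fun p : P => p.1.+2) (bl_opp bllam)). Qed.

Let qq_small (e : R) : 0 < e -> exists N0, forall N, (N0 <= N)%N ->
  nb W 0 e ((qq (N, 0) * g0 (N, 0) - 1) * r (N, 0)).
Proof.
move=> e0; have [Ml hl] := bllam; have [Mr hr] := blr.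
have D0 N : D (N, 0) by rewrite /D /= lexx ltW.
have Mr0 := nb_ge0 (hr _ (D0 0%N)).
pose X := KW W * Ml; pose A := KW W * nb1 W * Mr.
have A0 : 0 <= A by rewrite !mulr_ge0 ?KW_ge0 ?sqrtr_ge0.
have /cvgrPdist_le /(_ (e / (A + 1))) := texpM_cvg X.
rewrite divr_gt0 ?ltr_wpDl// => /(_ isT) [N0 _ h0]; exists N0 => N hN.
have h1 := nb_texp_inv N.+2 (hl _ (D0 N)).
have h2 := @nb_mono _ _ 2 0 _ _ _ _ h1 isT (lexx _) (fun k => lexx _).
apply: (nb_mono (nbM (m := 0) h2 (hr _ (D0 N)))) => //.
have := h0 N.+2; rewrite /= sub0r normrN => /(_ (leq_trans hN (leq_trans (leqnSn _) (leqnSn _)))).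
move=> /(le_trans (ler_norm _)) h3; rewrite -/X.
set Y := _ - _; rewrite (_ : _ * _ = A * Y); last by rewrite /A; ring.
apply: le_trans (ler_wpM2l A0 h3) _; rewrite mulrCA ler_piMr ?(ltW e0)//.
by rewrite ler_pdivrMr ?ltr_wpDl// mul1r lerDl.
Qed.

Let sqrt_jb k j : j != 0 -> Num.sqrt `|k%:~R| <= jb R (k - j) * Num.sqrt `|j%:~R : R|.
Proof.
move=> j0; rewrite -ler_sqr ?nnegrE ?mulr_ge0 ?sqrtr_ge0 ?jb_ge0// exprMn !sqr_sqrtr//.
have h : `|k%:~R : R| <= `|(k - j)%:~R| + `|j%:~R|.
  by apply: le_trans (ler_normD _ _); rewrite -rmorphD subrK.
have := int_ge1 j0; rewrite jb_int1; move: h.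
set x := `|k%:~R : R|; set w := `|(k - j)%:~R : R|; set y := `|j%:~R : R|.
have w0 : 0 <= w by exact: normr_ge0.
move=> h y1; rewrite sqrrD expr1n mul1r; nra.
Qed.

Let sqrt_jb2 k j : (absz k <= absz (k - j))%N -> Num.sqrt `|k%:~R| <= jb R (k - j).
Proof.
move=> h; rewrite -ler_sqr ?nnegrE ?sqrtr_ge0 ?jb_ge0// sqr_sqrtr//.
apply: (@le_trans _ _ (jb R k)); first exact: jb_int.
apply: (@le_trans _ _ (jb R (k - j))); first by rewrite /jb ler_nat.
by rewrite expr2 ler_peMr ?jb_ge0 ?jb_ge1.
Qed.

(** The gauge is undone by [r = qq z] up to a small defect. In each product the factor [|k|^(1/2)]
    goes to [z_j] if [j] is a growing mode, where [zenergy] pays for it, and to the smooth [qq]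
    otherwise. *)
Lemma core_estimate : exists CC, forall s : seq int, uniq s ->
  (forall k, k \in s -> eta * k%:~R < 0) ->
  \sum_(k <- s) W k * `|k%:~R| * cn (k%:~R ^+ 2 * a k 0) ^+ 2 <= CC.
Proof.
have [CC hC] := zenergy; have [Mq hq] := blqq; have [Mz hz] := blz.
have D0 N : D (N, 0) by rewrite /D /= lexx ltW.
pose Cm := Num.sqrt (`|CC| + Mz ^+ 2) + Mz.
pose B := KW W * Mq * Cm.
exists (2 * B ^+ 2 + 2) => s us sk.
(* [zenergy] is needed only up to [2 * J]: a mode beyond differs from [k] by at least [|k|]. *)
pose J := (\max_(k <- s) absz k)%N.
have sJ k : k \in s -> (absz k <= J)%N by move=> ks; exact: leq_bigmax_seq.
pose s2 := [seq j <- win (2 * J)%N | eta * j%:~R < 0].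
have us2 : uniq s2 by rewrite filter_uniq ?uniq_win.
have s2k j : j \in s2 -> eta * j%:~R < 0 by rewrite mem_filter => /andP[].
have [N1 hN1] := hC s2 us2 s2k.
(* The defect of the inverse gauge is multiplied by [|k| <= J + 1]; a norm of at most [1 / (J + 1)]
   keeps its square sum below 1, whatever the list. *)
have e0 : 0 < (J.+1%:R : R)^-1 by rewrite invr_gt0.
have [N2 hN2] := qq_small e0.
pose N := maxn J (maxn N1 N2).
have n1 : (N1 <= N)%N by rewrite /N !leq_max leqnn orbT.
have n2 : (N2 <= N)%N by rewrite /N !leq_max leqnn !orbT.
have nJ : (J <= N)%N by rewrite /N leq_max leqnn.
have {hC}hZ := hN1 N n1.
have hD := hN2 N n2.
pose p : P := (N, 0).
pose y j : R := if j \in s2 then Num.sqrt `|j%:~R| * cn (z p j) else 0.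
have y0 j : 0 <= y j by rewrite /y; case: ifP => // _; rewrite mulr_ge0 ?sqrtr_ge0 ?cn_ge0.
have Mz0 := nb_ge0 (hz _ (D0 N)).
have ny : nbs W (Num.sqrt (`|CC| + Mz ^+ 2)) y.
  split=> [|t ut]; first exact: sqrtr_ge0.
  rewrite sqr_sqrtr ?addr_ge0 ?sqr_ge0//.
  apply: (@le_trans _ _ CC); last by rewrite (le_trans (ler_norm _))// lerDl sqr_ge0.
  apply: le_trans hZ.
  have -> : \sum_(k <- t) W k * y k ^+ 2 =
    \sum_(k <- [seq k <- t | k \in s2]) W k * `|k%:~R| * cn (z p k) ^+ 2.
    rewrite big_filter [RHS]big_mkcond; apply: eq_bigr => k _ /=; rewrite /y.
    by case: ifP => _; rewrite ?expr0n ?mulr0// exprMn sqr_sqrtr// mulrA.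
  apply: ler_sum_sub => //; first by rewrite filter_uniq.
    by move=> k; rewrite mem_filter => /andP[].
  by move=> k; rewrite mulr_ge0 ?sqr_ge0 ?mulr_ge0.
have nz : nbs W Mz (fun j => cn (z p j)).
  by apply: nbs_le (hz _ (D0 N)) _ (lexx _) => j; rewrite expr0z mul1r.
have nyz := nbsD ny nz.
pose aq j := jb R j ^ 1 * cn (qq p j).
have naq : nbs W Mq aq by apply: (nb_mono (hq _ (D0 N))).
have aq0 j : 0 <= aq j by rewrite mulr_ge0 ?jbz_ge0 ?cn_ge0.
pose h1 k := \sum_(j <- win (ldeg (z p))) aq (k - j) * (y j + cn (z p j)).
have h10 k : 0 <= h1 k by apply: sumr_ge0 => j _; rewrite mulr_ge0 ?addr_ge0 ?cn_ge0.
have [_ /(_ s us) nh1] : nbs W B h1.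
  apply: nbs_conv (uniq_win (ldeg (z p))) aq0 _ naq nyz _ => [j|k]; first by rewrite addr_ge0 ?cn_ge0.
  rewrite (ger0_norm (h10 k)); exact: lexx.
have [_ /(_ s us) nD] := hD.
have rE : r p = qq p * z p - (qq p * g0 p - 1) * r p by exact: ungauge_ring.
have key k : k \in s -> W k * `|k%:~R| * cn (k%:~R ^+ 2 * a k 0) ^+ 2 <=
   2 * (W k * h1 k ^+ 2) +
   2 * (J.+1%:R * (W k * (jb R k ^ 0 * cn (((qq p * g0 p - 1) * r p) k)) ^+ 2)).
  move=> ks; rewrite expr0z mul1r.
  set dlt := cn (((qq p * g0 p - 1) * r p) k).
  set x := `|k%:~R : R|.
  have rk : cn (r p k) = cn (k%:~R ^+ 2 * a k 0).
    rewrite /r coefl_ldx2 /U /=.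
    by rewrite (leq_trans (sJ k ks) nJ) mulNr cnN.
  have hr : Num.sqrt x * cn (r p k) <= h1 k + Num.sqrt x * dlt.
    rewrite rE coeflB; apply: le_trans (ler_wpM2l (sqrtr_ge0 _) (cnB _ _)) _.
    rewrite mulrDr lerD2r.
    rewrite (_ : (qq p * z p) k = lconv (qq p) (z p) k)// /lconv /h1.
    apply: le_trans (ler_wpM2l (sqrtr_ge0 _) (cn_sum _ _ _)) _.
    rewrite big_distrr; apply: ler_sum => j _; rewrite -[leLHS]/(_ * _) cnM.
    have qz0 : 0 <= cn (qq p (k - j)) * cn (z p j) by rewrite mulr_ge0 ?cn_ge0.
    (* A growing mode within the window keeps the half derivative on [z]; any other mode is too high
       or has the opposite sign to [k], and [|k - j| >= |k|]. *)
    rewrite /aq expr1z; have [js|js] := boolP (j \in s2).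
      have j0 : j != 0 by move/s2k: js; apply: contraTneq => ->; rewrite mulr0 ltxx.
      apply: (@le_trans _ _ (jb R (k - j) * cn (qq p (k - j)) * y j)).
        rewrite /y js (_ : jb R (k - j) * cn (qq p (k - j)) * _ =
          (jb R (k - j) * Num.sqrt `|j%:~R|) * (cn (qq p (k - j)) * cn (z p j))); last by ring.
        by rewrite ler_wpM2r// sqrt_jb.
      by rewrite ler_wpM2l ?mulr_ge0 ?jb_ge0 ?cn_ge0// lerDl cn_ge0.
    apply: (@le_trans _ _ (jb R (k - j) * cn (qq p (k - j)) * cn (z p j))).
      rewrite -[leRHS]mulrA ler_wpM2r// sqrt_jb2//.
      have ek := sk k ks; have kJ := sJ k ks.
      move: js; rewrite mem_filter mem_win negb_and -leNgt -ltnNge => /orP[ej|]; last exact: absz_sub_far.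
      apply: absz_sub_opp; have : 0 <= - (k * j).
        have : 0 <= - ((k * j)%:~R : R).
          have -> : - ((k * j)%:~R : R) = (- (eta * k%:~R)) * (eta * j%:~R).
            have -> : (- (eta * k%:~R)) * (eta * j%:~R) = - (eta ^+ 2 * (k%:~R * j%:~R)) by ring.
            by rewrite eta2 mul1r rmorphM.
          by rewrite mulr_ge0// oppr_ge0 ltW.
        by rewrite -rmorphN ler0z.
      by [].
    by rewrite ler_wpM2l ?mulr_ge0 ?jb_ge0 ?cn_ge0// lerDr.
  have xJ : x <= J.+1%:R.
    by apply: le_trans (jb_int R k) _; rewrite /jb ler_nat ltnS sJ.
  have x0 : 0 <= x by exact: normr_ge0.
  have hr2 : x * cn (r p k) ^+ 2 <= 2 * h1 k ^+ 2 + 2 * (x * dlt ^+ 2).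
    have e1 : x * cn (r p k) ^+ 2 = (Num.sqrt x * cn (r p k)) ^+ 2 by rewrite exprMn (sqr_sqrtr x0).
    have e2 : x * dlt ^+ 2 = (Num.sqrt x * dlt) ^+ 2 by rewrite exprMn (sqr_sqrtr x0).
    rewrite e1 e2.
    have : (Num.sqrt x * cn (r p k)) ^+ 2 <= (h1 k + Num.sqrt x * dlt) ^+ 2.
      by rewrite ler_sqr ?nnegrE ?addr_ge0 ?mulr_ge0 ?sqrtr_ge0 ?cn_ge0.
    have := sqr_ge0 (h1 k - Num.sqrt x * dlt); rewrite sqrrB sqrrD; lra.
  rewrite -rk -mulrA; apply: le_trans (ler_wpM2l (W0 k) hr2) _.
  rewrite mulrDr; apply: lerD; first by apply: eq_ler; ring.
  have -> : W k * (2 * (x * dlt ^+ 2)) = 2 * (x * (W k * dlt ^+ 2)) by ring.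
  by rewrite ler_wpM2l// ler_wpM2r// mulr_ge0 ?sqr_ge0.
rewrite big_seq; apply: le_trans (ler_sum _ key) _; rewrite -big_seq.
rewrite big_split /= -!big_distrr; apply: lerD; first by rewrite ler_wpM2l.
rewrite -[leRHS]mulr1 ler_wpM2l//; apply: le_trans (ler_wpM2l (ler0n _ _) nD) _.
rewrite exprVn expr2 invfM mulrA divff ?pnatr_eq0// mul1r invf_le1 ?ltr0n//.
by rewrite ler1n.
Qed.

End Core.

(** * Integrals and Fourier coefficients *)

Section ComplexIntegral.
Variable R : realType.
Local Notation C := R[i].
Local Notation mu := (@lebesgue_measure R).
Implicit Types (f g : R -> C) (D : set R).

Lemma ae_imp (P Q : R -> Prop) : (forall x, P x -> Q x) ->
  {ae mu, forall x, P x} -> {ae mu, forall x, Q x}.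
Proof. by move=> PQ; apply: (@filterS _ _ (ae_filter_ringOfSetsType mu)). Qed.

Lemma ae_imp2 (P Q S : R -> Prop) : (forall x, P x -> Q x -> S x) ->
  {ae mu, forall x, P x} -> {ae mu, forall x, Q x} -> {ae mu, forall x, S x}.
Proof. by move=> PQ; apply: (@filterS2 _ _ (ae_filter_ringOfSetsType mu)). Qed.

Definition cmeas f : Prop :=
  measurable_fun setT (fun x => Re (f x)) /\ measurable_fun setT (fun x => Im (f x)).

Definition rint D (h : R -> R) : Prop := mu.-integrable D (EFin \o h).

Definition ci D f : Prop := rint D (fun x => Re (f x)) /\ rint D (fun x => Im (f x)).

Lemma cmeas_cst (c : C) : cmeas (fun=> c).
Proof. by split; exact: measurable_cst. Qed.

Lemma cmeasD f g : cmeas f -> cmeas g -> cmeas (fun x => f x + g x).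
Proof.
move=> [f1 f2] [g1 g2]; split.
  by under eq_fun do rewrite cReD; exact: measurable_funD.
by under eq_fun do rewrite cImD; exact: measurable_funD.
Qed.

Lemma cmeasM f g : cmeas f -> cmeas g -> cmeas (fun x => f x * g x).
Proof.
move=> [f1 f2] [g1 g2]; split.
  by under eq_fun do rewrite cReM; apply: measurable_funB; exact: measurable_funM.
by under eq_fun do rewrite cImM; apply: measurable_funD; exact: measurable_funM.
Qed.

Lemma cmeasN f : cmeas f -> cmeas (fun x => - f x).
Proof.
by move=> hf; rewrite (_ : (fun x => _) = fun x => -1 * f x);
  [exact: cmeasM (cmeas_cst _) hf|apply/funext => x; rewrite mulN1r].
Qed.

Lemma cmeasJ f : cmeas f -> cmeas (fun x => (f x)^*).
Proof.
move=> [f1 f2]; split; first by under eq_fun do rewrite cReJ.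
by under eq_fun do rewrite cImJ; exact: measurableT_comp.
Qed.

Lemma cmeas_sum I (r : seq I) (f : I -> R -> C) : (forall i, cmeas (f i)) ->
  cmeas (fun x => \sum_(i <- r) f i x).
Proof.
move=> h; elim: r => [|i r IH].
  by under eq_fun do rewrite big_nil; exact: cmeas_cst.
by under eq_fun do rewrite big_cons; exact: cmeasD.
Qed.

Lemma cmeas_cont f : continuous (fun x => Re (f x)) -> continuous (fun x => Im (f x)) -> cmeas f.
Proof. by move=> h1 h2; split; exact: continuous_measurable_fun. Qed.

Lemma rintD D (h k : R -> R) : measurable D -> rint D h -> rint D k ->
  rint D (fun x => h x + k x).
Proof. by rewrite /rint => mD ih ik; have := @integrableD _ _ _ mu D mD _ _ ih ik; exact: eq_integrable. Qed.

Lemma rintB D (h k : R -> R) : measurable D -> rint D h -> rint D k ->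
  rint D (fun x => h x - k x).
Proof. by rewrite /rint => mD ih ik; have := @integrableB _ _ _ mu D mD _ _ ih ik; exact: eq_integrable. Qed.

Lemma rintZ D (a : R) (h : R -> R) : measurable D -> rint D h -> rint D (fun x => a * h x).
Proof. by rewrite /rint => mD ih; have := @integrableZl _ _ _ mu D mD a _ ih; exact: eq_integrable. Qed.

Lemma rint_mulb D (h k : R -> R) (M : R) : measurable D -> rint D h ->
  measurable_fun D k -> (forall x, D x -> `|k x| <= M) -> rint D (fun x => h x * k x).
Proof.
move=> mD ih mk kM; have mh := measurable_int mu ih.
have : mu.-integrable D (fun x => M%:E * (EFin \o h) x)%E by exact: integrableZl.
apply: le_integrable => //=.
  by apply/measurable_EFinP; apply: measurable_funM => //; exact/measurable_EFinP.
move=> x Dx; rewrite /= lee_fin !normrM mulrC ler_wpM2r//.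
by rewrite (le_trans (kM x Dx))// ler_norm.
Qed.

Lemma rint_bounded (a b : R) (h : R -> R) (M : R) : measurable_fun setT h ->
  (forall x, `|h x| <= M) -> rint `[a, b] h.
Proof.
move=> mh hM; have : rint `[a, b] (fun x => 1 * h x).
  apply: (rint_mulb (M := M)) => //; last exact: measurable_funTS.
  apply: continuous_compact_integrable; first exact: segment_compact.
  by move=> x; exact: cst_continuous.
by rewrite (_ : (fun x => _) = h)//; apply/funext => x; rewrite mul1r.
Qed.

Lemma ciD D f g : measurable D -> ci D f -> ci D g -> ci D (fun x => f x + g x).
Proof.
move=> mD [f1 f2] [g1 g2]; split.
  rewrite (_ : (fun x => _) = (fun x => Re (f x) + Re (g x))); last first.
    by apply/funext => x; rewrite cReD.
  exact: rintD.
rewrite (_ : (fun x => _) = (fun x => Im (f x) + Im (g x))); last first.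
  by apply/funext => x; rewrite cImD.
exact: rintD.
Qed.

Lemma ci_mulb D f g (M : R) : measurable D -> ci D f -> cmeas g ->
  (forall x, D x -> cn (g x) <= M) -> ci D (fun x => f x * g x).
Proof.
move=> mD [f1 f2] [g1 g2] gM.
have gR x : D x -> `|Re (g x)| <= M by move=> Dx; exact: le_trans (ge_cn_Re _) (gM x Dx).
have gI x : D x -> `|Im (g x)| <= M by move=> Dx; exact: le_trans (ge_cn_Im _) (gM x Dx).
have g1' := measurable_funTS (D := D) g1; have g2' := measurable_funTS (D := D) g2.
split.
  rewrite (_ : (fun x => _) = (fun x => Re (f x) * Re (g x) - Im (f x) * Im (g x))).
    exact: rintB mD (rint_mulb mD f1 g1' gR) (rint_mulb mD f2 g2' gI).
  by apply/funext => x; rewrite cReM.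
rewrite (_ : (fun x => _) = (fun x => Re (f x) * Im (g x) + Im (f x) * Re (g x))).
  exact: rintD mD (rint_mulb mD f1 g2' gI) (rint_mulb mD f2 g1' gR).
by apply/funext => x; rewrite cImM.
Qed.

Lemma ci_scale D f (c : C) : measurable D -> ci D f -> ci D (fun x => c * f x).
Proof.
move=> mD hf; have := ci_mulb mD hf (cmeas_cst c) (fun _ _ => lexx (cn c)).
by under eq_fun do rewrite mulrC.
Qed.

Lemma ci_bounded (a b : R) f (M : R) : cmeas f -> (forall x, cn (f x) <= M) -> ci `[a, b] f.
Proof.
move=> [f1 f2] fM; split; apply: rint_bounded (M) _ _ => // x.
  exact: le_trans (ge_cn_Re _) (fM x).
exact: le_trans (ge_cn_Im _) (fM x).
Qed.

Lemma ci_sum D I (r : seq I) (f : I -> R -> C) : measurable D -> (forall i, ci D (f i)) ->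
  ci D (fun x => \sum_(i <- r) f i x).
Proof.
move=> mD h; elim: r => [|i r IH].
  under eq_fun do rewrite big_nil.
  by split; have := @integrable0 _ _ _ mu D; apply: eq_integrable.
by under eq_fun do rewrite big_cons; exact: ciD.
Qed.

Lemma cintD D f g : measurable D -> ci D f -> ci D g ->
  cintegral D (fun x => f x + g x) = cintegral D f + cintegral D g.
Proof.
move=> mD [f1 f2] [g1 g2]; rewrite /cintegral.
under eq_Rintegral do rewrite cReD; under [X in _ +i* X]eq_Rintegral do rewrite cImD.
by rewrite !RintegralD.
Qed.

Lemma cintZ D f (c : C) : measurable D -> ci D f ->
  cintegral D (fun x => c * f x) = c * cintegral D f.
Proof.
move=> mD [f1 f2]; rewrite /cintegral.
under eq_Rintegral do rewrite cReM; under [X in _ +i* X]eq_Rintegral do rewrite cImM.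
rewrite RintegralB ?RintegralD//; do ?exact: rintZ.
rewrite !RintegralZl//; case: c => a b; by rewrite /= /GRing.mul.
Qed.

Lemma cint_sum D I (r : seq I) (f : I -> R -> C) : measurable D -> (forall i, ci D (f i)) ->
  cintegral D (fun x => \sum_(i <- r) f i x) = \sum_(i <- r) cintegral D (f i).
Proof.
move=> mD h; elim: r => [|i r IH].
  rewrite big_nil /cintegral; under eq_Rintegral do rewrite big_nil.
  under [X in _ +i* X]eq_Rintegral do rewrite big_nil.
  by rewrite Rintegral_cst// mul0r.
rewrite big_cons -IH -cintD//; last exact: ci_sum.
by congr cintegral; apply/funext => x; rewrite big_cons.
Qed.

Lemma rint_le_ae D (h : R -> R) (M : R) : measurable D -> (mu D < +oo)%E -> rint D h ->
  {ae mu, forall x, D x -> `|h x| <= M} -> `|\int[mu]_(x in D) h x| <= M * fine (mu D).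
Proof.
move=> mD fD ih hM; have mh := measurable_int mu ih.
rewrite -lee_fin EFin_normr_Rintegral// EFinM fineK ?ge0_fin_numE//.
apply: le_trans (le_abse_integral mu mD mh) _.
(* The sign of [M] is not given; a negative almost everywhere bound on an absolute value forces [D]
   to be null. *)
have M0 : (0 <= M)%R \/ mu D = 0%E.
  case: (leP 0%R M) => [|M0]; first by left.
  right; have [N [mN N0 sN]] := hM; apply/eqP; rewrite eq_le measure_ge0 andbT -N0.
  apply: le_measure; rewrite ?inE// => x Dx; apply: sN => /= /(_ Dx) h1.
  by have := le_lt_trans h1 M0; rewrite normr_lt0.
case: M0 => [M0|D0]; last first.
  by rewrite D0 mule0 (@null_set_integral _ _ _ mu D _ mD)//; exact: measurableT_comp.
rewrite -integral_cst//; apply: ae_ge0_le_integral => //.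
exact: measurableT_comp.
Qed.

(** The factor 2 is the price of estimating the real and the imaginary part separately. *)
Lemma cn_cint_le D f (M : R) : measurable D -> (mu D < +oo)%E -> ci D f ->
  {ae mu, forall x, D x -> cn (f x) <= M} -> cn (cintegral D f) <= 2 * M * fine (mu D).
Proof.
move=> mD fD [f1 f2] hM; apply: le_trans (cn_le_ReIm _) _.
rewrite -mulrA mulr_natl mulr2n; apply: lerD; apply: rint_le_ae => //.
  by apply: ae_imp hM => x h Dx; exact: le_trans (ge_cn_Re _) (h Dx).
by apply: ae_imp hM => x h Dx; exact: le_trans (ge_cn_Im _) (h Dx).
Qed.

Lemma eq_cint_ae D f g : measurable D -> cmeas f -> cmeas g ->
  {ae mu, forall x, D x -> f x = g x} -> cintegral D f = cintegral D g.
Proof.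
move=> mD [f1 f2] [g1 g2] fg; rewrite /cintegral /Rintegral; congr (fine _ +i* fine _).
  apply: ae_eq_integral => //; do ?by apply/measurable_EFinP; exact: measurable_funTS.
  by apply: ae_imp fg => x h Dx; rewrite /= h.
apply: ae_eq_integral => //; do ?by apply/measurable_EFinP; exact: measurable_funTS.
by apply: ae_imp fg => x h Dx; rewrite /= h.
Qed.

End ComplexIntegral.

Section FourierBasics.
Variable R : realType.
Local Notation C := R[i].
Local Notation mu := (@lebesgue_measure R).
Local Notation L := (laurent C).
Implicit Types (f g : R -> C) (k : int).

Definition torus : set R := `[- pi, pi]%classic.

Lemma measurable_torus : measurable torus. Proof. exact: measurable_itv. Qed.
Hint Resolve measurable_torus : core.

Let pi0 : 0 < pi :> R. Proof. exact: pi_gt0. Qed.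

Lemma mu_torus : mu torus = (2 * pi)%:E.
Proof.
rewrite /torus lebesgue_measure_itv /= lte_fin ifT; last by rewrite gtrN.
by rewrite -EFinB opprK mulr_natl mulr2n.
Qed.

Lemma mu_torus_lty : (mu torus < +oo)%E. Proof. by rewrite mu_torus ltry. Qed.

Lemma expiD (x y : R) : expi (x + y) = expi x * expi y.
Proof.
rewrite /expi cosD sinD; apply/eqP; rewrite eq_complex /=; apply/andP; split; apply/eqP; ring.
Qed.

Lemma expi0 : expi 0 = 1 :> C.
Proof. by rewrite /expi cos0 sin0. Qed.

Lemma cn_expi (x : R) : cn (expi x) = 1.
Proof. by rewrite /cn /expi /= cos2Dsin2 sqrtr1. Qed.

Lemma expiJ (x : R) : (expi x)^* = expi (- x).
Proof. by rewrite /expi cosN sinN. Qed.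

Lemma continuous_cosM (a : R) : continuous (fun x : R => cos (a * x)).
Proof. by move=> x; apply: continuous_comp; [exact: mulrl_continuous|exact: continuous_cos]. Qed.
Lemma continuous_sinM (a : R) : continuous (fun x : R => sin (a * x)).
Proof. by move=> x; apply: continuous_comp; [exact: mulrl_continuous|exact: continuous_sin]. Qed.

Lemma cmeas_expi (a : R) : cmeas (fun x : R => expi (a * x)).
Proof. by apply: cmeas_cont; [exact: continuous_cosM|exact: continuous_sinM]. Qed.

Lemma expi_periodic k : Defs.periodic (fun x : R => expi (k%:~R * x)).
Proof.
have h n : expi (n%:R * (2 * pi)) = 1 :> C.
  elim: n => [|n IH]; first by rewrite mul0r expi0.
  rewrite -natr1 mulrDl mul1r expiD IH mul1r /expi mulr_natl cos2pi sin2pi//.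
move=> x; rewrite mulrDr expiD; suff -> : expi (k%:~R * (2 * pi)) = 1 :> C by rewrite mulr1.
case: k => n; first exact: h.
rewrite NegzE rmorphN mulNr -expiJ h; exact: conjc1.
Qed.

Lemma meanD f g : ci torus f -> ci torus g -> mean (fun x => f x + g x) = mean f + mean g.
Proof. by move=> hf hg; rewrite /mean cintD// mulrDr. Qed.

Lemma meanZ c f : ci torus f -> mean (fun x => c * f x) = c * mean f.
Proof. by move=> hf; rewrite /mean cintZ// mulrCA. Qed.

Lemma mean_sum I (r : seq I) (f : I -> R -> C) : (forall i, ci torus (f i)) ->
  mean (fun x => \sum_(i <- r) f i x) = \sum_(i <- r) mean (f i).
Proof. by move=> h; rewrite /mean cint_sum// big_distrr. Qed.

Lemma cn_mean_le f (M : R) : ci torus f ->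
  {ae mu, forall x, torus x -> cn (f x) <= M} -> cn (mean f) <= 2 * M.
Proof.
move=> hf hM; have p2 : 0 < 2 * pi :> R by rewrite mulr_gt0.
have p3 : 0 <= (2 * pi)^-1 :> R by rewrite invr_ge0 ltW.
rewrite /mean cnM cnR (ger0_norm p3) ler_pdivrMl// mulrC.
by apply: le_trans (cn_cint_le _ mu_torus_lty hf hM) _; rewrite // mu_torus.
Qed.

Lemma mean_cst (c : C) : mean (fun=> c) = c.
Proof.
have e : fine (mu torus) = 2 * pi by rewrite mu_torus.
have e2 (a : R) : \int[mu]_(_ in torus) a = a * (2 * pi) by rewrite Rintegral_cst// e.
rewrite /mean /cintegral !e2.
have p2 : 2 * pi != 0 :> R by rewrite gt_eqF// mulr_gt0.
by case: c => a b; apply/eqP; rewrite eq_complex /= !mul0r subr0 addr0;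
  rewrite [a * _]mulrC [b * _]mulrC !mulKf// !eqxx.
Qed.

Lemma Rintegral_FTC2 (F f : R -> R) (a b : R) : a < b -> continuous f ->
  (forall x : R, is_derive x (1 : R) F (f x)) ->
  \int[mu]_(x in `[a, b]) f x = F b - F a.
Proof.
move=> ab cf dF; rewrite /Rintegral (continuous_FTC2 (F := F))//.
- exact: continuous_subspaceT.
- have cF : continuous F by move=> x; apply: differentiable_continuous; apply/derivable1_diffP; have [] := dF x.
  split; first by move=> x _; have [] := dF x.
    exact/cvg_at_right_filter/cF.
  exact/cvg_at_left_filter/cF.
- by move=> x _; rewrite derive1E; have [_] := dF x.
Qed.

Lemma is_derive_cosM (a x : R) : is_derive x (1 : R) (fun x => cos (a * x)) (- a * sin (a * x)).
Proof.
have hl : is_derive x (1 : R) (fun x => a * x) a.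
  by have := is_deriveZ a (is_derive_id x 1); rewrite /GRing.scale /= mulr1.
have := is_derive1_comp (is_derive_cos (a * x)) hl.
by congr is_derive; ring.
Qed.

Lemma is_derive_sinM (a x : R) : is_derive x (1 : R) (fun x => sin (a * x)) (a * cos (a * x)).
Proof.
have hl : is_derive x (1 : R) (fun x => a * x) a.
  by have := is_deriveZ a (is_derive_id x 1); rewrite /GRing.scale /= mulr1.
have := is_derive1_comp (is_derive_sin (a * x)) hl.
by congr is_derive; ring.
Qed.

Lemma mean_expi k : mean (fun x : R => expi (k%:~R * x)) = if k == 0 then 1 else 0.
Proof.
case: eqP => [->|/eqP k0].
  by under [X in mean X]eq_fun do rewrite mul0r expi0; rewrite mean_cst.
have kr0 : k%:~R != 0 :> R by rewrite intr_eq0.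
rewrite /mean (_ : cintegral _ _ = 0) ?mulr0// /cintegral.
have ab : - pi < pi :> R by rewrite gtrN.
(* By periodicity the exponential takes equal values at [pi] and [- pi]; its imaginary part is
   odd. *)
have s1 : sin (k%:~R * pi) = 0 :> R.
  have e := expi_periodic k (- pi).
  have e2 : expi (k%:~R * pi) = expi (- (k%:~R * pi)) :> C.
    by rewrite -mulrN -e; congr expi; ring.
  move/(congr1 (@Im R)): e2; rewrite /expi /= sinN; lra.
apply/eqP; rewrite eq_complex /=; apply/andP; split; apply/eqP.
- have dF (x : R) : is_derive x (1 : R) (fun x => k%:~R^-1 * sin (k%:~R * x)) (cos (k%:~R * x)).
    have := is_deriveZ (k%:~R^-1) (is_derive_sinM k%:~R x).
    by rewrite /GRing.scale /= mulKf.
  rewrite (Rintegral_FTC2 ab _ dF); last exact: continuous_cosM.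
  by rewrite mulrN sinN s1 oppr0 mulr0 subrr.
- have dF (x : R) : is_derive x (1 : R) (fun x => - k%:~R^-1 * cos (k%:~R * x)) (sin (k%:~R * x)).
    have := is_deriveZ (- k%:~R^-1) (is_derive_cosM k%:~R x).
    by rewrite /GRing.scale /= mulrA mulrNN mulVf// mul1r.
  rewrite (Rintegral_FTC2 ab _ dF); last exact: continuous_sinM.
  by rewrite mulrN cosN subrr.
Qed.

Definition ev (g : L) (x : R) : C := \sum_(k <- win (ldeg g)) g k * expi (k%:~R * x).

Lemma evE (s : seq int) (g : L) x : uniq s -> (forall k, g k != 0 -> k \in s) ->
  ev g x = \sum_(k <- s) g k * expi (k%:~R * x).
Proof.
move=> us gs; apply: big_supp => //; first exact: uniq_win.
move=> k; have [->|g0 _] := eqVneq (g k) 0; first by rewrite mul0r eqxx.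
by rewrite mem_win ldeg_mem// gs.
Qed.

Lemma evD (g h : L) x : ev (g + h) x = ev g x + ev h x.
Proof.
pose s := win (ldeg g + ldeg h + ldeg (g + h)).
rewrite !(@evE s) ?uniq_win//; do ?by move=> k /ldeg_mem; rewrite mem_win; lia.
by rewrite -big_split; apply: eq_bigr => k _ /=; rewrite mulrDl.
Qed.

Lemma evM (g h : L) x : ev (g * h) x = ev g x * ev h x.
Proof.
pose s := win (ldeg g + ldeg h + ldeg (g * h)).
rewrite (@evE s (g * h)) ?uniq_win//; last by move=> k /ldeg_mem; rewrite mem_win; lia.
transitivity (\sum_(k <- s) \sum_(j <- win (ldeg h))
   g (k - j) * expi ((k - j)%:~R * x) * (h j * expi (j%:~R * x))).
  apply: eq_bigr => k _; rewrite (_ : (g * h) k = lconv g h k)// /lconv big_distrl.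
  apply: eq_bigr => j _ /=; rewrite mulrACA -expiD; congr (_ * expi _).
  by rewrite -mulrDl -rmorphD subrK.
rewrite exchange_big /= [ev h x]/ev big_distrr big_seq [RHS]big_seq.
apply: eq_bigr => j; rewrite mem_win => hj; rewrite -big_distrl /=; congr (_ * _).
rewrite (@evE [seq k - j | k <- s]) ?uniq_shift ?uniq_win ?big_map// => k /ldeg_mem hk.
by apply/mapP; exists (k + j); [rewrite mem_win; lia|lia].
Qed.

Lemma ev_cst c x : ev (lcst c) x = c.
Proof.
rewrite (@evE [:: 0])//; first by rewrite big_seq1 /= mul0r expi0 mulr1.
by move=> k /=; rewrite mem_seq1; case: (k == 0); rewrite ?eqxx.
Qed.

Lemma evN (g : L) x : ev (- g) x = - ev g x.
Proof. by rewrite -mulN1r -(rmorphN1 (@lcst C)) evM ev_cst mulN1r. Qed.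

Lemma ev_mono k x : ev (lmono C k) x = expi (k%:~R * x).
Proof.
rewrite (@evE [:: k])//; first by rewrite big_seq1 /= eqxx mul1r.
by move=> j /=; rewrite mem_seq1; case: (j == k); rewrite ?eqxx.
Qed.

Lemma ev_mmap n (X : 'I_n -> L) (F : mpoly.mpoly n C) x :
  ev (mpoly.mmap (@lcst C) X F) x = mpoly.meval (fun i => ev (X i) x) F.
Proof.
elim/mpoly_ring_ind: F => [c|i|p q hp hq|p q hp hq].
- by rewrite mpoly.mmapC ev_cst mpoly.mevalC.
- by rewrite mpoly.mmapX mpoly.mmap1U mpoly.mevalXU.
- by rewrite mpoly.mmapD evD hp hq mpoly.mevalD.
- by rewrite rmorphM /= evM hp hq mpoly.mevalM.
Qed.

Lemma cmeas_ev (g : L) : cmeas (ev g).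
Proof.
by apply: cmeas_sum => k; apply: cmeasM; [exact: cmeas_cst|exact: cmeas_expi].
Qed.

Lemma cn_ev_le (g : L) x : cn (ev g x) <= \sum_(k <- win (ldeg g)) cn (g k).
Proof.
by apply: le_trans (cn_sum _ _ _) _; apply: ler_sum => k _; rewrite cnM cn_expi mulr1.
Qed.

Lemma ev_periodic (g : L) : Defs.periodic (ev g).
Proof. by move=> x; apply: eq_bigr => k _; rewrite expi_periodic. Qed.

Lemma ci_expi f (a : R) : ci torus f -> ci torus (fun x => f x * expi (a * x)).
Proof.
move=> hf; apply: (ci_mulb (M := 1)) => //; first exact: cmeas_expi.
by move=> x _; rewrite cn_expi.
Qed.

Lemma mean_ev f (g : L) : ci torus f ->
  mean (fun x => f x * ev g x) = \sum_(k <- win (ldeg g)) g k * fourier f (- k).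
Proof.
move=> hf; rewrite (_ : (fun x => _) =
    fun x => \sum_(k <- win (ldeg g)) g k * (f x * expi (k%:~R * x))); last first.
  by apply/funext => x; rewrite /ev big_distrr; apply: eq_bigr => k _; rewrite /= mulrCA.
rewrite mean_sum => [|k]; last by apply: ci_scale => //; exact: ci_expi.
apply: eq_bigr => k _; rewrite meanZ; last exact: ci_expi.
congr (_ * mean _); apply/funext => x; rewrite rmorphN mulNr opprK//.
Qed.

Lemma fourier_ev (g : L) k : fourier (ev g) k = g k.
Proof.
rewrite /fourier (_ : (fun x => _) =
    fun x => \sum_(j <- win (ldeg g)) g j * expi ((j - k)%:~R * x)); last first.
  apply/funext => x; rewrite /ev big_distrl; apply: eq_bigr => j _ /=.
  by rewrite -mulrA -expiD rmorphB mulrBl.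
have ce (a : R) : ci torus (fun x : R => expi (a * x)).
  by apply: (@ci_bounded _ _ _ _ 1); [exact: cmeas_expi|move=> x; rewrite cn_expi].
rewrite mean_sum => [|j]; last exact: ci_scale.
under eq_bigr do rewrite meanZ// mean_expi subr_eq0.
transitivity (\sum_(j <- win (ldeg g)) if j == k then g k else 0).
  by apply: eq_bigr => j _; case: eqP => [->|_]; rewrite ?mulr1 ?mulr0.
have [kg|] := boolP (k \in win (ldeg g)).
  rewrite (bigD1_seq k) ?uniq_win//= eqxx big1 ?addr0// => j /negbTE ->//.
rewrite mem_win -ltnNge => /ldegP ->.
by rewrite big1// => j _; case: ifP.
Qed.

Lemma fourierB f g k : ci torus f -> ci torus g ->
  fourier (fun x => f x - g x) k = fourier f k - fourier g k.
Proof.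
move=> hf hg; rewrite /fourier.
have e h : ci torus h -> ci torus (fun x => h x * expi (- (k%:~R * x))).
  by move=> hh; under eq_fun do rewrite -mulNr; exact: ci_expi.
rewrite (_ : (fun x => _) = fun x => f x * expi (- (k%:~R * x)) +
    (-1) * (g x * expi (- (k%:~R * x)))); last by apply/funext => x; ring.
rewrite (meanD (e _ hf)); last exact: ci_scale (e _ hg).
by rewrite (meanZ _ (e _ hg)) mulN1r.
Qed.

Lemma cn_fourier_le f k (M : R) : ci torus f ->
  {ae mu, forall x, torus x -> cn (f x) <= M} -> cn (fourier f k) <= 2 * M.
Proof.
move=> hf hM; apply: cn_mean_le.
  by under eq_fun do rewrite -mulNr; exact: ci_expi.
by apply: ae_imp hM => x h tx; rewrite cnM cn_expi mulr1 h.
Qed.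

Lemma L2P f : L2 f <-> [/\ Defs.periodic f, cmeas f & rint torus (fun x => abs2 (f x))].
Proof.
have ma : cmeas f -> measurable_fun torus (fun x => abs2 (f x)).
  move=> [m1 m2]; apply: measurable_funTS; apply: measurable_funD.
    by under eq_fun do rewrite expr2; exact: measurable_funM.
  by under eq_fun do rewrite expr2; exact: measurable_funM.
have a0 x : 0 <= abs2 (f x) by rewrite addr_ge0 ?sqr_ge0.
split=> [ [pf m1 m2 fi]|[pf [m1 m2] fi] ].
  split=> //; apply/integrableP; split; first by apply/measurable_EFinP; exact: ma.
  by under eq_integral do rewrite /= ger0_norm//.
split=> //; case/integrableP : fi => _.
by under eq_integral do rewrite /= ger0_norm//.
Qed.

Lemma L2_cmeas f : L2 f -> cmeas f. Proof. by move=> /L2P[]. Qed.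
Lemma rint_dom D (h k : R -> R) : measurable D -> measurable_fun setT h -> rint D k ->
  (forall x, `|h x| <= k x) -> rint D h.
Proof.
rewrite /rint => mD mh ik hk.
apply: le_integrable ik => //; first by apply/measurable_EFinP; exact: measurable_funTS.
by move=> x _ /=; rewrite lee_fin (le_trans (hk x))// ler_norm.
Qed.

(** [|Re z|] and [|Im z|] are at most [1 + |z|^2], and the torus has finite measure. *)
Lemma L2_ci f : L2 f -> ci torus f.
Proof.
move=> /L2P[_ [m1 m2] fi].
have i1 : rint torus (fun x => 1 + abs2 (f x)).
  apply: rintD => //; apply: (@rint_bounded _ _ _ _ 1); first exact: measurable_cst.
  by move=> x; rewrite normr1.
have b (z : C) : `|Re z| <= 1 + abs2 z /\ `|Im z| <= 1 + abs2 z.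
  have h (a b : R) : `|a| <= 1 + (a ^+ 2 + b ^+ 2).
    rewrite -[a ^+ 2]real_normK ?num_real//; have := sqr_ge0 b; have := sqr_ge0 (`|a| - 1).
    have := normr_ge0 a; rewrite sqrrB1; lra.
  by split; rewrite /abs2; [|rewrite [Re z ^+ 2 + _]addrC]; exact: h.
by split; apply: rint_dom i1 _ => // x; have [] := b (f x).
Qed.

Lemma L2_bounded f (M : R) : Defs.periodic f -> cmeas f -> (forall x, cn (f x) <= M) -> L2 f.
Proof.
move=> pf mf fM; apply/L2P; split=> //.
apply: (@rint_bounded _ _ _ _ (M ^+ 2)).
  have [m1 m2] := mf; apply: measurable_funD; under eq_fun do rewrite expr2;
    exact: measurable_funM.
move=> x; rewrite -cn_sqE ger0_norm ?sqr_ge0// ler_sqr ?nnegrE ?cn_ge0//.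
exact: le_trans (cn_ge0 _) (fM x).
Qed.

Lemma L2B f g : L2 f -> L2 g -> L2 (fun x => f x - g x).
Proof.
move=> /L2P[pf mf fi] /L2P[pg mg gi]; have mB := cmeasD mf (cmeasN mg); apply/L2P; split=> //.
  by move=> x; rewrite pf pg.
have i1 : rint torus (fun x => 2 * abs2 (f x) + 2 * abs2 (g x)).
  by apply: rintD => //; exact: rintZ.
apply: rint_dom i1 _ => //.
  have [m1 m2] := mB; apply: measurable_funD; under eq_fun do rewrite expr2;
    exact: measurable_funM.
move=> x; rewrite ger0_norm ?addr_ge0 ?sqr_ge0// /abs2 cReD cImD cReN cImN.
have := sqr_ge0 (Re (f x) + Re (g x)); have := sqr_ge0 (Im (f x) + Im (g x)).
rewrite !sqrrD !sqrrN; lra.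
Qed.

Lemma L2_ev (g : L) : L2 (ev g).
Proof. exact: L2_bounded (ev_periodic g) (cmeas_ev g) (cn_ev_le g). Qed.

End FourierBasics.
Arguments torus {R}.
Arguments measurable_torus {R}.
Arguments mu_torus {R}.
Arguments mu_torus_lty {R}.

(** * Sup bounds from summable Fourier coefficients *)

Section SupBound.
Variable R : realType.
Local Notation C := R[i].
Local Notation mu := (@lebesgue_measure R).
Local Notation L := (laurent C).
Hint Resolve measurable_torus : core.

Lemma ev_exp (g : L) n x : ev (g ^+ n) x = ev g x ^+ n.
Proof.
elim: n => [|n IH]; first by rewrite !expr0 -(rmorph1 (@lcst C)) ev_cst.
by rewrite !exprS evM IH.
Qed.

Lemma ev1 (x : R) : ev (1 : L) x = 1.
Proof. by rewrite -(expr0 (0 : L)) ev_exp expr0. Qed.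

Lemma bernoulli_sub (t : R) n : 0 <= t <= 1 -> 1 - n%:R * t <= (1 - t) ^+ n.
Proof.
move=> /andP[t0 t1]; elim: n => [|n IH]; first by rewrite mul0r subr0 expr0.
have n0 : 0 <= n%:R :> R by [].
apply: (@le_trans _ _ ((1 - t) * (1 - n%:R * t))).
  rewrite -natr1; have : 0 <= n%:R * t * t by rewrite !mulr_ge0.
  lra.
by rewrite exprS ler_wpM2l// subr_ge0.
Qed.

Lemma bernoulli_mul (t : R) n : 0 <= t <= 1 -> (1 - t) ^+ n * (1 + n%:R * t) <= 1.
Proof.
move=> /andP[t0 t1]; elim: n => [|n IH]; first by rewrite mul0r addr0 expr0 mul1r.
have n0 : 0 <= n%:R :> R by [].
apply: le_trans IH; rewrite exprSr -mulrA ler_wpM2l ?exprn_ge0 ?subr_ge0//.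
rewrite -natr1; have : 0 <= n%:R * t * t by rewrite !mulr_ge0.
have : 0 <= t * t by rewrite mulr_ge0.
lra.
Qed.

(** Bernoulli's inequality bounds the expression below by [1 - (k y)^n]. The device is the one of
    the Brosowski-Deutsch proof of the Stone-Weierstrass theorem. *)
Lemma peak_cvg1 (y : R) (k : nat) : 0 <= y -> k%:R * y < 1 -> y <= 1 ->
  (1 - y ^+ n) ^+ (k ^ n)%N @[n --> \oo] --> (1 : R).
Proof.
move=> y0 ky y1.
have t01 n : 0 <= y ^+ n <= 1 by rewrite exprn_ge0// exprn_ile1.
apply: (@squeeze_cvgr _ _ _ _ (fun n => 1 - (k%:R * y) ^+ n) (fun=> 1)).
- apply: nearW => n; apply/andP; split.
    by have := bernoulli_sub (k ^ n)%N (t01 n); rewrite natrX exprMn.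
  by have /andP[a b] := t01 n; apply: exprn_ile1; lra.
- rewrite -[X in _ --> X]subr0; apply: cvgB; first exact: cvg_cst.
  by apply: cvg_expr; rewrite ger0_norm// mulr_ge0.
- exact: cvg_cst.
Qed.

(** The dual form of Bernoulli's inequality, [(1 - t)^n (1 + n t) <= 1], bounds the expression above
    by [(k y)^(-n)]. *)
Lemma peak_cvg0 (y : R) (k : nat) : 0 <= y -> 1 < k%:R * y -> y <= 1 ->
  (1 - y ^+ n) ^+ (k ^ n)%N @[n --> \oo] --> (0 : R).
Proof.
move=> y0 ky y1; have ky0 : 0 < k%:R * y by lra.
have t01 n : 0 <= y ^+ n <= 1 by rewrite exprn_ge0// exprn_ile1.
apply: (@squeeze_cvgr _ _ _ _ (fun=> 0) (fun n => (k%:R * y)^-1 ^+ n)).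
- apply: nearW => n; apply/andP; split.
    by have /andP[a b] := t01 n; apply: exprn_ge0; lra.
  have := bernoulli_mul (k ^ n)%N (t01 n); rewrite natrX -exprMn => h.
  have e0 : 0 < (k%:R * y) ^+ n by rewrite exprn_gt0.
  rewrite exprVn -[leRHS]mul1r ler_pdivlMr//; apply: le_trans h.
  apply: ler_wpM2l; last by lra.
  by have /andP[a b] := t01 n; apply: exprn_ge0; lra.
- exact: cvg_cst.
- by apply: cvg_expr; rewrite ger0_norm ?invr_ge0 ?ltW// invf_lt1.
Qed.

Lemma rint_dct (D : set R) (h : nat -> R -> R) (f g : R -> R) : measurable D ->
  (forall n, measurable_fun D (h n)) -> measurable_fun D f -> rint D g ->
  (forall n x, D x -> `|h n x| <= g x) ->
  {ae mu, forall x, D x -> h n x @[n --> \oo] --> f x} ->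
  \int[mu]_(x in D) h n x @[n --> \oo] --> \int[mu]_(x in D) f x.
Proof.
move=> mD mh mf ig hg hf.
have hg' : {ae mu, forall x n, D x -> (`|(h n x)%:E| <= (EFin \o g) x)%E}.
  by apply: aeW => x n Dx; rewrite /= lee_fin; exact: hg.
have hf' : {ae mu, forall x, D x -> ((h n x)%:E @[n --> \oo] --> (EFin \o f) x)%E}.
  by apply: ae_imp hf => x p Dx; apply: cvg_EFin; [exact: nearW|exact: p].
have [i1 _ c] := @dominated_convergence _ _ _ mu D mD (fun n x => (h n x)%:E)
  (EFin \o f) (EFin \o g) (fun n => (measurable_EFinP _ _).2 (mh n))
  ((measurable_EFinP _ _).2 mf) hf' ig hg'.
have fi : (\int[mu]_(x in D) (EFin \o f) x)%E \is a fin_num by exact: integrable_fin_num i1.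
by apply: fine_cvg; rewrite /Rintegral fineK.
Qed.

(** The square of the sine of half the angle from [theta], written as a trigonometric polynomial. *)
Definition bump_arg (theta x : R) : R := (1 - cos (x - theta)) / 2.

Lemma bump_arg01 theta x : 0 <= bump_arg theta x <= 1.
Proof. by rewrite /bump_arg; have := cos_le1 (x - theta); have := cos_geN1 (x - theta); lra. Qed.

(* For [0 <= y <= 1], [(1 - y^n)^(k^n)] tends to the indicator of [y < 1/k].  With
   [y = bump_arg theta x] it is a trigonometric polynomial in [x], and the set
   [y < 1/k] is a short arc around [theta]. *)
Definition peak (k : nat) theta n x : R := (1 - bump_arg theta x ^+ n) ^+ (k ^ n)%N.

Lemma peak01 k theta n x : 0 <= peak k theta n x <= 1.
Proof.
have /andP[a b] := bump_arg01 theta x.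
have p1 : 0 <= 1 - bump_arg theta x ^+ n by rewrite subr_ge0 exprn_ile1.
by rewrite /peak exprn_ge0//= exprn_ile1// gerBl exprn_ge0.
Qed.

Lemma peak_laurent k theta n : exists g : L, forall x, ev g x = (peak k theta n x)%:C.
Proof.
pose y : L := lcst 2^-1 * (1 - lcst 2^-1 *
  (lcst (expi (- theta)) * lmono C 1 + lcst (expi theta) * lmono C (-1))).
have ey x : ev y x = (bump_arg theta x)%:C.
  rewrite /y evM ev_cst evD ev1 evN evM ev_cst evD !evM !ev_cst !ev_mono -!expiD.
  rewrite rmorphN mulNr !mul1r [- theta + x]addrC.
  rewrite (_ : theta - x = - (x - theta)); last by rewrite opprB.
  rewrite -expiJ /expi /bump_arg; apply/eqP; rewrite eq_complex; apply/andP.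
  by split; apply/eqP; rewrite /=; field.
exists ((1 - y ^+ n) ^+ (k ^ n)%N) => x.
by rewrite ev_exp evD ev1 evN ev_exp ey /peak rmorphXn rmorphB rmorph1 rmorphXn.
Qed.

Lemma measurable_peak k theta n : measurable_fun setT (peak k theta n).
Proof.
have [g hg] := peak_laurent k theta n.
by have [m _] := cmeas_ev g; move: m; under eq_fun do rewrite hg.
Qed.

(** The difference of two points of the torus interval can exceed [pi]. Beyond [pi] the cosine
    increases again, but it returns to [cos al] only at [2 * pi - al]. *)
Lemma cos_cmp (al z : R) : 0 < al < pi -> `|z| < 2 * pi - al ->
  (`|z| < al -> cos al < cos z) /\ (al < `|z| -> cos z < cos al).
Proof.
move=> /andP[al0 al1] hz; have p0 := pi_gt0 R.
have -> : cos z = cos `|z| by case: (ger0P z) => // _; rewrite cosN.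
have z0 := normr_ge0 z; move: hz z0; set w := `|z| => hz z0.
have i (x : R) : 0 <= x -> x <= pi -> x \in `[0, pi] by move=> a b; rewrite in_itv /= a b.
split=> h; first by rewrite ltr_cos ?i//; lra.
have [wp|wp] := leP w pi; first by rewrite ltr_cos ?i//; lra.
have -> : cos w = cos (2 * pi - w) by rewrite addrC mulr_natl cosD2pi cosN.
by rewrite ltr_cos ?i//; lra.
Qed.

(** The radius is tied to an integer [k] by [bump_arg < 1 / k], which is the same as
    [cos > 1 - 2 / k = cos al]. Large [k] gives short arcs. *)
Lemma small_arc (e : R) : 0 < e -> exists (k : nat) (al : R),
  [/\ (0 < k)%N, 0 < al, al < e, al < pi & cos al = 1 - 2 / k%:R].
Proof.
move=> e0; have p0 := pi_gt0 R; pose e' := Num.min e (pi / 2).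
have e'0 : 0 < e' by rewrite lt_min e0 divr_gt0.
have e'p : e' < pi by rewrite gt_min; apply/orP; right; lra.
have e'e : e' <= e by rewrite ge_min lexx.
have i (x : R) : 0 <= x -> x <= pi -> x \in `[0, pi] by move=> a b; rewrite in_itv /= a b.
have ce : cos e' < 1 by rewrite -cos0 ltr_cos ?i//; lra.
pose d := 1 - cos e'; have d0 : 0 < d by rewrite /d; lra.
have [n hn] : exists n : nat, 2 / d < n%:R.
  by exists (Num.bound (2 / d)); apply: le_lt_trans (archi_boundP _); rewrite ?ler_norm// divr_ge0// ltW.
pose k := n.+1; have k0 : 0 < k%:R :> R by rewrite ltr0n.
have hk : 2 / k%:R < d.
  rewrite ltr_pdivrMr// mulrC -ltr_pdivrMr//; apply: lt_trans hn _; by rewrite ltr_nat.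
have k1 : 0 < 2 / k%:R :> R by rewrite divr_gt0.
have k2 : 2 / k%:R <= 2 :> R by rewrite ler_pdivrMr// ler_peMr// ler1n.
have [/andP[a0 a1] ca] := @acos_def R (1 - 2 / k%:R) ltac:(lra).
have lt1 : acos (1 - 2 / k%:R) < e'.
  rewrite -ltr_cos ?i// ?ca; last exact: ltW.
    by rewrite /d in hk; lra.
  exact: ltW.
exists k, (acos (1 - 2 / k%:R)); split=> //; last exact: lt_trans lt1 e'p.
  by apply: acos_gt0; lra.
exact: lt_le_trans lt1 e'e.
Qed.

Lemma ae_neq (a : R) : {ae mu, forall x, x != a}.
Proof.
exists [set a]; split=> //; first exact: lebesgue_measure_set1.
by move=> x /= /negP; rewrite negbK => /eqP.
Qed.

(** Dominated convergence with majorant [|h|]. The peaks need not converge to the indicator at the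
    two ends of the arc, which form a null set. *)
Lemma peak_int_cvg (h : R -> R) (k : nat) (theta al : R) : rint torus h -> (0 < k)%N ->
  0 < al < pi -> cos al = 1 - 2 / k%:R -> - pi + al < theta < pi - al ->
  \int[mu]_(x in torus) (h x * peak k theta n x) @[n --> \oo] -->
  \int[mu]_(x in ball theta al) h x.
Proof.
move=> ih k0 hal ca ht; have p0 := pi_gt0 R.
have k0r : 0 < k%:R :> R by rewrite ltr0n.
have sub : ball theta al `<=` torus.
  move=> x; rewrite /ball /= /torus /= in_itv /= ltr_norml; lra.
have mb : measurable (ball theta al) by exact: measurable_ball.
have mh : measurable_fun torus h by apply/measurable_EFinP; exact: measurable_int ih.
rewrite (_ : \int[mu]_(x in ball theta al) h x =
    \int[mu]_(x in torus) (h \_ (ball theta al)) x); last first.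
  by rewrite -Rintegral_mkcondr setIidr.
apply: (rint_dct (g := fun x => `|h x|)) => //.
- by move=> n; apply: measurable_funM => //; apply: measurable_funTS; exact: measurable_peak.
- have mi : measurable_fun (torus `&` ball theta al) h.
    apply: (@measurable_funS _ _ _ _ torus (torus `&` ball theta al) h measurable_torus _ mh).
    by move=> x [].
  exact: ((measurable_restrict h mb measurable_torus).1 mi).
- exact: integrable_norm ih.
- move=> n x _; rewrite normrM ler_piMr// ger0_norm; have /andP[a b] := peak01 k theta n x => //.
apply: ae_imp2 (ae_neq (theta - al)) (ae_neq (theta + al)) => x n1 n2 tx.
have hx : `|x - theta| < 2 * pi - al.
  by move: tx; rewrite /torus /= in_itv /= ltr_norml; lra.
have [c1 c2] := cos_cmp hal hx; have /andP[y0 y1] := bump_arg01 theta x.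
have ek : k%:R * bump_arg theta x = 1 + k%:R / 2 * (cos al - cos (x - theta)).
  by rewrite ca /bump_arg; field; rewrite gt_eqF.
rewrite patchE; case: ifPn => [/set_mem|/negP xb].
  rewrite /ball /= distrC => /c1 hc; rewrite -[X in _ --> X]mulr1.
  apply: cvgM; first exact: cvg_cst.
  by apply: peak_cvg1 => //; rewrite ek -subr_lt0 addrAC subrr add0r pmulr_rlt0 ?divr_gt0// subr_lt0.
have {}xb : al < `|x - theta|.
  rewrite lt_neqAle; apply/andP; split; last first.
    by rewrite leNgt; apply/negP => q; apply: xb; rewrite inE /ball /= distrC.
  apply/eqP => q; case: (ger0P (x - theta)) q => _ q.
    by move/eqP: n2; apply; rewrite q addrC subrK.
  by move/eqP: n1; apply; rewrite q opprK addrC subrK.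
rewrite /point /= -(mulr0 (h x)); apply: cvgM; first exact: cvg_cst.
apply: peak_cvg0 => //.
by rewrite ek ltrDl mulr_gt0 ?divr_gt0// subr_gt0 c2.
Qed.

Lemma arc_average_le (h : R -> R) (B : R) (k : nat) (theta al : R) : rint torus h -> (0 < k)%N ->
  (forall (g : L) (K : R -> R), (forall x, ev g x = (K x)%:C) -> (forall x, 0 <= K x <= 1) ->
    `|\int[mu]_(x in torus) (h x * K x)| <= B * \int[mu]_(x in torus) K x) ->
  0 < al < pi -> cos al = 1 - 2 / k%:R -> - pi + al < theta < pi - al ->
  `|\int[mu]_(x in ball theta al) h x| <= B * (al * 2).
Proof.
move=> ih k0 hB hal ca ht.
have i1 : rint torus (fun=> 1 : R).
  apply: (@rint_bounded _ _ _ _ 1); first exact: measurable_cst.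
  by move=> x; rewrite normr1.
have c1 := peak_int_cvg ih k0 hal ca ht; have c2 := peak_int_cvg i1 k0 hal ca ht.
have e2 : \int[mu]_(x in ball theta al) 1 = al * 2.
  have e : fine (mu (ball theta al)) = al * 2.
    by rewrite lebesgue_measure_ball ?mulr_natr// ltW//; case/andP: hal.
  by rewrite Rintegral_cst ?e ?mul1r//; exact: measurable_ball.
rewrite -e2.
apply: (ler_cvg_to (cvg_norm c1) (cvgMl_tmp c2)).
apply: nearW => n; have [g hg] := peak_laurent k theta n.
rewrite /=; under [X in _ <= _ * X]eq_Rintegral do rewrite mul1r.
exact: hB hg (peak01 k theta n).
Qed.

Let avg_contra (H B c I J : R) : H * c <= J + I -> J < c * (H - B) -> I <= B * c -> False.
Proof. by rewrite mulrBr; lra. Qed.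

(** At a Lebesgue point with [|h x| > B], the mean of [h] over a short arc would exceed [B] in
    absolute value, while the test inequality passes to arcs in the limit of the peaks. *)
Lemma ae_le_of_tests (h : R -> R) (B : R) : rint torus h ->
  (forall (g : L) (K : R -> R), (forall x, ev g x = (K x)%:C) -> (forall x, 0 <= K x <= 1) ->
    `|\int[mu]_(x in torus) (h x * K x)| <= B * \int[mu]_(x in torus) K x) ->
  {ae mu, forall x, torus x -> `|h x| <= B}.
Proof.
move=> ih hB; have p0 := pi_gt0 R.
have lp := lebesgue_differentiation (integrable_locally_restrict measurable_torus ih).
have l2 : {ae mu, forall x : R, x != pi /\ x != - pi}.
  by apply: ae_imp2 (ae_neq pi) (ae_neq (- pi)) => x.
apply: ae_imp2 lp l2 => x lpx [n1 n2]; rewrite /torus /= in_itv /= => /andP[x1 x2].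
have {n2}x1 : - pi < x by rewrite lt_neqAle eq_sym n2.
have {n1}x2 : x < pi by rewrite lt_neqAle n1.
rewrite leNgt; apply/negP => hlt; pose e := `|h x| - B.
have e0 : 0 < e by rewrite subr_gt0.
have near1 : \forall r \near 0^'+, (davg (h \_ torus) x r < e%:E)%E.
  have := lpx (fun y => (y < e%:E)%E); apply.
  exact: (@nbhs_open_ereal_lt _ 0 (fun=> e)).
move: near1 => /nbhs_right0P[r0 r00 hr0].
(* The arc must stay inside the torus interval, and its radius in the range where the mean
   oscillation of [h] around [h x] is below [e]. *)
pose m := Num.min r0 (Num.min (pi - x) (x + pi)).
have m0 : 0 < m by rewrite !lt_min r00 subr_gt0 x2 /=; lra.
have [k [al [k0 al0 alm alp ca]]] := small_arc m0.
have [m1 [m2 m3]] : al < r0 /\ al < pi - x /\ al < x + pi.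
  by move: alm; rewrite !lt_min => /andP[? /andP[]].
have ht : - pi + al < x < pi - al by apply/andP; split; lra.
have := arc_average_le ih k0 hB (introT andP (conj al0 alp)) ca ht.
have sub : ball x al `<=` torus.
  move=> y; rewrite /ball /= /torus /= in_itv /= ltr_norml; lra.
have mb : measurable (ball x al) by exact: measurable_ball.
have mub : mu (ball x al) = (al * 2)%:E by rewrite lebesgue_measure_ball ?ltW// mulr_natr.
have a2 : 0 < al * 2 by rewrite mulr_gt0.
have tx : x \in torus by rewrite inE /torus /= in_itv /= !ltW.
have ihb : rint (ball x al) h by exact: (@integrableS _ _ R mu torus (ball x al) (EFin \o h) measurable_torus mb sub ih).
have icb : rint (ball x al) (fun=> h x).
  apply: (@integrableS _ _ R mu torus (ball x al) (EFin \o fun=> h x) measurable_torus mb sub).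
  by apply: (@rint_bounded _ _ _ _ `|h x|) => //; exact: measurable_cst.
have idb : rint (ball x al) (fun y => h y - h x) by exact: rintB.
have hr : (davg (h \_ torus) x al < e%:E)%E.
  have := hr0 al; rewrite add0r; apply => //.
  by rewrite /ball_ /= sub0r normrN gtr0_norm.
move: hr; rewrite /davg /iavg mub inver gt_eqF// lte_pdivrMl//.
rewrite (_ : (\int[mu]_(y in ball x al) _)%E =
    (\int[mu]_(y in ball x al) `|(EFin \o (fun y => h y - h x)%R) y|)%E); last first.
  apply: eq_integral => y /set_mem/sub ty; have ty' : y \in torus by rewrite inE.
  by rewrite /= !patchE tx ty'.
move=> d1.
have d2 : `|\int[mu]_(y in ball x al) (h y - h x)| < al * 2 * e.
  rewrite -lte_fin EFin_normr_Rintegral//; apply: le_lt_trans d1.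
  by apply: le_abse_integral => //; exact: measurable_int idb.
have fmub : fine (mu (ball x al)) = al * 2 by rewrite mub.
move: d2; rewrite RintegralB// Rintegral_cst// fmub => d2 d3.
have : `|h x| * (al * 2) <= `|\int[mu]_(y in ball x al) h y - h x * (al * 2)| +
    `|\int[mu]_(y in ball x al) h y|.
  set I := \int[mu]_(y in ball x al) h y; set c := h x * (al * 2).
  have -> : `|h x| * (al * 2) = `|c| by rewrite normrM (gtr0_norm a2).
  by have := ler_normB I (I - c); rewrite subKr [leRHS]addrC.
by move=> q; exact: avg_contra q d2 d3.
Qed.

(** [K] is a nonnegative trigonometric polynomial, so each of its coefficients is at most twice its
    mean; pairing it with [v] costs no more than the sum of the coefficients of [v]. *)
Lemma norm_mean_test (v : R -> C) (M : R) (g : L) (K : R -> R) : L2 v ->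
  (forall s : seq int, uniq s -> \sum_(k <- s) cn (fourier v k) <= M) ->
  (forall x, ev g x = (K x)%:C) -> (forall x, 0 <= K x <= 1) ->
  cn (cintegral torus (fun x => v x * (K x)%:C)) <= 2 * M * \int[mu]_(x in torus) K x.
Proof.
move=> /L2_ci iv hM hg hK; have p0 := pi_gt0 R; have p2 : 0 < 2 * pi :> R by rewrite mulr_gt0.
have p3 : 0 <= (2 * pi)^-1 :> R by rewrite invr_ge0 ltW.
have mK : measurable_fun setT K by have [m _] := cmeas_ev g; move: m; under eq_fun do rewrite hg.
have iK : rint torus K.
  by apply: (@rint_bounded _ _ _ _ 1) => // x; rewrite ger0_norm; have /andP[] := hK x.
pose I := \int[mu]_(x in torus) K x.
have hc k : cn (g k) <= 2 * ((2 * pi)^-1 * I).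
  have h (c : R -> R) : continuous c -> (forall x, `|c x| <= 1) ->
      `|\int[mu]_(x in torus) (K x * c x)| <= I.
    move=> cc c1; have mc : measurable_fun torus c.
      by apply: measurable_funTS; exact: continuous_measurable_fun.
    have iKc : rint torus (fun x => K x * c x) by apply: (rint_mulb (M := 1)).
    have s1 := @le_normr_Rintegral _ _ _ mu torus _ measurable_torus iKc.
    have s2 : \int[mu]_(x in torus) `|K x * c x| <= I; last exact: (le_trans s1 s2).
    apply: (@le_Rintegral _ _ _ mu torus _ K measurable_torus (@integrable_norm _ _ _ mu _ _ iKc) iK).
    move=> x _; have /andP[k0 k1] := hK x.
    by rewrite /= normrM ger0_norm// ler_piMr.
  rewrite -fourier_ev /fourier /mean cnM cnR (ger0_norm p3) [leRHS]mulrCA.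
  rewrite ler_pM2l ?invr_gt0//; apply: le_trans (cn_le_ReIm _) _.
  rewrite mulr_natl mulr2n /cintegral; apply: lerD; rewrite [X in `|X|]/=.
    rewrite (@eq_Rintegral _ _ _ mu torus (fun x => K x * cos (- k%:~R * x))); last first.
      by move=> x _; rewrite hg /= mul0r subr0 mulNr.
    by apply: h; [exact: continuous_cosM|move=> x; rewrite ler_norml cos_le1 cos_geN1].
  rewrite (@eq_Rintegral _ _ _ mu torus (fun x => K x * sin (- k%:~R * x))); last first.
    by move=> x _; rewrite hg /= mul0r addr0 mulNr.
  by apply: h; [exact: continuous_sinM|move=> x; rewrite ler_norml sin_le1 sin_geN1].
have e1 : mean (fun x => v x * (K x)%:C) = \sum_(k <- win (ldeg g)) g k * fourier v (- k).
  by rewrite -mean_ev//; congr mean; apply/funext => x; rewrite hg.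
have : cn (mean (fun x => v x * (K x)%:C)) <= 2 * ((2 * pi)^-1 * I) * M.
  rewrite e1; apply: le_trans (cn_sum _ _ _) _.
  have := hM [seq - k | k <- win (ldeg g)]; rewrite big_map.
  have -> : uniq [seq - k | k <- win (ldeg g)] by rewrite map_inj_uniq ?uniq_win//; exact: oppr_inj.
  move=> /(_ isT) hM'.
  have c0 : 0 <= 2 * ((2 * pi)^-1 * I) by exact: le_trans (cn_ge0 _) (hc 0).
  apply: le_trans (ler_wpM2l c0 hM'); rewrite big_distrr.
  by apply: ler_sum => k _; rewrite cnM ler_wpM2r// cn_ge0.
rewrite /mean cnM cnR (ger0_norm p3) -/torus.
rewrite (_ : 2 * _ * M = (2 * pi)^-1 * (2 * M * I)) ?ler_pM2l ?invr_gt0//; ring.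
Qed.

(** A sup bound obtained without knowing that the Fourier series represents [v]. For [M = 0] it is
    the uniqueness theorem for Fourier coefficients. *)
Lemma ae_cn_le_of_fourier (v : R -> C) (M : R) : L2 v ->
  (forall s : seq int, uniq s -> \sum_(k <- s) cn (fourier v k) <= M) ->
  {ae mu, forall x, torus x -> cn (v x) <= 4 * M}.
Proof.
move=> lv hM; have [i1 i2] := L2_ci lv.
have b1 : {ae mu, forall x, torus x -> `|Re (v x)| <= 2 * M}.
  apply: ae_le_of_tests i1 _ => g K hg hK; apply: le_trans (norm_mean_test lv hM hg hK).
  apply: le_trans (ge_cn_Re _); rewrite /cintegral [Re _]/=.
  by rewrite (@eq_Rintegral _ _ _ mu torus (fun x => Re (v x * (K x)%:C)))// => x _; rewrite cReM /= mulr0 subr0.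
have b2 : {ae mu, forall x, torus x -> `|Im (v x)| <= 2 * M}.
  apply: ae_le_of_tests i2 _ => g K hg hK; apply: le_trans (norm_mean_test lv hM hg hK).
  apply: le_trans (ge_cn_Im _); rewrite /cintegral [Im _]/=.
  by rewrite (@eq_Rintegral _ _ _ mu torus (fun x => Im (v x * (K x)%:C)))// => x _; rewrite cImM /= mulr0 add0r.
apply: ae_imp2 b1 b2 => x h1 h2 tx; apply: le_trans (cn_le_ReIm _) _.
by have := h1 tx; have := h2 tx; lra.
Qed.

End SupBound.

(** * Fourier series and weak derivatives *)

Section FourierSeries.
Variable R : realType.
Local Notation C := R[i].
Local Notation mu := (@lebesgue_measure R).
Local Notation L := (laurent C).
Implicit Types (b c : int -> C) (v f : R -> C).
Hint Resolve measurable_torus : core.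

Definition l1b (m : nat) (M : R) b : Prop :=
  forall s : seq int, uniq s -> \sum_(k <- s) jb R k ^+ m * cn (b k) <= M.

Lemma l1b_ge0 m M b : l1b m M b -> 0 <= M.
Proof. by move=> /(_ [::] isT); rewrite big_nil. Qed.

Lemma l1b_dom m m' M b c : (forall k, jb R k ^+ m' * cn (c k) <= jb R k ^+ m * cn (b k)) ->
  l1b m M b -> l1b m' M c.
Proof. by move=> h hb s us; apply: le_trans (hb s us); exact: ler_sum. Qed.

Lemma l1b_mono m m' M b : (m' <= m)%N -> l1b m M b -> l1b m' M b.
Proof.
by move=> mm; apply: l1b_dom => k; rewrite ler_wpM2r ?cn_ge0// ler_weXn2l// jb_ge1.
Qed.

Lemma l1b_le m M M' b : M <= M' -> l1b m M b -> l1b m M' b.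
Proof. by move=> h hb s us; exact: le_trans (hb s us) h. Qed.

Lemma l1b_ltrunc m M b N : l1b m M b -> l1b m M (ltrunc N b).
Proof.
apply: l1b_dom => k; rewrite ler_wpM2l ?exprn_ge0 ?jb_ge0//=.
by case: ifP => // _; rewrite cn0 cn_ge0.
Qed.

Lemma l1b_dx m M b : l1b m.+1 M b -> l1b m M (fun k => 'i%C * k%:~R * b k).
Proof.
apply: l1b_dom => k; rewrite cnM cn_ik exprSr -mulrA ler_wpM2l ?exprn_ge0 ?jb_ge0//.
by rewrite ler_wpM2r ?cn_ge0// jb_int.
Qed.

Lemma l1b_cn M b k : l1b 0 M b -> cn (b k) <= M.
Proof. by move=> /(_ [:: k] isT); rewrite big_seq1 expr0 mul1r. Qed.

Lemma l1b_tail m e b N :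
  (forall s, uniq s -> (forall k, k \in s -> (N < absz k)%N) ->
     \sum_(k <- s) jb R k ^+ m * cn (b k) <= e) -> l1b m e (fun k => b k - ltrunc N b k).
Proof.
move=> h s us.
rewrite (_ : \sum_(k <- s) _ =
    \sum_(k <- [seq k <- s | (N < absz k)%N]) jb R k ^+ m * cn (b k)).
  by apply: h; [exact: filter_uniq|move=> k; rewrite mem_filter => /andP[]].
rewrite big_filter [RHS]big_mkcond; apply: eq_bigr => k _ /=.
by case: (leqP (absz k) N) => _; rewrite ?subr0// subrr cn0 mulr0.
Qed.

(** Beyond [N] a spare derivative is worth a factor [1 / (N + 1)]. *)
Lemma l1b_rate m M b N : l1b m.+1 M b -> l1b m (M / N.+1%:R) (fun k => b k - ltrunc N b k).
Proof.
move=> hb; apply: l1b_tail => s us hs; rewrite ler_pdivlMr ?ltr0n//.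
apply: le_trans (hb s us); rewrite big_distrl big_seq [leRHS]big_seq; apply: ler_sum => k /hs hk.
have hj : N.+1%:R <= jb R k by rewrite /jb ler_nat; lia.
rewrite /= exprSr -[leLHS]mulrA -[leRHS]mulrA ler_wpM2l ?exprn_ge0 ?jb_ge0//.
by rewrite mulrC ler_wpM2r ?cn_ge0.
Qed.

(** A list that attains the supremum up to [e] leaves at most [e] for all frequencies beyond it. *)
Lemma l1b_small m M b e : l1b m M b -> 0 < e ->
  exists N0, forall N, (N0 <= N)%N -> l1b m e (fun k => b k - ltrunc N b k).
Proof.
move=> hb e0; pose w k := jb R k ^+ m * cn (b k).
have w0 k : 0 <= w k by rewrite mulr_ge0 ?cn_ge0 ?exprn_ge0 ?jb_ge0.
pose E := [set x : R | exists2 s : seq int, uniq s & x = \sum_(k <- s) w k].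
have hE : has_sup E.
  split; first by exists 0, [::]; rewrite ?big_nil.
  by exists M => _ [s us ->]; exact: hb.
have [_ [s0 us0 ->] hs0] := sup_adherent e0 hE.
exists (\max_(k <- s0) absz k) => N hN; apply: l1b_tail => s us hs.
have : \sum_(k <- s0 ++ s) w k <= sup E.
  apply: ub_le_sup; first by case: hE.
  exists (s0 ++ s) => //; rewrite cat_uniq us0 us andbT; apply/hasPn => k ks.
  apply/negP => k0; have := hs k ks; rewrite ltnNge (leq_trans _ hN)//.
  exact: (@leq_bigmax_seq _ s0 xpredT (fun k => absz k) k).
by rewrite big_cat /=; move: hs0; lra.
Qed.

Lemma cauchy_seq_cvg (u : nat -> R) :
  (forall e, 0 < e -> exists N, forall n m, (N <= n)%N -> (N <= m)%N -> `|u n - u m| <= e) ->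
  cvgn u.
Proof.
move=> h; apply: (@R_complete R (u @ \oo)); apply: cauchy_exP => e e0.
have [N hN] := h (e / 2) ltac:(lra); exists (u N); exists N => // n /= Nn.
by apply: le_lt_trans (hN N n (leqnn N) Nn) _; lra.
Qed.

Definition fseries b (x : R) : C :=
  limn (fun N => Re (ev (ltrunc N b) x)) +i* limn (fun N => Im (ev (ltrunc N b) x)).

Lemma cn_ev_l1b M (g : L) x : l1b 0 M g -> cn (ev g x) <= M.
Proof.
move=> hg; apply: le_trans (cn_ev_le g x) _; apply: le_trans (hg _ (uniq_win (ldeg g))).
by apply: ler_sum => k _; rewrite expr0 mul1r.
Qed.

Lemma ev_ltrunc_cauchy M b e : l1b 0 M b -> 0 < e ->
  exists N0, forall N N' x, (N0 <= N)%N -> (N0 <= N')%N ->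
    cn (ev (ltrunc N b) x - ev (ltrunc N' b) x) <= e.
Proof.
move=> hb e0; have [N0 h0] := l1b_small hb e0; exists N0 => N N' x hN hN'.
rewrite -evN -evD; apply: cn_ev_l1b; apply: l1b_dom (h0 N0 (leqnn _)) => k.
rewrite !expr0 !mul1r coeflD coeflN /=.
have z : cn 0 <= cn (b k) by rewrite cn0 cn_ge0.
case: (leqP (absz k) N0) => h; first by rewrite !ifT ?subrr ?(leq_trans h).
by rewrite subr0; case: ifP => _; case: ifP => _; rewrite ?subrr ?subr0 ?sub0r ?cnN.
Qed.

Lemma fseries_cvg M b x : l1b 0 M b ->
  cvgn (fun N => Re (ev (ltrunc N b) x)) /\ cvgn (fun N => Im (ev (ltrunc N b) x)).
Proof.
move=> hb; split; apply: cauchy_seq_cvg => e e0;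
  have [N0 h0] := ev_ltrunc_cauchy hb e0; exists N0 => n m hn hm.
  by have := le_trans (ge_cn_Re _) (h0 n m x hn hm); rewrite cReD cReN.
by have := le_trans (ge_cn_Im _) (h0 n m x hn hm); rewrite cImD cImN.
Qed.

Lemma fseries_unif M b e : l1b 0 M b -> 0 < e ->
  exists N0, forall N x, (N0 <= N)%N -> cn (fseries b x - ev (ltrunc N b) x) <= e.
Proof.
move=> hb e0; have [N0 h0] := ev_ltrunc_cauchy hb (divr_gt0 e0 (ltr0Sn R 1)).
exists N0 => N x hN; have [c1 c2] := fseries_cvg x hb.
have lim_close (u : nat -> R) (a : R) : cvgn u -> (forall n, (N0 <= n)%N -> `|u n - a| <= e / 2) ->
    `|limn u - a| <= e / 2.
  move=> cu hu; have hc : `|u n - a| @[n --> \oo] --> `|limn u - a|.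
    by apply: cvg_norm; apply: cvgB => //; exact: cvg_cst.
  rewrite -(cvg_lim _ hc)//; apply: limr_le; first exact: cvgP hc.
  by exists N0.
apply: le_trans (cn_le_ReIm _) _; rewrite cReD cReN cImD cImN [e]splitr; apply: lerD.
  apply: lim_close c1 _ => n hn.
  by have := le_trans (ge_cn_Re _) (h0 n N x hn hN); rewrite cReD cReN.
apply: lim_close c2 _ => n hn.
by have := le_trans (ge_cn_Im _) (h0 n N x hn hN); rewrite cImD cImN.
Qed.

Lemma cmeas_fseries M b : l1b 0 M b -> cmeas (fseries b).
Proof.
move=> hb; split.
  apply: (measurable_fun_cvg (h := fun N x => Re (ev (ltrunc N b) x))) => [N|x _].
    by have [] := cmeas_ev (ltrunc N b).
  by have [] := fseries_cvg x hb.
apply: (measurable_fun_cvg (h := fun N x => Im (ev (ltrunc N b) x))) => [N|x _].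
  by have [] := cmeas_ev (ltrunc N b).
by have [] := fseries_cvg x hb.
Qed.

Lemma cn_fseries M b x : l1b 0 M b -> cn (fseries b x) <= M + 1.
Proof.
move=> hb; have [N0 h0] := fseries_unif hb ltr01.
rewrite -[fseries b x](subrK (ev (ltrunc N0 b) x)) addrC; apply: le_trans (cnD _ _) _.
by apply: lerD; [apply: cn_ev_l1b; exact: l1b_ltrunc|exact: h0].
Qed.

Lemma L2_fseries M b : l1b 0 M b -> L2 (fseries b).
Proof.
move=> hb; apply: (L2_bounded _ (cmeas_fseries hb) (fun x => cn_fseries x hb)) => x.
by rewrite /fseries; congr (_ +i* _); congr (limn _); apply/funext => N; rewrite ev_periodic.
Qed.

Lemma cn_le_eps (z : C) (K : R) : 0 <= K -> (forall e, 0 < e -> cn z <= K * e) -> z = 0.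
Proof.
move=> K0 h; apply: cn_eq0; apply/eqP; rewrite eq_le cn_ge0 andbT; apply/ler_addgt0Pl => e e0.
rewrite addr0; apply: le_trans (h (e / (K + 1)) _) _; first by rewrite divr_gt0//; lra.
by rewrite mulrCA ger_pMr// ler_pdivrMr; lra.
Qed.

Lemma fourier_fseries M b k : l1b 0 M b -> fourier (fseries b) k = b k.
Proof.
move=> hb; apply/eqP; rewrite -subr_eq0; apply/eqP.
apply: (@cn_le_eps _ 2) => // e e0; have [N0 h0] := fseries_unif hb e0.
pose N := (N0 + absz k)%N.
have -> : b k = fourier (ev (ltrunc N b)) k by rewrite fourier_ev /= leq_addl.
rewrite -fourierB; [|exact: L2_ci (L2_fseries hb)|exact: L2_ci (L2_ev _)].
apply: cn_fourier_le; first by apply: L2_ci; apply: L2B; [exact: L2_fseries hb|exact: L2_ev].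
by apply: aeW => x _; apply: h0; exact: leq_addr.
Qed.

Lemma is_cder_cexpi (a : R) : is_cder (fun x => expi (a * x)) (fun x => 'i%C * a%:C * expi (a * x)).
Proof.
split=> x.
  by have := is_derive_cosM a x; congr is_derive; rewrite !cReM !cImM /=; ring.
by have := is_derive_sinM a x; congr is_derive; rewrite cImM cReM cImM /=; ring.
Qed.

Lemma is_cder_ev (g : L) : is_cder (ev g) (ev (ldx g)).
Proof.
apply: is_cder_ext (is_cder_sum (win (ldeg g)) (fun k => is_cder_scale (g k) (is_cder_cexpi k%:~R))).
  by [].
move=> x; rewrite (@evE _ (win (ldeg g)))//; last 2 first.
- exact: uniq_win.
- move=> k; rewrite coefl_ldx mem_win => h; apply: ldeg_mem; apply: contraNneq h => ->.
  by rewrite mulr0.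
apply: eq_bigr => k _; rewrite coefl_ldx mulrCA mulrA.
by rewrite (_ : (k%:~R)%:C = k%:~R :> C)//; exact: rmorph_int.
Qed.

End FourierSeries.

Section WeakDerivative.
Variable R : realType.
Local Notation C := R[i].
Local Notation mu := (@lebesgue_measure R).
Local Notation L := (laurent C).
Implicit Types (b c : int -> C) (v f : R -> C).
Hint Resolve measurable_torus : core.

Lemma is_cder_cont f f' : is_cder f f' ->
  continuous (fun x => Re (f x)) /\ continuous (fun x => Im (f x)).
Proof.
move=> [h1 h2]; split=> x; apply: differentiable_continuous; apply/derivable1_diffP.
  by have [] := h1 x.
by have [] := h2 x.
Qed.

Lemma cint_FTC2 (f f' : R -> C) (a d : R) : a < d -> is_cder f f' ->
  continuous (fun x => Re (f' x)) -> continuous (fun x => Im (f' x)) ->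
  cintegral `[a, d] f' = f d - f a.
Proof.
move=> ad [h1 h2] c1 c2.
rewrite /cintegral (Rintegral_FTC2 ad c1 h1) (Rintegral_FTC2 ad c2 h2).
by apply/eqP; rewrite eq_complex /= cReD cImD cReN cImN !eqxx.
Qed.

Lemma cont_bounded f (a d : R) : a <= d ->
  continuous (fun x => Re (f x)) -> continuous (fun x => Im (f x)) ->
  exists M, forall x, x \in `[a, d] -> cn (f x) <= M.
Proof.
move=> ad c1 c2.
have b (h : R -> R) : continuous h -> exists M, forall x, x \in `[a, d] -> `|h x| <= M.
  move=> ch; have [|c _ hc] := @EVT_max R (fun x => `|h x|) a d ad.
    apply: continuous_subspaceT => x; apply: continuous_comp; first exact: ch.
    exact: norm_continuous.
  by exists `|h c|.
have [M1 h1] := b _ c1; have [M2 h2] := b _ c2; exists (M1 + M2) => x hx.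
by apply: le_trans (cn_le_ReIm _) _; apply: lerD; [exact: h1|exact: h2].
Qed.

Lemma ci_mul_cont f g : ci torus f ->
  continuous (fun x => Re (g x)) -> continuous (fun x => Im (g x)) ->
  ci torus (fun x => f x * g x).
Proof.
move=> hf c1 c2; have p0 := pi_gt0 R; have pp : - pi <= pi :> R by lra.
have [M hM] := cont_bounded pp c1 c2.
by apply: (ci_mulb (M := M)) => //; exact: cmeas_cont.
Qed.

Lemma smooth_cder (psi : R -> C) : smooth_torus psi ->
  [/\ is_cder psi (cderive1 psi), continuous (fun x => Re (cderive1 psi x)) &
      continuous (fun x => Im (cderive1 psi x))].
Proof.
move=> [_ h]; split.
- split=> x /=; rewrite derive1E; apply: derivableP; [exact: (h 0 x).1|exact: (h 0 x).2].
- by move=> x; apply: differentiable_continuous; apply/derivable1_diffP; exact: (h 1 x).1.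
- by move=> x; apply: differentiable_continuous; apply/derivable1_diffP; exact: (h 1 x).2.
Qed.

(** Integration by parts; both factors are periodic, so the boundary terms cancel. *)
Lemma mean_ev_parts (g : L) (psi : R -> C) : smooth_torus psi ->
  mean (fun x => ev (ldx g) x * psi x) = - mean (fun x => ev g x * cderive1 psi x).
Proof.
move=> hpsi; have [d1 d2 d3] := smooth_cder hpsi; have [pp _] := hpsi.
have [e1 e2] := is_cder_cont (is_cder_ev g).
have [e3 e4] := is_cder_cont (is_cder_ev (ldx g)).
have [p1 p2] := is_cder_cont d1.
have i1 : ci torus (fun x => ev (ldx g) x * psi x).
  by apply: ci_mul_cont => //; exact: L2_ci (L2_ev _).
have i2 : ci torus (fun x => ev g x * cderive1 psi x).
  by apply: ci_mul_cont => //; exact: L2_ci (L2_ev _).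
apply/eqP; rewrite -addr_eq0 -meanD//; apply/eqP.
rewrite /mean; apply/eqP; rewrite mulf_eq0; apply/orP; right; apply/eqP.
have p0 := pi_gt0 R; have pp' : - pi < pi :> R by lra.
rewrite (cint_FTC2 pp' (is_cderM (is_cder_ev g) d1)).
- have e := ev_periodic g (- pi); have e' := pp (- pi).
  have e0 : - pi + 2 * pi = pi :> R by lra.
  by rewrite e0 in e e'; rewrite e e' subrr.
- move=> x; rewrite (_ : (fun x => _) = (fun x => (Re (ev (ldx g) x) * Re (psi x) -
    Im (ev (ldx g) x) * Im (psi x)) + (Re (ev g x) * Re (cderive1 psi x) -
    Im (ev g x) * Im (cderive1 psi x)))); last by apply/funext => y; rewrite cReD !cReM.
  by apply: cvgD; apply: cvgB; apply: cvgM; [exact: e3|exact: p1|exact: e4|exact: p2|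
    exact: e1|exact: d2|exact: e2|exact: d3].
- move=> x; rewrite (_ : (fun x => _) = (fun x => (Re (ev (ldx g) x) * Im (psi x) +
    Im (ev (ldx g) x) * Re (psi x)) + (Re (ev g x) * Im (cderive1 psi x) +
    Im (ev g x) * Re (cderive1 psi x)))); last by apply/funext => y; rewrite cImD !cImM.
  by apply: cvgD; apply: cvgD; apply: cvgM; [exact: e3|exact: p2|exact: e4|exact: p1|
    exact: e1|exact: d3|exact: e2|exact: d2].
Qed.

Lemma fourier_dev v N k : L2 v ->
  fourier (fun x => v x - ev (ltrunc N (fourier v)) x) k =
  fourier v k - ltrunc N (fourier v) k.
Proof.
by move=> lv; rewrite fourierB ?fourier_ev//; [exact: L2_ci|exact: L2_ci (L2_ev _)].
Qed.

Lemma sum_cn_of_l1b v M : l1b 0 M (fourier v) ->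
  forall s : seq int, uniq s -> \sum_(k <- s) cn (fourier v k) <= M.
Proof.
by move=> h s us; apply: le_trans (h s us); apply: ler_sum => k _; rewrite expr0 mul1r.
Qed.

Lemma ae_cn_le v M : L2 v -> l1b 0 M (fourier v) ->
  {ae mu, forall x, torus x -> cn (v x) <= 4 * M}.
Proof. by move=> lv /sum_cn_of_l1b; exact: ae_cn_le_of_fourier. Qed.

Lemma l1b_ext m M b c : b =1 c -> l1b m M b -> l1b m M c.
Proof. by move=> bc; apply: l1b_dom => k; rewrite bc. Qed.

(** Truncations can be integrated by parts exactly. Those of the derivative series converge
    uniformly to it, and those of [v] are close to [v] almost everywhere by the sup bound applied to
    the difference. *)
Lemma weak_derivative_fseries v M : L2 v -> l1b 1 M (fourier v) ->
  weak_derivative v (fseries (fun k => 'i%C * k%:~R * fourier v k)).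
Proof.
move=> lv hv; set G := fseries _.
have hG : l1b 0 M (fun k => 'i%C * k%:~R * fourier v k) := l1b_dx hv.
have hv0 : l1b 0 M (fourier v) := l1b_mono (leq0n 1) hv.
have lG : L2 G := L2_fseries hG.
split=> // psi hpsi; have [d1 d2 d3] := smooth_cder hpsi; have [p1 p2] := is_cder_cont d1.
have p0 := pi_gt0 R; have pp : - pi <= pi :> R by lra.
have [B1 hB1] := cont_bounded pp p1 p2; have [B2 hB2] := cont_bounded pp d2 d3.
have B10 : 0 <= B1 by apply: le_trans (cn_ge0 (psi pi)) (hB1 _ _); rewrite in_itv /= lexx pp.
have B20 : 0 <= B2.
  by apply: le_trans (cn_ge0 (cderive1 psi pi)) (hB2 _ _); rewrite in_itv /= lexx pp.
apply/eqP; rewrite -subr_eq0 opprK; apply/eqP.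
(* The 2 comes from [cn_mean_le]; the 8 is this 2 times the 4 of [ae_cn_le]. *)
apply: (@cn_le_eps _ _ (2 * B1 + 8 * B2)) => [|e e0]; first by lra.
have [N1 h1] := fseries_unif hG e0; have [N2 h2] := l1b_small hv0 e0.
pose N := (N1 + N2)%N; pose U := ltrunc N (fourier v).
have eU : ltrunc N (fun k => 'i%C * k%:~R * fourier v k) = ldx U.
  by apply: laurentP => k; rewrite coefl_ldx /=; case: ifP => // _; rewrite mulr0.
have lU := L2_ev U; have ldU := L2_ev (ldx U).
have iU : ci torus (ev U) := L2_ci lU; have idU : ci torus (ev (ldx U)) := L2_ci ldU.
have lD : L2 (fun x => v x - ev U x) := L2B lv lU.
have lD' : L2 (fun x => G x - ev (ldx U) x) := L2B lG ldU.
have s1 : cn (mean (fun x => (G x - ev (ldx U) x) * psi x)) <= 2 * (e * B1).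
  apply: cn_mean_le; first by apply: ci_mul_cont => //; exact: L2_ci.
  apply: aeW => x tx; rewrite cnM; apply: ler_pM; rewrite ?cn_ge0//; last exact: hB1.
  by rewrite -eU; apply: h1; exact: leq_addr.
have s2 : cn (mean (fun x => (v x - ev U x) * cderive1 psi x)) <= 2 * (4 * e * B2).
  apply: cn_mean_le; first by apply: ci_mul_cont => //; exact: L2_ci.
  have hae : {ae mu, forall x, torus x -> cn (v x - ev U x) <= 4 * e}.
    apply: ae_cn_le => //; apply: l1b_ext (h2 N (leq_addl _ _)) => k.
    by rewrite fourier_dev.
  apply: ae_imp hae => x hx tx; rewrite cnM; apply: ler_pM; rewrite ?cn_ge0//; first exact: hx.
  exact: hB2.
have split1 (f g h : R -> C) : ci torus f -> ci torus g ->
    continuous (fun x => Re (h x)) -> continuous (fun x => Im (h x)) ->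
    mean (fun x => f x * h x) = mean (fun x => (f x - g x) * h x) + mean (fun x => g x * h x).
  move=> jf jg j1 j2; rewrite -meanD; last exact: ci_mul_cont.
    by congr mean; apply/funext => x; rewrite -mulrDl subrK.
  apply: ci_mul_cont => //; rewrite (_ : (fun x => _) = fun x => f x + (-1) * g x).
    by apply: ciD => //; exact: ci_scale.
  by apply/funext => x; rewrite mulN1r.
rewrite (split1 G (ev (ldx U)) psi (L2_ci lG) idU p1 p2).
rewrite (split1 v (ev U) (cderive1 psi) (L2_ci lv) iU d2 d3) (mean_ev_parts U hpsi).
rewrite addrACA [- _ + _]addNr addr0; apply: le_trans (cnD _ _) _.
by apply: le_trans (lerD s1 s2) _; rewrite le_eqVlt; apply/orP; left; apply/eqP; ring.
Qed.

(** Existence of one weak derivative makes the chosen representative [dx v] a weak derivative as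
    well; from then on only properties common to all of them are used. *)
Lemma dx_weak v M : L2 v -> l1b 1 M (fourier v) -> weak_derivative v (dx v).
Proof.
move=> lv hv; apply: (@xgetPex _ _ [set g | weak_derivative v g]).
by exists (fseries (fun k => 'i%C * k%:~R * fourier v k)); exact: weak_derivative_fseries hv.
Qed.

Lemma L2_dx v M : L2 v -> l1b 1 M (fourier v) -> L2 (dx v).
Proof. by move=> lv hv; have [] := dx_weak lv hv. Qed.

Lemma derive1n_trig (a : R) n : forall p q : R, exists p' q' : R,
  derive1n n (fun x => p * cos (a * x) + q * sin (a * x)) =
  fun x => p' * cos (a * x) + q' * sin (a * x).
Proof.
elim: n => [|n IH] p q; first by exists p, q.
have [p' [q' e]] := IH p q; exists (a * q'), (- a * p'); rewrite derive1nS e.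
apply/funext => x; rewrite derive1E.
have := is_deriveD (is_deriveZ p' (is_derive_cosM a x)) (is_deriveZ q' (is_derive_sinM a x)).
case=> _ h; apply: etrans h _; rewrite /GRing.scale /=.
by ring.
Qed.

Lemma smooth_expi (k : int) : smooth_torus (fun x : R => expi (k%:~R * x)).
Proof.
split=> [|n x]; first exact: expi_periodic.
have h (p q : R) : derivable (derive1n n (fun x => p * cos (k%:~R * x) + q * sin (k%:~R * x))) x 1.
  have [p' [q' ->]] := derive1n_trig k%:~R n p q.
  have [d _] := is_deriveD (is_deriveZ p' (is_derive_cosM k%:~R x)) (is_deriveZ q' (is_derive_sinM k%:~R x)).
  exact: d.
split.
  rewrite (_ : (fun y => _) = fun y => 1 * cos (k%:~R * y) + 0 * sin (k%:~R * y)); first exact: h.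
  by apply/funext => y; rewrite mul1r mul0r addr0.
rewrite (_ : (fun y => _) = fun y => 0 * cos (k%:~R * y) + 1 * sin (k%:~R * y)); first exact: h.
by apply/funext => y; rewrite mul1r mul0r add0r.
Qed.

Lemma cderive1_expi (a x : R) : cderive1 (fun x => expi (a * x)) x = 'i%C * a%:C * expi (a * x).
Proof.
have [h1 h2] := is_cder_cexpi a; rewrite /cderive1 !derive1E.
have [_ ->] := h1 x; have [_ ->] := h2 x; by case: (_ * _).
Qed.

Lemma fourier_dx v M k : L2 v -> l1b 1 M (fourier v) ->
  fourier (dx v) k = 'i%C * k%:~R * fourier v k.
Proof.
move=> lv hv; have [lD h] := dx_weak lv hv.
have e (f : R -> C) : fourier f k = mean (fun x => f x * expi ((- k)%:~R * x)).
  by congr mean; apply/funext => x; rewrite rmorphN mulNr.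
rewrite !e (h _ (smooth_expi (- k))).
under [X in mean X]eq_fun do rewrite cderive1_expi mulrCA.
rewrite meanZ; last by apply: ci_expi; exact: L2_ci.
rewrite -mulNr; congr (_ * _); rewrite -mulrN; congr (_ * _).
by rewrite rmorphN /= rmorphN /= opprK; exact: rmorph_int.
Qed.

End WeakDerivative.

(** * The nonlinearity *)

Section Nonlinearity.
Variable R : realType.
Local Notation C := R[i].
Local Notation mu := (@lebesgue_measure R).
Local Notation L := (laurent C).
Implicit Types (b c : int -> C) (v w f : R -> C) (F : mpoly.mpoly 4 C).
Hint Resolve measurable_torus : core.

Lemma meval_lip n (F : mpoly.mpoly n C) (K : R) : 0 <= K ->
  exists B D : R, [/\ 0 <= B, 0 <= D,
    forall X, (forall i, cn (X i) <= K) -> cn (mpoly.meval X F) <= B &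
    forall X Y d, (forall i, cn (X i) <= K) -> (forall i, cn (Y i) <= K) ->
      (forall i, cn (X i - Y i) <= d) ->
      cn (mpoly.meval X F - mpoly.meval Y F) <= D * d].
Proof.
move=> K0; elim/mpoly_ring_ind: F => [c|i|p q|p q].
- have c0 := cn_ge0 c; exists (cn c), 0; split=> // [X _|X Y d _ _ _].
    by rewrite mpoly.mevalC.
  by rewrite !mpoly.mevalC subrr cn0 mul0r.
- exists K, 1; split=> // [X hX|X Y d _ _ hd].
    by rewrite mpoly.mevalXU.
  by rewrite !mpoly.mevalXU mul1r.
- move=> [B1 [D1 [b1 d1 h1 l1]]] [B2 [D2 [b2 d2 h2 l2]]].
  have b3 := addr_ge0 b1 b2; have d3 := addr_ge0 d1 d2.
  exists (B1 + B2), (D1 + D2); split=> // [X hX|X Y d hX hY hd].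
    by rewrite mpoly.mevalD; apply: le_trans (cnD _ _) _; apply: lerD; [exact: h1|exact: h2].
  rewrite !mpoly.mevalD opprD addrACA mulrDl; apply: le_trans (cnD _ _) _.
  by apply: lerD; [exact: l1|exact: l2].
- move=> [B1 [D1 [b1 d1 h1 l1]]] [B2 [D2 [b2 d2 h2 l2]]].
  exists (B1 * B2), (B1 * D2 + D1 * B2); split; rewrite ?addr_ge0 ?mulr_ge0//.
    by move=> X hX; rewrite mpoly.mevalM cnM; apply: ler_pM; rewrite ?cn_ge0 ?h1 ?h2.
  move=> X Y d hX hY hd; rewrite !mpoly.mevalM.
  set x1 := mpoly.meval X p; set x2 := mpoly.meval X q.
  set y1 := mpoly.meval Y p; set y2 := mpoly.meval Y q.
  rewrite (_ : x1 * x2 - y1 * y2 = x1 * (x2 - y2) + (x1 - y1) * y2); last first.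
    by rewrite mulrBr mulrBl addrA subrK.
  apply: le_trans (cnD _ _) _; rewrite !cnM mulrDl -mulrA mulrAC; apply: lerD.
    by apply: ler_pM; rewrite ?cn_ge0 ?h1//; exact: l2.
  by apply: ler_pM; rewrite ?cn_ge0 ?h2//; exact: l1.
Qed.

Lemma polyval_lip F (K : R) : 0 <= K -> exists B D : R, [/\ 0 <= B, 0 <= D,
  forall al be, cn al <= K -> cn be <= K -> cn (polyval F al be) <= B &
  forall al be al' be' d, cn al <= K -> cn be <= K -> cn al' <= K -> cn be' <= K ->
    cn (al - al') <= d -> cn (be - be') <= d ->
    cn (polyval F al be - polyval F al' be') <= D * d].
Proof.
move=> K0; have [B [D [B0 D0 hB hD]]] := meval_lip F K0; exists B, D; split=> //.
  move=> al be ha hb; apply: hB.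
  by case=> -[|[|[|[|//]]]] i /=; rewrite ?cnJ.
move=> al be al' be' d h1 h2 h3 h4 h5 h6; apply: hD.
- by case=> -[|[|[|[|//]]]] i /=; rewrite ?cnJ.
- by case=> -[|[|[|[|//]]]] i /=; rewrite ?cnJ.
- by case=> -[|[|[|[|//]]]] i; rewrite [nth _ _ _]/= [X in _ - X]/= -?rmorphB ?cnJ.
Qed.

Lemma cmeas_meval n (X : 'I_n -> R -> C) (F : mpoly.mpoly n C) : (forall i, cmeas (X i)) ->
  cmeas (fun x => mpoly.meval (X^~ x) F).
Proof.
move=> hX; elim/mpoly_ring_ind: F => [c|i|p q hp hq|p q hp hq].
- by under eq_fun do rewrite mpoly.mevalC; exact: cmeas_cst.
- by under eq_fun do rewrite mpoly.mevalXU; exact: hX.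
- by under eq_fun do rewrite mpoly.mevalD; exact: cmeasD.
- by under eq_fun do rewrite mpoly.mevalM; exact: cmeasM.
Qed.

Lemma cmeas_polyval F f g : cmeas f -> cmeas g -> cmeas (fun x => polyval F (f x) (g x)).
Proof.
move=> hf hg; apply: (@cmeas_meval _ (fun i x => nth 0 [:: f x; g x; (f x)^*; (g x)^*] i)).
by case=> -[|[|[|[|//]]]] i //=; exact: cmeasJ.
Qed.

Lemma ci_ae_bounded D f (M : R) : measurable D -> (mu D < +oo)%E -> cmeas f ->
  {ae mu, forall x, D x -> cn (f x) <= M} -> ci D f.
Proof.
move=> mD fD [m1 m2] hM.
have h (g : R -> R) : measurable_fun setT g ->
    {ae mu, forall x, D x -> `|g x| <= M} -> rint D g.
  move=> mg hg; apply/integrableP; split; first by apply/measurable_EFinP; exact: measurable_funTS.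
  apply: (@le_lt_trans _ _ (\int[mu]_(x in D) (cst `|M|%:E x))%E); last first.
    by rewrite integral_cst// lte_mul_pinfty// lee_fin.
  apply: ae_ge0_le_integral => //.
  - by apply/measurable_EFinP; apply: measurableT_comp => //; exact: measurable_funTS.
  - by move=> x _; rewrite /= lee_fin.
  - by apply: ae_imp hg => x k Dx /=; rewrite lee_fin (le_trans (k Dx))// ler_norm.
split; apply: h => //; apply: ae_imp hM => x k Dx; apply: le_trans (k Dx).
  exact: ge_cn_Re.
exact: ge_cn_Im.
Qed.

Definition nonlin F v (x : R) : C := polyval F (v x) (dx v x).

Lemma ae_cn_dx_le v M : L2 v -> l1b 1 M (fourier v) ->
  {ae mu, forall x, torus x -> cn (dx v x) <= 4 * M}.
Proof.
move=> lv hv; apply: ae_cn_le; first exact: L2_dx hv.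
by apply: l1b_ext (l1b_dx hv) => k; rewrite (fourier_dx _ lv hv).
Qed.

Lemma cmeas_nonlin F v M : L2 v -> l1b 1 M (fourier v) -> cmeas (nonlin F v).
Proof.
by move=> lv hv; apply: cmeas_polyval; [exact: L2_cmeas|exact: L2_cmeas (L2_dx lv hv)].
Qed.

(** Closeness of the coefficients in [l^1] with one derivative makes both [v] and [dx v] close
    almost everywhere, and a polynomial is Lipschitz on bounded sets. *)
Lemma nonlin_lip F (K : R) : exists B D : R, [/\ 0 <= B, 0 <= D,
  forall v, L2 v -> l1b 1 K (fourier v) ->
    {ae mu, forall x, torus x -> cn (nonlin F v x) <= B} &
  forall v w d, L2 v -> L2 w -> l1b 1 K (fourier v) -> l1b 1 K (fourier w) ->
    l1b 1 d (fun k => fourier v k - fourier w k) ->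
    {ae mu, forall x, torus x -> cn (nonlin F v x - nonlin F w x) <= D * d}].
Proof.
have [K0|K0] := ltP K 0.
  exists 0, 0; split=> // [v _ h|v w d _ _ h]; have := l1b_ge0 h; lra.
have [B [D [B0 D0 hB hD]]] := @polyval_lip F (4 * K) ltac:(lra).
have D1 : 0 <= D * 4 by rewrite mulr_ge0.
exists B, (D * 4); split=> // [v lv hv|v w d lv lw hv hw hd].
  apply: ae_imp2 (ae_cn_le lv (l1b_mono (leq0n 1) hv)) (ae_cn_dx_le lv hv) => x h1 h2 tx.
  exact: hB (h1 tx) (h2 tx).
have lD := L2B lv lw; have lDx := L2B (L2_dx lv hv) (L2_dx lw hw).
have e0 k : fourier v k - fourier w k = fourier (fun x => v x - w x) k.
  by rewrite fourierB//; exact: L2_ci.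
have e1 k : 'i%C * k%:~R * (fourier v k - fourier w k) = fourier (fun x => dx v x - dx w x) k.
  rewrite fourierB; [|exact: L2_ci (L2_dx lv hv)|exact: L2_ci (L2_dx lw hw)].
  by rewrite (fourier_dx _ lv hv) (fourier_dx _ lw hw) mulrBr.
have a1 := ae_cn_le lD (l1b_ext e0 (l1b_mono (leq0n 1) hd)).
have a2 := ae_cn_le lDx (l1b_ext e1 (l1b_dx hd)).
have b1 := ae_imp2 (fun x h1 h2 => conj h1 h2)
  (ae_cn_le lv (l1b_mono (leq0n 1) hv)) (ae_cn_dx_le lv hv).
have b2 := ae_imp2 (fun x h1 h2 => conj h1 h2)
  (ae_cn_le lw (l1b_mono (leq0n 1) hw)) (ae_cn_dx_le lw hw).
have b := ae_imp2 (fun x h1 h2 => conj h1 h2) b1 b2.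
have a := ae_imp2 (fun x h1 h2 => conj h1 h2) a1 a2.
apply: ae_imp2 a b => x [h1 h2] [ [h3 h4] [h5 h6] ] tx; rewrite -mulrA.
exact: hD (h3 tx) (h4 tx) (h5 tx) (h6 tx) (h1 tx) (h2 tx).
Qed.

Lemma ci_nonlin F v M : L2 v -> l1b 1 M (fourier v) -> ci torus (nonlin F v).
Proof.
move=> lv hv; have [B [D [_ _ hB _]]] := nonlin_lip F M.
exact: ci_ae_bounded measurable_torus mu_torus_lty (cmeas_nonlin F lv hv) (hB v lv hv).
Qed.

(** An almost everywhere bound gives coefficients that are small uniformly in [k], with no decay;
    this is the form in which [Core] assumes its truncation error. *)
Lemma fourier_nonlin_lip F (K : R) : exists B D : R, [/\ 0 <= B, 0 <= D,
  forall v k, L2 v -> l1b 1 K (fourier v) -> cn (fourier (nonlin F v) k) <= B &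
  forall v w d k, L2 v -> L2 w -> l1b 1 K (fourier v) -> l1b 1 K (fourier w) ->
    l1b 1 d (fun k => fourier v k - fourier w k) ->
    cn (fourier (nonlin F v) k - fourier (nonlin F w) k) <= D * d].
Proof.
have [B [D [B0 D0 hB hD]]] := nonlin_lip F K.
have B1 : 0 <= 2 * B by rewrite mulr_ge0.
have D1 : 0 <= 2 * D by rewrite mulr_ge0.
exists (2 * B), (2 * D); split=> // [v k lv hv|v w d k lv lw hv hw hd].
  by apply: cn_fourier_le; [exact: ci_nonlin hv|exact: hB].
have iv := ci_nonlin F lv hv; have iw := ci_nonlin F lw hw.
rewrite -fourierB// -mulrA; apply: cn_fourier_le; last exact: hD.
rewrite (_ : (fun x => _) = fun x => nonlin F v x + (-1) * nonlin F w x).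
  by apply: ciD => //; exact: ci_scale.
by apply/funext => x; rewrite mulN1r.
Qed.

Lemma cJM (z w : C) : conjc (z * w) = conjc z * conjc w.
Proof. exact: (rmorphM (@conjc R)). Qed.

Lemma ev_conj (g h : L) x : (forall k, h k = (g (- k))^*) -> ev h x = (ev g x)^*.
Proof.
move=> gh; rewrite [ev g x]/ev rmorph_sum /=.
rewrite (@evE _ [seq - k | k <- win (ldeg g)]).
- rewrite big_map; apply: eq_bigr => k _.
  by rewrite gh opprK cJM expiJ rmorphN mulNr.
- by rewrite map_inj_uniq ?uniq_win//; exact: oppr_inj.
- move=> k; rewrite gh => h0; apply/mapP; exists (- k); last by rewrite opprK.
  by rewrite mem_win; apply: ldeg_mem; apply: contraNneq h0 => ->; rewrite conjc0.
Qed.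

Lemma cJ_int k : (k%:~R : C)^* = k%:~R.
Proof. exact: (rmorph_int (@conjc R)). Qed.

Lemma conjc_i : ('i%C : C)^* = - 'i%C.
Proof. by apply/eqP; rewrite eq_complex /= oppr0 !eqxx. Qed.

Lemma ev_lval (g h : L) F x : (forall k, h k = (g (- k))^*) ->
  ev (lval g h F) x = polyval F (ev g x) (ev (ldx g) x).
Proof.
move=> gh; rewrite /lval ev_mmap /polyval; congr (mpoly.meval _ _); apply/funext.
have dgh k : ldx h k = (ldx g (- k))^*.
  by rewrite !coefl_ldx gh !cJM conjc_i cJ_int rmorphN mulrNN.
by case=> -[|[|[|[|//]]]] i /=; rewrite /lvec /=; [| |exact: ev_conj|exact: ev_conj].
Qed.

(** [dx (ev g)] is a chosen representative and agrees with [ev (ldx g)] only almost everywhere: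
    their difference has zero coefficients, so the sup bound with constant 0 applies. *)
Lemma fourier_nonlin_ev F (g h : L) M k : (forall k, h k = (g (- k))^*) ->
  l1b 1 M g -> fourier (nonlin F (ev g)) k = lval g h F k.
Proof.
move=> gh hg; have hg' : l1b 1 M (fourier (ev g)) by apply: l1b_ext hg => j; rewrite fourier_ev.
have lg := L2_ev g; have lD := L2B (L2_dx lg hg') (L2_ev (ldx g)).
have z : l1b 0 0 (fourier (fun x => dx (ev g) x - ev (ldx g) x)).
  move=> s _; rewrite big1// => j _.
  rewrite fourierB; [|exact: L2_ci (L2_dx lg hg')|exact: L2_ci (L2_ev _)].
  by rewrite (fourier_dx _ lg hg') !fourier_ev coefl_ldx subrr cn0 mulr0.
rewrite -(fourier_ev (lval g h F)) /fourier /mean; congr (_ * _).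
have me : cmeas (fun x : R => expi (- (k%:~R * x))).
  by under eq_fun do rewrite -mulNr; exact: cmeas_expi.
apply: eq_cint_ae => //.
- by apply: cmeasM => //; exact: cmeas_nonlin hg'.
- by apply: cmeasM => //; exact: cmeas_ev.
- apply: ae_imp (ae_cn_le lD z) => x h0 tx; congr (_ * _); rewrite (ev_lval _ _ gh) /nonlin.
  congr (polyval F _ _); apply/eqP; rewrite -subr_eq0; apply/eqP; apply: cn_eq0.
  by apply/eqP; rewrite eq_le cn_ge0 andbT -(mulr0 4) h0.
Qed.

(** Of the two derivatives in [l^1], one is needed by the nonlinearity and the other gives the
    rate. *)
Lemma fourier_nonlin_trunc F (K : R) : exists2 D : R, 0 <= D &
  forall v N k, L2 v -> l1b 2 K (fourier v) ->
    cn (fourier (nonlin F v) k -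
        lval (ltrunc N (fourier v)) (ltrunc N (fun j => (fourier v (- j))^*)) F k) <= D / N.+1%:R.
Proof.
have [B [D [B0 D0 _ hD]]] := fourier_nonlin_lip F K.
have [K0|K0] := ltP K 0.
  by exists 0 => // v N k _ /l1b_ge0; lra.
exists (D * K) => [|v N k lv hv]; first by rewrite mulr_ge0.
have hv1 := l1b_mono (leqnSn 1) hv; have ht := l1b_ltrunc N hv1.
rewrite -(fourier_nonlin_ev F k _ ht) => [|j]; last first.
  by rewrite /= abszN; case: ifP => // _; rewrite conjc0.
rewrite -mulrA; apply: hD => //; first exact: L2_ev.
  by apply: l1b_ext ht => j; rewrite fourier_ev.
by apply: l1b_ext (l1b_rate N hv) => j; rewrite fourier_ev.
Qed.

Lemma is_cder_meval n (X X' : 'I_n -> R -> C) (F : mpoly.mpoly n C) :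
  (forall i, is_cder (X i) (X' i)) ->
  is_cder (fun t => mpoly.meval (X^~ t) F)
     (fun t => \sum_(i < n) mpoly.meval (X^~ t) (mpoly.mderiv i F) * X' i t).
Proof.
move=> hX; elim/mpoly_ring_ind: F => [c|i|p q hp hq|p q hp hq].
- apply: is_cder_ext (is_cder_cst c) => t; first by rewrite mpoly.mevalC.
  by rewrite big1// => i _; rewrite mpoly.mderivC mpoly.meval0 mul0r.
- apply: is_cder_ext (hX i) => t; first by rewrite mpoly.mevalXU.
  rewrite (bigD1 i)//= big1 => [|j ji].
    by rewrite mderiv_var eqxx mpoly.mevalC mul1r addr0.
  by rewrite mderiv_var eq_sym (negbTE ji) mpoly.mevalC mul0r.
- apply: is_cder_ext (is_cderD hp hq) => t; first by rewrite mpoly.mevalD.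
  by rewrite -big_split; apply: eq_bigr => i _; rewrite mpoly.mderivD mpoly.mevalD mulrDl.
- apply: is_cder_ext (is_cderM hp hq) => t; first by rewrite mpoly.mevalM.
  rewrite big_distrl big_distrr -big_split; apply: eq_bigr => i _ /=.
  by rewrite mpoly.mderivM mpoly.mevalD !mpoly.mevalM mulrDl mulrAC mulrA.
Qed.

Lemma cderive1_of f f' x : is_cder f f' -> cderive1 f x = f' x.
Proof.
move=> [h1 h2]; rewrite /cderive1 !derive1E.
by have [_ ->] := h1 x; have [_ ->] := h2 x; case: (f' x).
Qed.

Lemma wirtinger_ring (S : comNzRingType) (p q i : S) : i * i = -1 ->
  p * 1 + q * 1 - i * (p * i + q * - i) = 2 * p.
Proof.
move=> ii; rewrite (_ : _ - _ = p + q - (i * i) * p + (i * i) * q); last by ring.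
by rewrite ii; ring.
Qed.

(** With [p] and [q] the formal derivatives in [beta] and its conjugate, the derivatives along the
    two axes are [p + q] and [i (p - q)]; the Wirtinger combination keeps [p]. *)
Lemma F_betaE F al be : F_beta F al be = polyval (mpoly.mderiv (@ord4 1 isT) F) al be.
Proof.
pose X (p : R -> C) (i : 'I_4) (t : R) : C := nth 0 [:: al; p t; al^*; (p t)^*] i.
pose X' (p' : R -> C) (i : 'I_4) (t : R) : C := nth 0 [:: 0; p' t; 0; (p' t)^*] i.
have hX p p' : is_cder p p' -> forall i, is_cder (X p i) (X' p' i).
  move=> hp; case=> -[|[|[|[|//]]]] i; rewrite /X /X' /=.
  - exact: is_cder_cst.
  - exact: hp.
  - exact: is_cder_cst.
  - exact: (is_cder_conj hp).
have hd p p' t : is_cder p p' -> cderive1 (fun a => polyval F al (p a)) t =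
    polyval (mpoly.mderiv (@ord4 1 isT) F) al (p t) * p' t +
    polyval (mpoly.mderiv (@ord4 3 isT) F) al (p t) * conjc (p' t).
  move=> hp; rewrite (cderive1_of t (is_cder_meval F (hX p p' hp))) sum4.
  by rewrite /X' /= !mulr0 add0r addr0.
have did (t : R) : is_derive t (1 : R) (fun t : R => t) 1 by exact: is_derive_id.
have dc (c t : R) : is_derive t (1 : R) (fun=> c) (0 : R) by exact: is_derive_cst.
have d1 : is_cder (fun a => a +i* Im be) (fun=> 1) by split=> t /=.
have d2 : is_cder (fun d : R => Re be +i* d) (fun=> 'i%C) by split=> t /=.
rewrite /F_beta /wirtinger (hd _ _ _ d1) (hd _ _ _ d2).
have -> : Re be +i* Im be = be by case: be {d1 d2}.
cbv beta; rewrite conjc1 conjc_i wirtinger_ring ?mulKf//.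
by apply/eqP; rewrite eq_complex /= !(mul0r, mulr0, mulr1, sub0r, addr0, oppr0) !eqxx.
Qed.

End Nonlinearity.

(** * Sobolev norms *)

Section SobolevNorm.
Variable R : realType.
Local Notation C := R[i].
Local Notation mu := (@lebesgue_measure R).
Local Notation L := (laurent C).
Implicit Types (b c : int -> C) (v w f phi : R -> C).

Let term s f (k : int) : \bar R := ((1 + k%:~R ^+ 2) `^ s * abs2 (fourier f k))%:E.

Lemma Hs_sum (s : R) f (M : R) (ks : seq int) : 0 <= M -> (Hs_norm s f <= M%:E)%E -> uniq ks ->
  \sum_(k <- ks) sobw s k * cn (fourier f k) ^+ 2 <= M ^+ 2.
Proof.
move=> M0 hM uk; rewrite -lee_fin.
have h1 : (\esum_(k in [set: int]) term s f k <= (M ^+ 2)%:E)%E.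
  have e : sqrte (M ^+ 2)%:E = M%:E by rewrite /= sqrtr_sqr ger0_norm.
  by rewrite -lee_sqrt ?lee_fin ?sqr_ge0// e.
apply: le_trans h1; apply: esum_ge; exists [set` ks].
  by split; [exact: finite_seq|].
rewrite -fsbig_seq//= -sumEFin; apply: lee_sum => k _.
by rewrite /term cn_sqE.
Qed.

Lemma Hs_norm_lty (s : R) f (B : R) :
  (forall ks : seq int, uniq ks -> \sum_(k <- ks) sobw s k * cn (fourier f k) ^+ 2 <= B) ->
  (Hs_norm s f < +oo)%E.
Proof.
move=> hB.
have B0 : 0 <= B by have := hB [::] isT; rewrite big_nil.
apply: (@le_lt_trans _ _ (sqrte B%:E)); last by rewrite /= ltry.
rewrite /Hs_norm lee_sqrt ?lee_fin//.
apply: ge_ereal_sup => _ [X [fX _] <-]; rewrite fsbig_finite//= sumEFin lee_fin.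
apply: le_trans (hB _ (finmap.fset_uniq (fset_set X))).
by apply: ler_sum => k _; rewrite cn_sqE.
Qed.

Lemma Hs_norm_bound s f : (Hs_norm s f < +oo)%E -> exists2 M : R, 0 <= M & (Hs_norm s f <= M%:E)%E.
Proof.
have := sqrte_ge0 (\esum_(k in [set: int]) term s f k); rewrite -/(Hs_norm s f).
case: (Hs_norm s f) => [r r0 _|//|//]; exists r => //.
Qed.

(** The 2 comes from [(1 + |k|)^2 <= 2 (1 + k^2)], squared because two derivatives are counted by
    [jb]. *)
Lemma Hs_nb (s : R) (hs : 2^-1 < s - 2) f (M : R) : 0 <= M -> (Hs_norm s f <= M%:E)%E ->
  nb (sobolev_weight hs) 2 (2 * M) (fourier f).
Proof.
move=> M0 hM; split=> [|ks uk]; first by rewrite mulr_ge0.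
rewrite exprMn (_ : 2 ^+ 2 = 4 :> R); last by ring.
apply: le_trans (ler_wpM2l (ler0n R 4) (Hs_sum M0 hM uk)).
rewrite big_distrr; apply: ler_sum => k _ /=.
rewrite exprMn; move: (cn (fourier f k) ^+ 2) (sqr_ge0 (cn (fourier f k))) => z z0.
have j0 : 0 <= jb R k ^+ 2 by rewrite sqr_ge0.
have hJ : (jb R k ^ 2) ^+ 2 <= (2 * jap2 R k) ^+ 2.
  by rewrite ler_sqr ?nnegrE ?jap2_ge// mulr_ge0// ltW ?jap2_gt0.
have w0 := sobw_ge0 (s - 2) k.
apply: le_trans (ler_wpM2l w0 (ler_wpM2r z0 hJ)) _.
rewrite (_ : sobw s k = sobw (s - 2) k * jap2 R k ^+ 2); last by rewrite -sobw_nat -sobwD subrK.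
rewrite le_eqVlt; apply/orP; left; apply/eqP; ring.
Qed.

Lemma nb_l1b (W : weight R) (m : nat) (M : R) b : nb W m M b -> l1b m (Num.sqrt (SW W) * M) b.
Proof.
move=> hb ks uk; apply: le_trans (nbs_l1 hb uk); apply: ler_sum => k _.
by rewrite ger0_norm ?mulr_ge0 ?cn_ge0 ?jbz_ge0.
Qed.

Lemma Hs_l1b (s : R) : 5 / 2 < s -> exists2 A : R, 0 <= A &
  forall f M, 0 <= M -> (Hs_norm s f <= M%:E)%E -> l1b 2 (A * M) (fourier f).
Proof.
move=> hs; have hs' : 2^-1 < s - 2 by lra.
exists (Num.sqrt (SW (sobolev_weight hs')) * 2) => [|f M M0 hM].
  by rewrite mulr_ge0 ?sqrtr_ge0.
by rewrite -mulrA; apply: (nb_l1b (m := 2)); exact: Hs_nb.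
Qed.

Definition restrict_freq (p : pred int) b (k : int) : C := if p k then b k else 0.

Lemma l1b_restrict m M p b : l1b m M b -> l1b m M (restrict_freq p b).
Proof.
apply: l1b_dom => k; rewrite ler_wpM2l ?exprn_ge0 ?jb_ge0// /restrict_freq.
by case: ifP => // _; rewrite cn0 cn_ge0.
Qed.

Lemma limn_shift (u v : nat -> R) : (forall n, u n.+1 = v n) -> cvgn v -> limn u = limn v.
Proof.
move=> uv cv; apply: cvg_lim => //.
have : (fun n => u n.+1) @ \oo --> limn v by under eq_fun do rewrite uv.
by rewrite cvg_shiftS.
Qed.

Lemma csum_fseries p b M (a : R -> nat -> C) x (sg : int) : l1b 0 M b -> sg * sg = 1 ->
  (forall k, p k = (0 < sg * k)) ->
  (forall n, a x n = b (sg * n%:Z) * expi ((sg * n%:Z)%:~R * x)) ->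
  csum (a x) = fseries (restrict_freq p b) x.
Proof.
move=> hb sg1 hp ha; have [c1 c2] := fseries_cvg x (l1b_restrict p hb).
have e n : \sum_(1 <= k < n.+1) a x k = ev (ltrunc n (restrict_freq p b)) x.
  rewrite (@evE _ [seq sg * k%:Z | k <- index_iota 1 n.+1]).
  - rewrite big_map big_seq [RHS]big_seq; apply: eq_bigr => k; rewrite mem_index_iota => hk.
    rewrite ha /= /restrict_freq hp mulrA sg1 mul1r.
    by rewrite ifT; [rewrite ifT//; lia|nia].
  - rewrite map_inj_uniq ?iota_uniq// => i j /(congr1 (fun z => sg * z)).
    by rewrite !mulrA sg1 !mul1r => -[].
  - move=> k /=; rewrite /restrict_freq hp; case: ifP => [hk|]; last by rewrite eqxx.
    case: ifP => [hk0 _|]; last by rewrite eqxx.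
    apply/mapP; exists (absz k); first by rewrite mem_index_iota; nia.
    have : sg * (sg * k) = sg * `|k|%N%:Z by congr (_ * _); nia.
    by rewrite mulrA sg1 mul1r.
(* The partial sums of [csum] stop before the upper index and those of [fseries] include it, hence a
   shift by one. *)
rewrite /csum /fseries; congr (_ +i* _); apply: limn_shift => // n; rewrite -e.
  by elim/big_rec2 : _ => // i y1 y2 _ ->; rewrite cReD.
by elim/big_rec2 : _ => // i y1 y2 _ ->; rewrite cImD.
Qed.

Lemma P_plus_fseries phi M : l1b 0 M (fourier phi) ->
  P_plus phi = fseries (restrict_freq (fun k => 0 < k) (fourier phi)).
Proof.
move=> h; apply/funext => x; rewrite /P_plus.
apply: (@csum_fseries _ _ M (fun x k => fourier phi k%:Z * expi (k%:R * x)) x 1) => //.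
  by move=> k; rewrite mul1r.
by move=> n; rewrite mul1r.
Qed.

Lemma P_minus_fseries phi M : l1b 0 M (fourier phi) ->
  P_minus phi = fseries (restrict_freq (fun k => k < 0) (fourier phi)).
Proof.
move=> h; apply/funext => x; rewrite /P_minus.
apply: (@csum_fseries _ _ M (fun x k => fourier phi (- k%:Z) * expi (- (k%:R * x))) x (-1)) => //.
  by move=> k; rewrite mulN1r oppr_gt0.
by move=> n; rewrite mulN1r rmorphN mulNr.
Qed.

(** [s + delta] is at most [(s - 2) + 2 + 1/2]. For [k] nonzero [1 + k^2 <= 2 k^2], so the power 2
    costs [4 k^4] and the square root at most [2 |k|]; hence the 8. *)
Lemma sobw_gain (s delta : R) (k : int) : delta < 1 / 2 -> k != 0 ->
  sobw (s + delta) k <= 8 * (sobw (s - 2) k * `|k%:~R| * k%:~R ^+ 4).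
Proof.
move=> hd k0; have k1 : 1 <= `|k%:~R : R| by rewrite -intr_norm ler1z; lia.
have j0 := jap2_gt0 R k.
have h1 : sobw (s + delta) k <= sobw (s - 2) k * (jap2 R k ^+ 2 * jap2 R k `^ 2^-1).
  rewrite -sobw_nat -[jap2 R k `^ _]/(sobw 2^-1 k) -!sobwD; apply: sobw_mono; lra.
apply: le_trans h1 _; rewrite -mulrA [leRHS]mulrCA ler_wpM2l ?sobw_ge0//.
rewrite (powR12_sqrt (ltW j0)).
set y := `|k%:~R| in k1 *; have y2 : k%:~R ^+ 2 = y ^+ 2 :> R by rewrite real_normK ?num_real.
have jy : jap2 R k <= 2 * y ^+ 2 by rewrite /jap2 y2; nra.
have jy2 : jap2 R k <= (2 * y) ^+ 2 by nra.
have sy : Num.sqrt (jap2 R k) <= 2 * y.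
  have y0 : 0 <= 2 * y by lra.
  by rewrite -(ger0_norm y0) -sqrtr_sqr ler_wsqrtr.
have s0 := sqrtr_ge0 (jap2 R k).
have -> : 8 * (y * k%:~R ^+ 4) = (2 * y ^+ 2) ^+ 2 * (2 * y).
  by rewrite (exprM _ 2 2) y2; ring.
have y20 : 0 <= 2 * y ^+ 2 by rewrite mulr_ge0 ?sqr_ge0.
have p1 : jap2 R k ^+ 2 <= (2 * y ^+ 2) ^+ 2 by rewrite ler_sqr ?nnegrE// ltW.
exact: (ler_pM (sqr_ge0 _) s0 p1 sy).
Qed.

Lemma Hs_fseries_restrict (s delta CC M : R) phi (p : pred int) : delta < 1 / 2 ->
  l1b 0 M (fourier phi) -> (forall k, p k -> k != 0) ->
  (forall ks : seq int, uniq ks -> (forall k, k \in ks -> p k) ->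
     \sum_(k <- ks) sobw (s - 2) k * `|k%:~R| * cn (k%:~R ^+ 2 * fourier phi k) ^+ 2 <= CC) ->
  Hs (s + delta) (fseries (restrict_freq p (fourier phi))).
Proof.
move=> hd h1 p0 hC; have hr := l1b_restrict p h1; split; first exact: L2_fseries hr.
apply: (@Hs_norm_lty _ _ (8 * CC)) => ks uk.
apply: le_trans (ler_wpM2l _ (hC [seq k <- ks | p k] _ _)) => //; last 2 first.
- exact: filter_uniq.
- by move=> k; rewrite mem_filter => /andP[].
rewrite big_filter big_distrr [leRHS]big_mkcond; apply: ler_sum => k _ /=.
rewrite (fourier_fseries k hr) /restrict_freq; case: ifP => pk; last by rewrite cn0 expr0n mulr0.
rewrite (cnM _ (fourier phi k)) exprMn.
move: (cn (fourier phi k) ^+ 2) (sqr_ge0 (cn (fourier phi k))) => z z0.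
rewrite (_ : cn (k%:~R ^+ 2 : C) ^+ 2 = k%:~R ^+ 4); last first.
  by rewrite cn_prodX cn_int real_normK ?num_real// -exprM.
apply: le_trans (ler_wpM2r z0 (sobw_gain s hd (p0 k pk))) _.
by rewrite le_eqVlt; apply/orP; left; apply/eqP; ring.
Qed.

End SobolevNorm.

(** * From the weak formulation to ordinary differential equations *)

Section SmoothCutoff.
Variable R : realType.
Implicit Types p q : {poly R}.

(** The functions [p(1/x) exp(-1/x)], extended by 0, form a class closed under differentiation: the
    derivative replaces [p] by [flat_der p]. Smoothness thus needs a single computation. *)
Definition flat p (x : R) : R := if 0 < x then p.[x^-1] * expR (- x^-1) else 0.

Definition flat_der p : {poly R} := 'X^2 * (p - p^`()).

Lemma pow_le_expR (y : R) n : 0 <= y -> y ^+ n <= n`!%:R * expR y.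
Proof.
move=> y0; case: n => [|n].
  by rewrite expr0 fact0 mul1r (le_trans _ (expR_ge1Dx y))// lerDl.
have := expR_ge1Dxn n y0; rewrite -ler_pdivrMl ?ltr0n ?fact_gt0//.
by rewrite [_ / _]mulrC; apply: le_trans; rewrite lerDr.
Qed.

Lemma poly_le_expR p m : exists2 D : R, 0 <= D &
  forall y, 0 <= y -> `|p.[y] * y ^+ m| <= D * expR y.
Proof.
exists (\sum_(i < size p) `|p`_i| * (i + m)`!%:R).
  by apply: sumr_ge0 => i _; rewrite mulr_ge0.
move=> y y0; rewrite horner_coef big_distrl big_distrl /=.
apply: le_trans (ler_norm_sum _ _ _) _; apply: ler_sum => i _.
by rewrite -mulrA -exprD normrM -mulrA ler_wpM2l// ger0_norm ?exprn_ge0// pow_le_expR.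
Qed.

(** A quadratic bound is all that differentiability at 0 needs; the exponential beats every power of
    [1/x]. *)
Lemma flat_quadratic p : exists2 D : R, 0 <= D & forall x, `|flat p x| <= D * x ^+ 2.
Proof.
have [D D0 hD] := poly_le_expR p 2; exists D => // x; rewrite /flat; case: ifP => x0; last first.
  by rewrite normr0 mulr_ge0 ?sqr_ge0.
have y0 : 0 <= x^-1 by rewrite invr_ge0 ltW.
have := hD _ y0; rewrite normrM exprVn normfV (ger0_norm (sqr_ge0 x)) ler_pdivrMr ?exprn_gt0//.
rewrite normrM expRN normfV (ger0_norm (expR_ge0 _)) => h.
by rewrite ler_pdivrMr ?expR_gt0// mulrAC.
Qed.

Lemma is_derive_flat p (x : R) : is_derive x (1 : R) (flat p) (flat (flat_der p) x).
Proof.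
have [x0|x0|x0] := ltrgtP x 0.
- rewrite {2}/flat lt_gtF//; have h : is_derive x (1 : R) (fun=> 0 : R) (0 : R) by exact: is_derive_cst.
  apply: near_eq_is_derive h.
  by apply: filterS (lt_nbhsl x0) => y y0; rewrite /flat lt_gtF.
- have xn : x != 0 by rewrite gt_eqF.
  have dV := is_deriveV xn (is_derive_id x (1 : R)).
  have d1 := is_derive1_comp (is_derive_poly p x^-1) dV.
  have d2 := @is_derive1_comp _ expR (fun x => - x^-1) x _ _ (is_derive_expR (- x^-1)) (is_deriveN dV).
  have h : is_derive x (1 : R) (fun x : R => p.[x^-1] * expR (- x^-1)) (flat (flat_der p) x).
    have := is_deriveM d1 d2; congr is_derive.
    rewrite /flat x0 /flat_der /GRing.scale /= !(hornerM, hornerXn, hornerD, hornerN) mulr1.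
    by rewrite !hornerX -exprVn; ring.
  by apply: near_eq_is_derive h; apply: filterS (lt_nbhsr x0) => y y0; rewrite /flat y0.
- rewrite x0 {2}/flat ltxx; have [D D0 hD] := flat_quadratic p.
  have f0 : flat p 0 = 0 by rewrite /flat ltxx.
  apply/is_derive1_caratheodory; exists (fun z => flat p z / z); split.
  + move=> z; rewrite f0 !subr0; have [->|z0] := eqVneq z 0; first by rewrite f0 !mul0r.
    by rewrite divfK.
  + apply/(@cvgrPdist_le _ R) => e e0; rewrite f0 mul0r.
    apply: filterS (@nbhsx_ballx _ R 0 (e / (D + 1)) _); last by rewrite divr_gt0//; lra.
    move=> z; rewrite /ball /= !sub0r !normrN => hz.
    have [->|z0] := eqVneq z 0; first by rewrite f0 mul0r normr0 ltW.
    rewrite normrM normfV ler_pdivrMr ?normr_gt0//; apply: le_trans (hD z) _.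
    rewrite -[z ^+ 2]real_normK ?num_real// expr2 mulrA ler_wpM2r//.
    apply: le_trans (_ : (D + 1) * `|z| <= _).
      by rewrite ler_wpM2r// lerDl.
    by rewrite mulrC -ler_pdivlMr ?ltW//; lra.
  + by rewrite f0 mul0r.
Qed.

Lemma flat0 p x : x <= 0 -> flat p x = 0.
Proof. by move=> x0; rewrite /flat ltNge x0. Qed.

(** For [p = 1] and [c > 0] it vanishes from [T0] on and tends to 1 before [T0] as [c] grows. A
    negative [c] gives the reflected profile, used for reversed time. *)
Definition cutoff p (c T0 t : R) : R := flat p (c * (T0 - t)).

Lemma is_derive_cutoff p (c T0 t : R) :
  is_derive t (1 : R) (cutoff p c T0) (- c * cutoff (flat_der p) c T0 t).
Proof.
have dl : is_derive t (1 : R) (fun t => c * (T0 - t)) (- c).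
  have := is_deriveZ c (is_deriveB (is_derive_cst T0 t (1 : R)) (is_derive_id t (1 : R))).
  by rewrite /GRing.scale /= sub0r mulrN1.
have := @is_derive1_comp _ (flat p) (fun t => c * (T0 - t)) t _ _ (is_derive_flat p (c * (T0 - t))) dl.
by rewrite /cutoff mulrC.
Qed.

Lemma continuous_cutoff p c T0 : continuous (cutoff p c T0).
Proof.
move=> x; apply: differentiable_continuous; apply/derivable1_diffP.
by have [] := is_derive_cutoff p c T0 x.
Qed.

(** Both partial derivatives stay in the class, changing only [p], [A] and [B]; so every iterated
    derivative is covered by induction on the word. *)
Lemma smooth2_cutoff p (c T0 a A B : R) :
  smooth2 (fun t x => cutoff p c T0 t * (A * cos (a * x) + B * sin (a * x))).
Proof.
have dtr A' B' (x : R) : is_derive x (1 : R) (fun x => A' * cos (a * x) + B' * sin (a * x))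
    ((a * B') * cos (a * x) + (- a * A') * sin (a * x)).
  have := is_deriveD (is_deriveZ A' (is_derive_cosM a x)) (is_deriveZ B' (is_derive_sinM a x)).
  by rewrite /GRing.scale /=; congr is_derive; ring.
have d_t p' A' B' (t x : R) : is_derive t (1 : R)
    (fun t => cutoff p' c T0 t * (A' * cos (a * x) + B' * sin (a * x)))
    (cutoff (flat_der p') c T0 t * (- c * A' * cos (a * x) + - c * B' * sin (a * x))).
  have := is_deriveM (is_derive_cutoff p' c T0 t) (is_derive_cst (A' * cos (a * x) + B' * sin (a * x)) t (1 : R)).
  by rewrite /GRing.scale /= mulr0 add0r; congr is_derive; ring.
have d_x p' A' B' (t x : R) : is_derive x (1 : R)
    (fun x => cutoff p' c T0 t * (A' * cos (a * x) + B' * sin (a * x)))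
    (cutoff p' c T0 t * ((a * B') * cos (a * x) + (- a * A') * sin (a * x))).
  have := is_deriveZ (cutoff p' c T0 t) (dtr A' B' x).
  by rewrite /GRing.scale /=.
move=> w.
have [p' [A' [B' ->]]] : exists p' A' B', foldr partial
    (fun t x => cutoff p c T0 t * (A * cos (a * x) + B * sin (a * x))) w =
    fun t x => cutoff p' c T0 t * (A' * cos (a * x) + B' * sin (a * x)).
  elim: w => [|b w [p' [A' [B' IH]]]] /=; first by exists p, A, B.
  rewrite IH; case: b.
    exists (flat_der p'), (- c * A'), (- c * B'); apply/funext => t; apply/funext => x.
    by rewrite /partial derive1E; have [_] := d_t p' A' B' t x.
  exists p', (a * B'), (- a * A'); apply/funext => t; apply/funext => x.
  by rewrite /partial derive1E; have [_] := d_x p' A' B' t x.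
split=> [z|t x]; last by split; [have [] := d_t p' A' B' t x|have [] := d_x p' A' B' t x].
have c1 : (cutoff p' c T0 \o fst) y @[y --> z] --> cutoff p' c T0 z.1.
  by apply: continuous_comp; [exact: cvg_fst|exact: continuous_cutoff].
pose h x := A' * cos (a * x) + B' * sin (a * x).
have ch : continuous h.
  by move=> x; apply: differentiable_continuous; apply/derivable1_diffP; have [] := dtr A' B' x.
have c2 : (h \o snd) y @[y --> z] --> h z.2.
  by apply: continuous_comp; [exact: cvg_snd|exact: ch].
exact: cvgM c1 c2.
Qed.

End SmoothCutoff.

(** * Testing against an approximate Dirac mass *)

Section WeakOde.
Variable R : realType.
Local Notation C := R[i].
Local Notation mu := (@lebesgue_measure R).

Lemma rint_cont (a d : R) (h : R -> R) : continuous h -> rint `[a, d] h.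
Proof.
move=> ch; apply: continuous_compact_integrable; first exact: segment_compact.
exact: continuous_subspaceT.
Qed.

(* [- d/dt cutoff 1 c T0]: it tends to the Dirac mass at [T0] as [c] grows. *)
Definition kern (c T0 t : R) : R := c * cutoff (flat_der 1) c T0 t.

Lemma flat_der1 (x : R) : 0 < x -> flat (flat_der 1) x = x^-1 ^+ 2 * expR (- x^-1).
Proof.
by move=> x0; rewrite /flat x0 /flat_der derivC subr0 mulr1 hornerXn.
Qed.

Lemma kern_ge0 c T0 t : 0 < c -> 0 <= kern c T0 t.
Proof.
move=> c0; rewrite /kern; apply: mulr_ge0; [exact: ltW|rewrite /cutoff; set x := _ * _].
have [x0|x0] := ltP 0 x; last by rewrite (flat0 _ x0) lexx.
by rewrite flat_der1// mulr_ge0 ?sqr_ge0 ?expR_ge0.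
Qed.

Lemma kern_le c T0 t d : 0 < c -> 0 < d -> t <= T0 - d -> kern c T0 t <= (c * d ^+ 2)^-1.
Proof.
move=> c0 d0 td; have dt : d <= T0 - t by lra.
have t0 : 0 < T0 - t by apply: lt_le_trans dt.
rewrite /kern /cutoff flat_der1 ?mulr_gt0//.
apply: (@le_trans _ _ (c * (c * (T0 - t))^-1 ^+ 2)).
  rewrite (ler_wpM2l (ltW c0))// ler_piMr ?sqr_ge0//.
  by rewrite -[leRHS](expR0 R) ler_expR oppr_le0 invr_ge0 mulr_ge0 ?ltW.
rewrite exprVn exprMn invfM mulrA.
have -> : c / c ^+ 2 = c^-1 by field; rewrite gt_eqF.
have ci0 : 0 <= c^-1 by rewrite invr_ge0 ltW.
rewrite [leRHS]invfM; apply: (ler_wpM2l ci0); rewrite lef_pV2 ?posrE ?exprn_gt0//.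
by rewrite ler_sqr ?nnegrE// ltW.
Qed.

Lemma kern_support c T0 t : 0 < c -> T0 <= t -> kern c T0 t = 0.
Proof. by move=> c0 h; rewrite /kern /cutoff flat0 ?mulr0// pmulr_rle0// subr_le0. Qed.

Lemma cutoff1_0 c T0 : 0 < c -> 0 < T0 -> 1 - (c * T0)^-1 <= cutoff (1 : {poly R}) c T0 0.
Proof.
move=> c0 t0; rewrite /cutoff /flat subr0 mulr_gt0// hornerC mul1r.
by rewrite (le_trans _ (expR_ge1Dx _)).
Qed.

Lemma int_kern c T0 T : 0 < c -> 0 < T0 < T -> 
  \int[mu]_(t in `[0, T]) kern c T0 t = cutoff (1 : {poly R}) c T0 0.
Proof.
move=> c0 /andP[t0 tT]; have dK (t : R) : is_derive t (1 : R) (fun t => - cutoff (1 : {poly R}) c T0 t) (kern c T0 t).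
  by have := is_deriveN (is_derive_cutoff (1 : {poly R}) c T0 t); rewrite mulNr opprK.
rewrite (Rintegral_FTC2 (lt_trans t0 tT) _ dK).
  rewrite opprK [cutoff 1 c T0 T]/cutoff flat0 ?oppr0 ?add0r//.
  by rewrite pmulr_rle0// subr_le0 ltW.
by move=> x; apply: cvgM; [exact: cvg_cst|exact: continuous_cutoff].
Qed.

Lemma continuous_kern c T0 : continuous (kern c T0).
Proof. by move=> x; apply: cvgM; [exact: cvg_cst|exact: continuous_cutoff]. Qed.

(** If [h] were positive at [T0], it would be at least some [m > 0] just before [T0], where the
    kernel concentrates; elsewhere the kernel is of order [1 / c], so the integral would be positive
    for large [c]. *)
Lemma kern_test_le0 (T : R) (h : R -> R) : continuous h ->
  (forall c T0, 0 < c -> 0 < T0 < T -> \int[mu]_(t in `[0, T]) (kern c T0 t * h t) = 0) ->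
  forall t, 0 < t < T -> h t <= 0.
Proof.
move=> ch hK T0 hT; have /andP[t0 tT] := hT; have T_gt0 := lt_trans t0 tT.
rewrite leNgt; apply/negP => h0; pose m := h T0 / 2; have m0 : 0 < m by rewrite divr_gt0.
have [d d0 hd] : exists2 d, 0 < d & forall t, T0 - d < t -> t <= T0 -> m <= h t.
  have /cvgrPdist_lt/(_ m m0)/nbhs_ballP[d /= d0 hd] := ch T0.
  exists d => // t t1 t2; have := hd t; rewrite /ball /= => /(_ _).
  have dt : `|T0 - t| < d by rewrite ger0_norm; lra.
  by move=> /(_ dt); rewrite ltr_norml => /andP[_]; rewrite /m; lra.
have [B hB] : exists B, forall t, t \in `[0, T] -> `|h t| <= B.
  have [|x _ hx] := @EVT_max R (fun x => `|h x|) 0 T (ltW T_gt0).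
    apply: continuous_subspaceT => x; apply: continuous_comp; first exact: ch.
    exact: norm_continuous.
  by exists `|h x|.
have B0 : 0 <= B by apply: le_trans (hB 0 _); rewrite // in_itv /= lexx ltW.
(* [c > q + 1 / T0] is what the final comparison needs: the mass of the kernel is at least
   [1 - 1 / (c T0)], and the loss away from [T0] is [m q / c]. *)
pose q := (m + B) * T / (m * d ^+ 2).
have q0 : 0 <= q by rewrite divr_ge0 ?mulr_ge0 ?addr_ge0 ?sqr_ge0// ltW.
pose c := T0^-1 + q + 1.
have c0 : 0 < c by rewrite /c -addrA ltr_wpDr ?addr_ge0// invr_gt0.
(* One lower bound for all times: near [T0] because [h >= m], farther away because the kernel is
   small, and after [T0] because it vanishes. *)
have pw t : t \in `[0, T] -> m * kern c T0 t - (m + B) * (c * d ^+ 2)^-1 <= kern c T0 t * h t.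
  move=> tI; have k0 := kern_ge0 T0 t c0; have := hB t tI; rewrite ler_norml => /andP[b1 b2].
  have e0 : 0 <= (m + B) * (c * d ^+ 2)^-1.
    by rewrite mulr_ge0 ?addr_ge0 ?invr_ge0 ?mulr_ge0 ?sqr_ge0// ltW.
  have [tT0|tT0] := leP T0 t; first by rewrite kern_support// mulr0 mul0r; lra.
  have [td|td] := ltP (T0 - d) t.
    have := hd t td (ltW tT0) => mh; have := ler_wpM2l k0 mh; rewrite mulrC; lra.
  have kl := kern_le c0 d0 td.
  have := ler_wpM2l (addr_ge0 (ltW m0) B0) kl; have := ler_wpM2l k0 b1; rewrite mulrN; nra.
have i1 : rint `[0, T] (fun t => m * kern c T0 t - (m + B) * (c * d ^+ 2)^-1).
  apply: rint_cont => x; apply: cvgB; last exact: cvg_cst.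
  by apply: cvgM; [exact: cvg_cst|exact: continuous_kern].
have i2 : rint `[0, T] (fun t => kern c T0 t * h t).
  by apply: rint_cont => x; apply: cvgM; [exact: continuous_kern|exact: ch].
have i3 : rint `[0, T] (fun t => m * kern c T0 t).
  by apply: rint_cont => x; apply: cvgM; [exact: cvg_cst|exact: continuous_kern].
have i4 : rint `[0, T] (fun=> (m + B) * (c * d ^+ 2)^-1).
  by apply: rint_cont => x; exact: cvg_cst.
have i5 : rint `[0, T] (kern c T0) by apply: rint_cont; exact: continuous_kern.
have mT : measurable (`[0, T]%classic : set R) by exact: measurable_itv.
have muT : fine (mu `[0, T]%classic) = T.
  by rewrite lebesgue_measure_itv /= lte_fin T_gt0 -EFinB subr0.
have := @le_Rintegral _ _ _ mu `[0, T]%classic _ _ mT i1 i2 pw.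
rewrite (hK c T0 c0 hT) (@RintegralB _ _ _ mu _ _ _ mT i3 i4) Rintegral_cst// muT.
rewrite (@RintegralZl _ _ _ mu _ _ _ mT i5) (int_kern c0 hT).
have c1 := cutoff1_0 c0 t0.
have cm := ler_wpM2l (ltW m0) c1 => hle.
suff : (m + B) * (c * d ^+ 2)^-1 * T < m * (1 - (c * T0)^-1) by lra.
have md : 0 < m * d ^+ 2 by rewrite mulr_gt0 ?exprn_gt0.
have -> : (m + B) * (c * d ^+ 2)^-1 * T = m * (q / c).
  by rewrite /q; field; rewrite !gt_eqF.
rewrite ltr_pM2l// ltr_pdivrMr// mulrBl mul1r invfM -mulrA.
by rewrite [c^-1 * _]mulrCA mulVf ?gt_eqF// mulr1 /c; lra.
Qed.

Lemma kern_test_eq0 (T : R) (h : R -> R) : continuous h ->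
  (forall c T0, 0 < c -> 0 < T0 < T -> \int[mu]_(t in `[0, T]) (kern c T0 t * h t) = 0) ->
  forall t, 0 <= t < T -> h t = 0.
Proof.
move=> ch hK.
have pos t : 0 < t < T -> h t = 0.
  move=> tT; apply/eqP; rewrite eq_le (kern_test_le0 ch hK tT) /= -oppr_le0.
  apply: (@kern_test_le0 T (fun t => - h t)) => // [x|c T0 c0 hT].
    by apply: cvgN; exact: ch.
  rewrite (@eq_Rintegral _ _ _ mu _ (fun t => -1 * (kern c T0 t * h t))) => [|x _]; last by ring.
  rewrite RintegralZl ?hK ?mulr0//.
  by apply: rint_cont => x; apply: cvgM; [exact: continuous_kern|exact: ch].
(* The time 0 is not among the admissible [T0]; it is reached by continuity. *)
move=> t /andP[]; rewrite le_eqVlt => /orP[/eqP<- T0|t0 tT]; last by apply: pos; rewrite t0 tT.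
apply/eqP; apply: contraT => h0; have e0 : 0 < `|h 0| by rewrite normr_gt0.
have /cvgrPdist_lt/(_ _ e0)/nbhs_ballP[d /= d0 hd] := ch 0.
pose x := Num.min (d / 2) (T / 2).
have x0 : 0 < x by rewrite lt_min !divr_gt0.
have [xd xT] : x <= d / 2 /\ x <= T / 2 by rewrite /x !ge_min !lexx orbT.
have := hd x; rewrite /ball /= sub0r normrN gtr0_norm// => /(_ ltac:(lra)).
by rewrite (pos x) ?subr0 ?ltxx// x0; lra.
Qed.

(** Bounded support makes [g] integrable on the line, so the integral from minus infinity is a
    primitive at every real point. *)
Lemma antiderivative (g : R -> R) (l : R) : continuous g -> (forall t, l < `|t| -> g t = 0) ->
  exists F : R -> R, forall t, is_derive t (1 : R) F (g t).
Proof.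
move=> cg hg; pose F (x : R) : R := \int[mu]_(t in `]-oo, x]) g t; exists F => t.
have ig : mu.-integrable setT (EFin \o g).
  have := rint_cont (- l) l cg; rewrite /rint integrable_mkcond//.
  apply: eq_integrable => // x _; rewrite patchE; case: ifPn => // /negP xl.
  rewrite /= hg//; rewrite ltNge; apply/negP; rewrite ler_norml => hx.
  by apply: xl; rewrite inE /= in_itv.
have [d e] := @continuous_FTC1 R g -oo%O t (t + 1) ltac:(lra)
  (@integrableS _ _ R mu setT _ (EFin \o g) measurableT (measurable_itv _) (@subsetT _ _) ig)
  (ltNyr t) (cg t).
by rewrite -e derive1E; exact: derivableP.
Qed.

End WeakOde.

(** * From the weak formulation to the Fourier coefficients *)

Section WeakForm.
Variable R : realType.
Local Notation C := R[i].
Local Notation mu := (@lebesgue_measure R).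
Implicit Types (F : mpoly.mpoly 4 C) (T c t : R).
Hint Resolve measurable_torus : core.
Local Notation th c T0 t := (cutoff (1 : {poly R}) c T0 t).

Definition ccont (f : R -> C) : Prop :=
  continuous (fun x => Re (f x)) /\ continuous (fun x => Im (f x)).

Lemma ccont_cst (z : C) : ccont (fun=> z).
Proof. by split=> x; exact: cvg_cst. Qed.

Lemma ccontD f g : ccont f -> ccont g -> ccont (fun x => f x + g x).
Proof.
move=> [f1 f2] [g1 g2]; split=> x.
  by under eq_fun do rewrite cReD; apply: cvgD; [exact: f1|exact: g1].
by under eq_fun do rewrite cImD; apply: cvgD; [exact: f2|exact: g2].
Qed.

Lemma ccontM f g : ccont f -> ccont g -> ccont (fun x => f x * g x).
Proof.
move=> [f1 f2] [g1 g2]; split=> x.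
  under eq_fun do rewrite cReM; apply: cvgB; apply: cvgM;
    [exact: f1|exact: g1|exact: f2|exact: g2].
under eq_fun do rewrite cImM; apply: cvgD; apply: cvgM;
  [exact: f1|exact: g2|exact: f2|exact: g1].
Qed.

Lemma ccont_real (h : R -> R) : continuous h -> ccont (fun x => (h x)%:C).
Proof. by move=> ch; split=> x /=; [exact: ch|exact: cvg_cst]. Qed.

Lemma ccont_scale z f : ccont f -> ccont (fun x => z * f x).
Proof. by move=> hf; apply: ccontM; [exact: ccont_cst|]. Qed.

Lemma ci_cont (a d : R) f : ccont f -> ci `[a, d] f.
Proof. by move=> [f1 f2]; split; exact: rint_cont. Qed.

Lemma eq_cint D (f g : R -> C) : (forall t, D t -> f t = g t) -> cintegral D f = cintegral D g.
Proof.
by move=> fg; rewrite /cintegral; congr (_ +i* _); apply: eq_Rintegral => t /set_mem/fg ->.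
Qed.

Lemma is_cder_real (h h' : R -> R) : (forall t, is_derive t (1 : R) h (h' t)) ->
  is_cder (fun t => (h t)%:C) (fun t => (h' t)%:C).
Proof. by move=> hh; split=> t /=; [exact: hh|exact: is_derive_cst]. Qed.

Lemma is_derive_th c T0 t : is_derive t (1 : R) (fun t => th c T0 t) (- kern c T0 t).
Proof. by have := is_derive_cutoff (1 : {poly R}) c T0 t; rewrite mulNr. Qed.

Lemma continuous_plateau T : 0 < T -> exists2 h : R -> R, continuous h &
  (forall t, 0 <= t <= T -> h t = 1) /\ (forall t, T + 1 < `|t| -> h t = 0).
Proof.
move=> T0; pose h (t : R) := Num.max 0 (Num.min 1 (Num.min (t + 1) (T + 1 - t))).
exists h; last split.
- move=> t; apply: (@continuous_max _ _ (fun=> 0) (fun t => Num.min 1 (Num.min (t + 1) (T + 1 - t)))).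
    exact: cvg_cst.
  apply: (@continuous_min _ _ (fun=> 1) (fun t => Num.min (t + 1) (T + 1 - t))); first exact: cvg_cst.
  apply: (@continuous_min _ _ (fun t => t + 1) (fun t => T + 1 - t)).
    by apply: cvgD; [exact: cvg_id|exact: cvg_cst].
  by apply: cvgB; [exact: cvg_cst|exact: cvg_id].
- move=> t /andP[t0 tT]; rewrite /h (@min_l _ _ 1) ?max_r//.
  by rewrite le_min; lra.
- move=> t tT; rewrite /h max_l// ge_min; apply/orP; right; rewrite ge_min.
  have [t0|t0] := ger0P t; first by rewrite (ger0_norm t0) in tT; apply/orP; right; lra.
  by rewrite (ltr0_norm t0) in tT; apply/orP; left; lra.
Qed.

(** [b] is the primitive of [r], cut off outside [[0, T]], that starts from [phi0]. It satisfies the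
    same tested identity, so [b - a] is orthogonal to all kernels. Unlike [a], [b] is differentiable
    on the whole line. *)
Lemma weak_ode T (a r : R -> C) (phi0 : C) : 0 < T -> ccont a -> ccont r ->
  (forall c T0, 0 < c -> 0 < T0 < T ->
     cintegral `[0, T] (fun t => (- kern c T0 t)%:C * a t) =
     - ((th c T0 0)%:C * phi0) - cintegral `[0, T] (fun t => (th c T0 t)%:C * r t)) ->
  exists b b' : R -> C, [/\ is_cder b b', forall t, 0 <= t <= T -> b' t = r t,
    forall t, 0 <= t < T -> b t = a t & b 0 = phi0].
Proof.
move=> T_gt0 ca cr H.
have [h ch [h1 h0]] := continuous_plateau T_gt0.
have [F1 dF1] : exists F1 : R -> R, forall t, is_derive t (1 : R) F1 (Re (r t) * h t).
  apply: (@antiderivative _ _ (T + 1)) => [x|t /h0 ->]; last by rewrite mulr0.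
  by apply: cvgM; [exact: cr.1|exact: ch].
have [F2 dF2] : exists F2 : R -> R, forall t, is_derive t (1 : R) F2 (Im (r t) * h t).
  apply: (@antiderivative _ _ (T + 1)) => [x|t /h0 ->]; last by rewrite mulr0.
  by apply: cvgM; [exact: cr.2|exact: ch].
pose b (t : R) : C := (phi0 - (F1 0 +i* F2 0)) + (F1 t +i* F2 t).
pose b' (t : R) : C := Re (r t) * h t +i* (Im (r t) * h t).
have db : is_cder b b'.
  have d12 : is_cder (fun t => F1 t +i* F2 t) b' by split=> t /=; [exact: dF1|exact: dF2].
  by apply: is_cder_ext (is_cderD (is_cder_cst (phi0 - (F1 0 +i* F2 0))) d12) => t //; rewrite add0r.
have b'r t : 0 <= t <= T -> b' t = r t.
  by move=> /h1 ht; rewrite /b' ht !mulr1; case: (r t).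
have b0 : b 0 = phi0 by rewrite /b subrK.
have cb : ccont b := is_cder_cont db.
have cb' : ccont b'.
  split=> x /=; apply: cvgM; [exact: cr.1|exact: ch|exact: cr.2|exact: ch].
exists b, b'; split=> // t tT.
have mT : measurable (`[0, T]%classic : set R) by exact: measurable_itv.
have ckern c T0 : ccont (fun t => (- kern c T0 t)%:C).
  by apply: ccont_real => x; apply: cvgN; exact: continuous_kern.
have cth c T0 : ccont (fun t => (th c T0 t)%:C) by apply: ccont_real; exact: continuous_cutoff.
have H2 c T0 : 0 < c -> 0 < T0 < T ->
    cintegral `[0, T] (fun t => (- kern c T0 t)%:C * b t) =
    - ((th c T0 0)%:C * phi0) - cintegral `[0, T] (fun t => (th c T0 t)%:C * r t).
  move=> c0 hT0; have dP := is_cderM (is_cder_real (is_derive_th c T0)) db.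
  have c1 := ccontM (ckern c T0) cb; have c2 := ccontM (cth c T0) cb'.
  have [c3 c4] := ccontD c1 c2.
  have := cint_FTC2 T_gt0 dP c3 c4; rewrite cintD//; [|exact: ci_cont|exact: ci_cont].
  have -> : th c T0 T = 0.
    by case/andP: hT0 => _ ht; rewrite /cutoff flat0// pmulr_rle0// subr_le0 ltW.
  rewrite b0 mul0r sub0r => <-; rewrite [X in _ - X](@eq_cint _ _ (fun t => (th c T0 t)%:C * b' t)).
    by rewrite addrK.
  by move=> x; rewrite /= in_itv /= => /b'r ->.
have cD : ccont (fun t => b t - a t).
  have := ccontD cb (ccont_scale (-1) ca).
  by under eq_fun do rewrite mulN1r.
have H3 c T0 : 0 < c -> 0 < T0 < T ->
    cintegral `[0, T] (fun t => (- kern c T0 t)%:C * (b t - a t)) = 0.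
  move=> c0 hT0.
  rewrite (@eq_cint _ _ (fun t => (- kern c T0 t)%:C * b t + (-1) * ((- kern c T0 t)%:C * a t))).
    rewrite cintD ?cintZ ?H ?H2 ?mulN1r ?subrr//; do ?exact: ci_cont (ccontM (ckern _ _) _).
    by apply: ci_cont; apply: ccont_scale; exact: ccontM.
  by move=> x _; rewrite mulrBr mulN1r.
have z1 : Re (b t - a t) = 0.
  apply: (@kern_test_eq0 R T (fun t => Re (b t - a t)) cD.1) => // c T0 c0 hT0.
  have /(congr1 (@Re R)) := H3 c T0 c0 hT0; rewrite /cintegral [LHS]/= [RHS]/= => e.
  apply/eqP; rewrite -oppr_eq0 -mulN1r -RintegralZl//; last first.
    by apply: rint_cont => x; apply: cvgM; [exact: continuous_kern|exact: cD.1].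
  rewrite -[X in _ == X]e; apply/eqP; apply: eq_Rintegral => x _.
  by rewrite cReM /= mul0r subr0 mulrA mulN1r.
have z2 : Im (b t - a t) = 0.
  apply: (@kern_test_eq0 R T (fun t => Im (b t - a t)) cD.2) => // c T0 c0 hT0.
  have /(congr1 (@Im R)) := H3 c T0 c0 hT0; rewrite /cintegral [LHS]/= [RHS]/= => e.
  apply/eqP; rewrite -oppr_eq0 -mulN1r -RintegralZl//; last first.
    by apply: rint_cont => x; apply: cvgM; [exact: continuous_kern|exact: cD.2].
  rewrite -[X in _ == X]e; apply/eqP; apply: eq_Rintegral => x _.
  by rewrite cImM /= mul0r addr0 mulrA mulN1r.
by apply/eqP; rewrite -subr_eq0 eq_complex z1 z2 !eqxx.
Qed.

(* [sg = 1] is the forward problem; [sg = -1] reverses time. *)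
Definition test_fun (c T0 sg : R) (k : int) (t x : R) : C :=
  (th c T0 (sg * t))%:C * expi (- (k%:~R * x)).

Let signE p c T0 sg t : sg * sg = 1 -> cutoff p c T0 (sg * t) = cutoff p (sg * c) (sg * T0) t :> R.
Proof.
move=> ss; rewrite /cutoff; congr flat.
rewrite (_ : sg * c * _ = (sg * sg) * (c * T0) - c * (sg * t)); last by ring.
by rewrite ss mul1r mulrBr.
Qed.

Lemma smooth_test_fun c T0 sg k : sg * sg = 1 -> smooth_spacetime (test_fun c T0 sg k).
Proof.
move=> ss; split.
- move=> t x; rewrite /test_fun; congr (_ * _); have := expi_periodic (- k) x.
  by rewrite rmorphN !mulNr.
- rewrite (_ : (fun t x => _) = fun t x => cutoff 1 (sg * c) (sg * T0) t *
    (1 * cos (k%:~R * x) + 0 * sin (k%:~R * x))); first exact: smooth2_cutoff.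
  by apply/funext => t; apply/funext => x; rewrite cReM /= signE// mul0r subr0 cosN mul1r mul0r addr0.
- rewrite (_ : (fun t x => _) = fun t x => cutoff 1 (sg * c) (sg * T0) t *
    (0 * cos (k%:~R * x) + -1 * sin (k%:~R * x))); first exact: smooth2_cutoff.
  by apply/funext => t; apply/funext => x; rewrite cImM /= signE// mul0r addr0 sinN mul0r add0r mulN1r.
Qed.

Lemma dt_test_fun c T0 sg k t x :
  dt (test_fun c T0 sg k) t x = (- (sg * kern c T0 (sg * t)))%:C * expi (- (k%:~R * x)).
Proof.
have dl (y : R) : is_derive y (1 : R) (fun y => sg * y) sg.
  by have := is_deriveZ sg (is_derive_id y (1 : R)); rewrite /GRing.scale /= mulr1.
have d1 : is_cder (fun t => (th c T0 (sg * t))%:C) (fun t => (- (sg * kern c T0 (sg * t)))%:C).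
  apply: is_cder_real => t'.
  have := @is_derive1_comp _ (fun t => th c T0 t) (fun t => sg * t) t' _ _ (is_derive_th c T0 _) (dl t').
  by rewrite mulrC mulrN.
have d2 := is_cderM d1 (is_cder_cst (expi (- (k%:~R * x)))).
by rewrite /dt /test_fun (cderive1_of t d2) mulr0 addr0.
Qed.

Lemma dxx_test_fun c T0 sg k t x :
  dxx (test_fun c T0 sg k) t x = (- (k%:~R ^+ 2) * (th c T0 (sg * t))%:C) * expi (- (k%:~R * x)).
Proof.
pose z := 'i%C * (- k%:~R)%:C : C.
have e y : expi (- (k%:~R * y)) = expi (- k%:~R * y) :> C by rewrite mulNr.
have d1 w : is_cder (fun x => w * expi (- k%:~R * x)) (fun x => w * (z * expi (- k%:~R * x))).
  by apply: is_cder_scale; exact: is_cder_cexpi.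
have et : test_fun c T0 sg k t = fun x => (th c T0 (sg * t))%:C * expi (- k%:~R * x).
  by apply/funext => y; rewrite /test_fun e.
have ed : cderive1 (test_fun c T0 sg k t) = fun x => ((th c T0 (sg * t))%:C * z) * expi (- k%:~R * x).
  by apply/funext => y; rewrite et (cderive1_of y (d1 _)) mulrA.
rewrite /dxx ed.
rewrite (cderive1_of x (d1 _)) e.
have zz : z * z = - (k%:~R ^+ 2).
  have ek : (- (k%:~R : R))%:C = - k%:~R :> C.
    rewrite rmorphN; congr (- _); exact: (rmorph_int (real_complex R)).
  rewrite /z ek.
  rewrite (_ : _ * _ = ('i%C * 'i%C) * k%:~R ^+ 2); last by rewrite mulrACA mulrNN.
  rewrite (_ : 'i%C * 'i%C = -1 :> C) ?mulN1r//.
  by apply/eqP; rewrite eq_complex /= !(mul0r, mulr0, mulr1, sub0r, addr0, oppr0) !eqxx.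
rewrite -zz; ring.
Qed.

Lemma mean_test f (w : C) (k : int) : ci torus f ->
  mean (fun x => f x * (w * expi (- (k%:~R * x)))) = w * fourier f k.
Proof.
move=> hf; rewrite /fourier -meanZ; last by under eq_fun do rewrite -mulNr; exact: ci_expi.
by congr mean; apply/funext => x; rewrite mulrCA.
Qed.

Lemma cint_opp (a d : R) (g : R -> C) : a <= d -> ccont g ->
  cintegral `[- d, - a] g = cintegral `[a, d] (fun t => g (- t)).
Proof.
move=> ad [g1 g2]; rewrite /cintegral /Rintegral.
rewrite (integration_by_substitution_oppr ad (continuous_subspaceT g1)).
by rewrite (integration_by_substitution_oppr ad (continuous_subspaceT g2)).
Qed.

Let forward_ring (S : comNzRingType) (i k X P Y Z X' P' W Z' V V' : S) :
  X' = X -> P' = P -> W = - k * Y -> Z' = Z -> V = V' + Z -> V' = i * k * Y ->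
  - X' - P' + i * W = Z' -> X = - P - V.
Proof. by move=> -> -> -> -> -> -> <-; ring. Qed.

Let backward_ring (S : comNzRingType) (i k X P Y Z X' P' W Z' V V' : S) :
  X' = -1 * X -> P' = P -> W = - k * Y -> Z' = -1 * Z -> V = V' + Z -> V' = - i * k * Y ->
  - X' + P' + i * W = Z' -> X = - P - V.
Proof.
move=> -> -> -> -> -> -> e; rewrite -[Z]opprK -[- Z]mulN1r -e; ring.
Qed.

(** [A] and [f] are continuous on the line and agree with the coefficients on [[0, T]], the only
    times at which [u] is constrained. *)
Lemma forward_identity (s T : R) F phi u k (A f : R -> C) : 0 < T -> L2 phi ->
  solution_forward s T F phi u ->
  (forall t, 0 <= t <= T -> L2 (u t) /\ ci torus (nonlin F (u t))) ->
  ccont A -> ccont f ->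
  (forall t, 0 <= t <= T -> A t = fourier (u t) k) ->
  (forall t, 0 <= t <= T -> f t = fourier (nonlin F (u t)) k) ->
  forall c T0, 0 < c -> 0 < T0 < T ->
  cintegral `[0, T] (fun t => (- kern c T0 t)%:C * A t) =
  - ((th c T0 0)%:C * fourier phi k) -
  cintegral `[0, T] (fun t => (th c T0 t)%:C * ('i%C * k%:~R ^+ 2 * A t + f t)).
Proof.
move=> T_gt0 lphi [_ H] hu cA cf hA hf c T0 c0 /andP[t0 tT].
have one : 1 * 1 = 1 :> R by rewrite mulr1.
have tst : test_forward T (test_fun c T0 1 k).
  split; first exact: smooth_test_fun.
  exists T0 => // t x h; rewrite /test_fun mul1r /cutoff flat0 ?mul0r//.
  by rewrite pmulr_rle0// subr_le0.
have e := H _ tst.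
have cth : ccont (fun t => (th c T0 t)%:C) by apply: ccont_real; exact: continuous_cutoff.
have ck : ccont (fun t => (- kern c T0 t)%:C).
  by apply: ccont_real => x; apply: cvgN; exact: continuous_kern.
have e1 : cintegral `[0, T] (fun t => mean (fun x => u t x * dt (test_fun c T0 1 k) t x)) =
    cintegral `[0, T] (fun t => (- kern c T0 t)%:C * A t).
  apply: eq_cint => t; rewrite /= in_itv /= => ht; have [lu _] := hu t ht.
  under eq_fun do rewrite dt_test_fun.
  by rewrite mean_test ?hA// ?mul1r//; exact: L2_ci.
have e2 : mean (fun x => phi x * test_fun c T0 1 k 0 x) = (th c T0 0)%:C * fourier phi k.
  by rewrite /test_fun mulr0 mean_test//; exact: L2_ci.
have e3 : cintegral `[0, T] (fun t => mean (fun x => u t x * dxx (test_fun c T0 1 k) t x)) =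
    cintegral `[0, T] (fun t => - (k%:~R ^+ 2) * ((th c T0 t)%:C * A t)).
  apply: eq_cint => t; rewrite /= in_itv /= => ht; have [lu _] := hu t ht.
  under eq_fun do rewrite dxx_test_fun.
  rewrite (mean_test _ _ (L2_ci lu)) mul1r hA//; exact: esym (mulrA _ _ _).
have e4 : cintegral `[0, T] (fun t => mean (fun x =>
      polyval F (u t x) (dx (u t) x) * test_fun c T0 1 k t x)) =
    cintegral `[0, T] (fun t => (th c T0 t)%:C * f t).
  apply: eq_cint => t; rewrite /= in_itv /= => ht; have [_ iu] := hu t ht.
  by rewrite /test_fun mul1r (mean_test _ _ iu) hf.
have mT : measurable (`[0, T]%classic : set R) by exact: measurable_itv.
have i1 := ci_cont 0 T (ccontM cth cA); have i2 := ci_cont 0 T (ccontM cth cf).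
have e5 : cintegral `[0, T] (fun t => (th c T0 t)%:C * ('i%C * k%:~R ^+ 2 * A t + f t)) =
    cintegral `[0, T] (fun t => 'i%C * k%:~R ^+ 2 * ((th c T0 t)%:C * A t) + (th c T0 t)%:C * f t).
  by apply: eq_cint => t _; rewrite mulrDr mulrCA.
have e6 := cintD mT (ci_scale ('i%C * k%:~R ^+ 2) mT i1) i2.
have e7 := cintZ ('i%C * k%:~R ^+ 2) mT i1; have e8 := cintZ (- (k%:~R ^+ 2)) mT i1.
exact: (forward_ring e1 e2 (etrans e3 e8) e4 (etrans e5 e6) e7 e).
Qed.

(** Substituting [- t] for [t] turns the phase factor [i] into [- i] and changes the sign of the
    nonlinearity. *)
Lemma backward_identity (s T : R) F phi u k (A f : R -> C) : 0 < T -> L2 phi ->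
  solution_backward s T F phi u ->
  (forall t, 0 <= t <= T -> L2 (u (- t)) /\ ci torus (nonlin F (u (- t)))) ->
  ccont A -> ccont f ->
  (forall t, 0 <= t <= T -> A t = fourier (u (- t)) k) ->
  (forall t, 0 <= t <= T -> f t = - fourier (nonlin F (u (- t))) k) ->
  forall c T0, 0 < c -> 0 < T0 < T ->
  cintegral `[0, T] (fun t => (- kern c T0 t)%:C * A t) =
  - ((th c T0 0)%:C * fourier phi k) -
  cintegral `[0, T] (fun t => (th c T0 t)%:C * (- 'i%C * k%:~R ^+ 2 * A t + f t)).
Proof.
move=> T_gt0 lphi [_ H] hu cA cf hA hf c T0 c0 /andP[t0 tT].
have one : (-1) * (-1) = 1 :> R by rewrite mulrNN mulr1.
have tst : test_backward T (test_fun c T0 (-1) k).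
  split; first exact: smooth_test_fun.
  exists T0 => // t x h; rewrite /test_fun mulN1r /cutoff flat0 ?mul0r//.
  by rewrite pmulr_rle0//; lra.
have e := H _ tst.
have copp g : ccont g -> ccont (fun t => g (- t)).
  have co (h : R -> R) : continuous h -> continuous (h \o -%R).
    by move=> ch x; apply: continuous_comp; [exact: opp_continuous|exact: ch].
  by move=> [g1 g2]; split; [exact: co g1|exact: co g2].
have sub (h g : R -> C) : ccont g -> (forall t, 0 <= t <= T -> h (- t) = g t) ->
    cintegral `[- T, 0] h = cintegral `[0, T] g.
  move=> cg hg; rewrite (@eq_cint _ h (fun t => g (- t))) => [|t]; last first.
    rewrite /= in_itv /= => ht; rewrite -hg ?opprK//; lra.
  have := cint_opp (ltW T_gt0) (copp _ cg); rewrite oppr0 => ->.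
  by apply: eq_cint => t _; rewrite opprK.
have cth : ccont (fun t => (th c T0 t)%:C) by apply: ccont_real; exact: continuous_cutoff.
have ck : ccont (fun t => (- kern c T0 t)%:C).
  by apply: ccont_real => x; apply: cvgN; exact: continuous_kern.
have mT : measurable (`[0, T]%classic : set R) by exact: measurable_itv.
have i1 := ci_cont 0 T (ccontM cth cA); have i2 := ci_cont 0 T (ccontM cth cf).
have i3 := ci_cont 0 T (ccontM ck cA).
have e1 : cintegral `[- T, 0] (fun t => mean (fun x => u t x * dt (test_fun c T0 (-1) k) t x)) =
    cintegral `[0, T] (fun t => -1 * ((- kern c T0 t)%:C * A t)).
  apply: sub => [|t ht]; first by apply: ccont_scale; exact: ccontM.
  have [lu _] := hu t ht; under eq_fun do rewrite dt_test_fun.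
  rewrite mean_test ?hA//; last exact: L2_ci.
  by rewrite !mulN1r !opprK rmorphN mulNr opprK.
have e2 : mean (fun x => phi x * test_fun c T0 (-1) k 0 x) = (th c T0 0)%:C * fourier phi k.
  by rewrite /test_fun mulr0 mean_test//; exact: L2_ci.
have e3 : cintegral `[- T, 0] (fun t => mean (fun x => u t x * dxx (test_fun c T0 (-1) k) t x)) =
    cintegral `[0, T] (fun t => - (k%:~R ^+ 2) * ((th c T0 t)%:C * A t)).
  apply: sub => [|t ht]; first by apply: ccont_scale; exact: ccontM.
  have [lu _] := hu t ht; under eq_fun do rewrite dxx_test_fun.
  rewrite (mean_test _ _ (L2_ci lu)) mulN1r opprK hA//; exact: esym (mulrA _ _ _).
have e4 : cintegral `[- T, 0] (fun t => mean (fun x =>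
      polyval F (u t x) (dx (u t) x) * test_fun c T0 (-1) k t x)) =
    cintegral `[0, T] (fun t => -1 * ((th c T0 t)%:C * f t)).
  apply: sub => [|t ht]; first by apply: ccont_scale; exact: ccontM.
  have [_ iu] := hu t ht.
  rewrite /test_fun (mean_test _ _ iu) hf// (_ : -1 * - t = t); last by rewrite mulN1r opprK.
  by rewrite [RHS]mulN1r mulrN opprK.
have e5 : cintegral `[0, T] (fun t => (th c T0 t)%:C * (- 'i%C * k%:~R ^+ 2 * A t + f t)) =
    cintegral `[0, T] (fun t => - 'i%C * k%:~R ^+ 2 * ((th c T0 t)%:C * A t) + (th c T0 t)%:C * f t).
  by apply: eq_cint => t _; rewrite mulrDr mulrCA.
have e6 := cintD mT (ci_scale (- 'i%C * k%:~R ^+ 2) mT i1) i2.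
have e7 := cintZ (- 'i%C * k%:~R ^+ 2) mT i1; have e8 := cintZ (- (k%:~R ^+ 2)) mT i1.
have e9 := cintZ (-1) mT i2; have e10 := cintZ (-1) mT i3.
exact: (backward_ring (etrans e1 e10) e2 (etrans e3 e8) (etrans e4 e9) (etrans e5 e6) e7 e).
Qed.

End WeakForm.

(** * Gain of regularity *)

Section Assembly.
Variable R : realType.
Local Notation C := R[i].
Local Notation mu := (@lebesgue_measure R).
Implicit Types (F : mpoly.mpoly 4 C) (v w phi : R -> C).

Lemma ccont_eps (f : R -> C) :
  (forall t e : R, 0 < e -> exists2 d, 0 < d & forall t', `|t' - t| < d -> cn (f t' - f t) <= e) ->
  ccont f.
Proof.
move=> h; split=> t; apply/(@cvgrPdist_le _ R) => e e0; have [d d0 hd] := h t e e0;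
  apply: filterS (@nbhsx_ballx _ R t d d0) => t'; rewrite /ball /= distrC => /hd ht'; rewrite distrC.
  by apply: le_trans ht'; apply: le_trans (ge_cn_Re _); rewrite cReD cReN.
by apply: le_trans ht'; apply: le_trans (ge_cn_Im _); rewrite cImD cImN.
Qed.

(** Extends functions of time from [[0, T]] to the line by their end values; being 1-Lipschitz, it
    preserves continuity. *)
Definition clamp (T t : R) : R := if t < 0 then 0 else if T < t then T else t.

Lemma clamp_itv T t : 0 < T -> 0 <= clamp T t <= T.
Proof. by move=> T0; rewrite /clamp; have [|] := ltP t 0; have [|] := ltP T t; lra. Qed.

Lemma clamp_id T t : 0 <= t <= T -> clamp T t = t.
Proof. by move=> /andP[t0 tT]; rewrite /clamp ltNge t0 ltNge tT. Qed.

Lemma clamp_lip T t t' : 0 < T -> `|clamp T t - clamp T t'| <= `|t - t'|.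
Proof.
move=> T0; rewrite /clamp ler_norml.
have h1 := ler_norm (t - t'); have h2 := ler_norm (t' - t); rewrite distrC in h2.
by have [|] := ltP t 0; have [|] := ltP T t; have [|] := ltP t' 0; have [|] := ltP T t';
  move=> ? ? ? ?; apply/andP; split; lra.
Qed.

Lemma l1bD m M M' b c : l1b m M b -> l1b m M' c -> l1b m (M + M') (fun k : int => b k + c k : C).
Proof.
move=> hb hc s us; apply: le_trans (lerD (hb s us) (hc s us)); rewrite -big_split /=.
by apply: ler_sum => k _; rewrite -mulrDr ler_wpM2l ?cnD ?exprn_ge0 ?jb_ge0.
Qed.

Lemma Im_fourier0 (f : R -> C) : Im (fourier f 0) = rmean (fun x => Im (f x)).
Proof.
rewrite /fourier (_ : (fun x => _) = f); last first.
  by apply/funext => x; rewrite mul0r oppr0 expi0 mulr1.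
by rewrite /mean cImM /= mul0r addr0.
Qed.

Lemma rate_small (D e : R) : 0 <= D -> 0 < e ->
  exists N0, forall N, (N0 <= N)%N -> D / N.+1%:R <= e.
Proof.
move=> D0 e0; exists (Num.bound (D / e)) => N hN.
have h : D / e < (Num.bound (D / e))%:R.
  by apply: le_lt_trans (archi_boundP _); rewrite ?ler_norm// divr_ge0// ltW.
rewrite ler_pdivrMr ?ltr0n// mulrC -ler_pdivrMr//; apply: ltW; apply: lt_trans h _.
by rewrite ltr_nat ltnS.
Qed.

Lemma fourierDB (s : R) v w k : Hs s v -> Hs s w ->
  fourier (fun x => v x - w x) k = fourier v k - fourier w k.
Proof. by move=> [lv _] [lw _]; rewrite fourierB//; exact: L2_ci. Qed.

Let gain_arith (g a b c : R) : g = a -> a - b <= g / 4 -> b - c <= g / 4 -> g / 2 <= c.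
Proof. lra. Qed.

Section Gain.
Variables (s T sg eta : R) (F : mpoly.mpoly 4 C) (phi : R -> C) (U : R -> R -> C).
Hypothesis hs : 5 / 2 < s.
Hypothesis T_gt0 : 0 < T.
Hypothesis hphi : Hs s phi.
Hypothesis hU : forall t : R, 0 <= t <= T -> Hs s (U t).
Hypothesis hcont : forall t e : R, 0 <= t <= T -> 0 < e -> exists2 d, 0 < d &
  forall t' : R, 0 <= t' <= T -> `|t' - t| < d -> (Hs_norm s (fun x => U t' x - U t x)%R <= e%:E)%E.
Hypothesis sg2 : sg ^+ 2 = 1.
Hypothesis hid : forall k (A f : R -> C), ccont A -> ccont f ->
  (forall t : R, 0 <= t <= T -> A t = fourier (U t) k) ->
  (forall t : R, 0 <= t <= T -> f t = fourier (nonlin F (U t)) k) ->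
  forall c T0 : R, 0 < c -> 0 < T0 < T ->
  cintegral `[0, T] (fun t => (- kern c T0 t)%:C * A t) =
  - ((cutoff 1 c T0 0)%:C * fourier phi k) -
  cintegral `[0, T] (fun t => (cutoff 1 c T0 t)%:C * ('i%C * sg%:C * k%:~R ^+ 2 * A t + f t)).
Hypothesis eta2 : eta ^+ 2 = 1.
Hypothesis hmean : 0 < eta * rmean (fun x => Im (F_beta F (phi x) (dx phi x))).

Let hs' : 2^-1 < s - 2. Proof. by have := hs; lra. Qed.
Let W := sobolev_weight hs'.

Let close (t e : R) : 0 <= t <= T -> 0 < e -> exists2 d, 0 < d &
  forall t' : R, 0 <= t' <= T -> `|t' - t| < d ->
    nb W 2 e (fun k => fourier (U t') k - fourier (U t) k) /\
    l1b 2 e (fun k => fourier (U t') k - fourier (U t) k).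
Proof.
move=> ht e0; pose A := Num.sqrt (SW W) * 2.
have A0 : 0 <= A by rewrite mulr_ge0 ?sqrtr_ge0.
have e1 : 0 < e / (A + 2) by rewrite divr_gt0//; lra.
have [d d0 hd] := hcont ht e1; exists d => // t' ht' tt'.
have h := hd t' ht' tt'; have e1' := ltW e1.
have ed k : fourier (fun x => U t' x - U t x) k = fourier (U t') k - fourier (U t) k.
  exact: fourierDB (hU ht') (hU ht).
have hn := Hs_nb hs' e1' h.
have n2 : 2 * (e / (A + 2)) <= e.
  by rewrite mulrCA ger_pMr// ler_pdivrMr; lra.
have n3 : A * (e / (A + 2)) <= e by rewrite mulrCA ger_pMr// ler_pdivrMr; lra.
split.
  by apply: (nb_mono hn) => // k; rewrite ed.
apply: l1b_ext ed _; apply: l1b_le n3 _; rewrite -mulrA; exact: (nb_l1b (m := 2) hn).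
Qed.

Let bounded (t : R) : 0 <= t <= T -> exists2 M, 0 <= M & nb W 2 M (fourier (U t)) /\ l1b 2 M (fourier (U t)).
Proof.
move=> ht; have [_ /Hs_norm_bound[M M0 hM]] := hU ht.
have hn := Hs_nb hs' M0 hM; have hl := nb_l1b (m := 2) hn.
have M1 : 0 <= 2 * M by rewrite mulr_ge0.
have S1 : 0 <= Num.sqrt (SW W) * (2 * M) by rewrite mulr_ge0 ?sqrtr_ge0.
exists (2 * M + Num.sqrt (SW W) * (2 * M)); first exact: addr_ge0.
split; last by apply: l1b_le hl; rewrite lerDr.
by apply: (nb_mono hn) => //; rewrite lerDl.
Qed.

Let near_bounded (t : R) : 0 <= t <= T -> exists K d, [/\ 0 < d, 0 <= K &
  forall t' : R, 0 <= t' <= T -> `|t' - t| < d ->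
    nb W 2 K (fourier (U t')) /\ l1b 2 K (fourier (U t'))].
Proof.
move=> ht; have [M M0 [n1 l1]] := bounded ht; have [d d0 hd] := close ht ltr01.
exists (1 + M), d; split=> // [|t' ht' tt']; first by rewrite addr_ge0.
have [n2 l2] := hd t' ht' tt'; split.
  by apply: nb_eq (nbD n2 n1) => k; rewrite subrK.
by apply: l1b_ext (l1bD l2 l1) => k; rewrite subrK.
Qed.

Let nonlin_close (G : mpoly.mpoly 4 C) (t e : R) : 0 <= t <= T -> 0 < e -> exists2 d, 0 < d &
  forall t' k, 0 <= t' <= T -> `|t' - t| < d ->
    cn (fourier (nonlin G (U t')) k - fourier (nonlin G (U t)) k) <= e.
Proof.
move=> ht e0; have [K [d1 [d10 K0 hK]]] := near_bounded ht.
have [B [D [B0 D0 _ hD]]] := fourier_nonlin_lip G K.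
have e1 : 0 < e / (D + 1) by rewrite divr_gt0//; lra.
have [d2 d20 hd] := close ht e1; exists (Num.min d1 d2); first by rewrite lt_min d10.
move=> t' k ht'; rewrite lt_min => /andP[t1 t2].
have [_ l1] := hK t' ht' t1; have [_ l2] := hK t ht ltac:(by rewrite subrr normr0).
have [_ l3] := hd t' ht' t2.
apply: le_trans (hD _ _ _ k (hU ht').1 (hU ht).1 (l1b_mono (leqnSn 1) l1)
  (l1b_mono (leqnSn 1) l2) (l1b_mono (leqnSn 1) l3)) _.
by rewrite mulrCA ger_pMr// ler_pdivrMr; lra.
Qed.

(** The function and its derivative are packed in a pair, so that one use of [choice] selects both
    for all modes. *)
Let ode k : exists p : (R -> C) * (R -> C), [/\ is_cder p.1 p.2,
  forall t : R, 0 <= t <= T -> p.2 t = 'i%C * sg%:C * k%:~R ^+ 2 * fourier (U t) k +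
    fourier (nonlin F (U t)) k,
  forall t : R, 0 <= t < T -> p.1 t = fourier (U t) k & p.1 0 = fourier phi k].
Proof.
pose A t := fourier (U (clamp T t)) k; pose f t := fourier (nonlin F (U (clamp T t))) k.
have cA : ccont A.
  apply: ccont_eps => t e e0; have ht := clamp_itv t T_gt0.
  have [d d0 hd] := close ht e0; exists d => // t' tt'.
  have [_ l] := hd _ (clamp_itv t' T_gt0) (le_lt_trans (clamp_lip t' t T_gt0) tt').
  exact: l1b_cn k (l1b_mono (leq0n 2) l).
have cf : ccont f.
  apply: ccont_eps => t e e0; have ht := clamp_itv t T_gt0.
  have [d d0 hd] := nonlin_close F ht e0; exists d => // t' tt'.
  exact: hd _ (clamp_itv t' T_gt0) (le_lt_trans (clamp_lip t' t T_gt0) tt').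
have eA t : 0 <= t <= T -> A t = fourier (U t) k by move=> ht; rewrite /A clamp_id.
have ef t : 0 <= t <= T -> f t = fourier (nonlin F (U t)) k by move=> ht; rewrite /f clamp_id.
have cr : ccont (fun t => 'i%C * sg%:C * k%:~R ^+ 2 * A t + f t).
  by apply: ccontD => //; exact: ccont_scale.
have [b [b' [h1 h2 h3 h4]]] := weak_ode T_gt0 cA cr (hid cA cf eA ef).
exists (b, b'); split; [exact: h1| | |exact: h4] => t ht.
  by apply: etrans (h2 t ht) _; rewrite (eA t ht) (ef t ht).
have ht' : 0 <= t <= T by case/andP: ht => -> /ltW.
exact: etrans (h3 t ht) (eA t ht').
Qed.

Lemma frequency_gain : exists CC, forall ks : seq int, uniq ks ->
  (forall k, k \in ks -> eta * k%:~R < 0) ->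
  \sum_(k <- ks) sobw (s - 2) k * `|k%:~R| * cn (k%:~R ^+ 2 * fourier phi k) ^+ 2 <= CC.
Proof.
have [p hp] := choice ode; pose a k := (p k).1.
(* Defined as a remainder, so that the equation holds at all real times; it is the coefficient of
   the nonlinearity only on [[0, T)]. *)
pose f k t := (p k).2 t - 'i%C * sg%:C * k%:~R ^+ 2 * a k t.
pose G := mpoly.mderiv (@ord4 1 isT) F.
have h0T : (0 : R) <= 0 <= T by rewrite lexx ltW.
have aU k t : 0 <= t < T -> a k t = fourier (U t) k by have [_ _ h _] := hp k; exact: h.
have a0 k : a k 0 = fourier phi k by have [_ _ _] := hp k.
have phiU k : fourier (U 0) k = fourier phi k by rewrite -a0 aU// lexx.
have fU k t : 0 <= t < T -> f k t = fourier (nonlin F (U t)) k.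
  move=> ht; have [_ h _ _] := hp k; rewrite /f h; last by case/andP: ht => -> /ltW.
  by rewrite aU// addrC addKr.
pose g0 := eta * rmean (fun x => Im (F_beta F (phi x) (dx phi x))).
(* The initial condition identifies [U 0] and [phi] only through their Fourier coefficients; the
   Lipschitz bound at distance 0 then equates the two means. *)
have g0E : g0 = eta * Im (fourier (nonlin G (U 0)) 0).
  have [K K0 [_ l0]] := bounded h0T; have l1 := l1b_mono (leqnSn 1) l0.
  have [B [D [_ _ _ hD]]] := fourier_nonlin_lip G K.
  have lphi : l1b 1 K (fourier phi) by apply: l1b_ext l1 => k; exact: phiU.
  have z : l1b 1 0 (fun k => fourier phi k - fourier (U 0) k).
    by move=> ks _; rewrite big1// => k _; rewrite phiU subrr cn0 mulr0.
  have := hD _ _ _ 0 hphi.1 (hU h0T).1 lphi l1 z; rewrite mulr0 => h.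
  have /eqP : fourier (nonlin G phi) 0 - fourier (nonlin G (U 0)) 0 = 0.
    by apply: cn_eq0; apply/eqP; rewrite eq_le h cn_ge0.
  rewrite subr_eq0 => /eqP <-; rewrite /g0 Im_fourier0; congr (_ * rmean _).
  by apply/funext => x; rewrite F_betaE.
have g00 : 0 < g0 := hmean.
have g4 : 0 < g0 / 4 by rewrite divr_gt0.
have eta1 : `|eta| = 1.
  by apply/eqP; rewrite -(eqrXn2 (isT : (0 < 2)%N))// ?real_normK ?num_real// eta2 expr1n.
have [K [d1 [d10 K0 hK]]] := near_bounded h0T.
have [d2 d20 hd2] := nonlin_close G h0T g4.
(* Short enough to stay below [T], where the coefficients are identified, within the uniform bounds
   near time 0, and within a drift of the mean by [g0 / 4]. The truncation costs another [g0 / 4],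
   so [g0 / 2] remains as growth rate. *)
pose T1 := Num.min (T / 2) (Num.min (d1 / 2) (d2 / 2)).
have T10 : 0 < T1 by rewrite !lt_min !divr_gt0.
have [T1T [T1d1 T1d2]] : T1 <= T / 2 /\ T1 <= d1 / 2 /\ T1 <= d2 / 2.
  by rewrite /T1 !ge_min !lexx !orbT.
have tT t : 0 <= t <= T1 -> 0 <= t < T by move=> /andP[-> h] /=; lra.
have tT' t : 0 <= t <= T1 -> 0 <= t <= T by move=> /andP[-> h] /=; lra.
have td1 t : 0 <= t <= T1 -> `|t - 0| < d1 by move=> /andP[t0 h]; rewrite subr0 ger0_norm//; lra.
have td2 t : 0 <= t <= T1 -> `|t - 0| < d2 by move=> /andP[t0 h]; rewrite subr0 ger0_norm//; lra.
have aE t : 0 <= t <= T1 -> (fun k => a k t) = fourier (U t).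
  by move=> ht; apply/funext => k; exact: aU (tT t ht).
have trE H N t k : 0 <= t <= T1 -> truncF H a N t k =
    lval (ltrunc N (fourier (U t))) (ltrunc N (fun j => conjc (fourier (U t) (- j)))) H k.
  move=> ht; rewrite /truncF /truncU /truncV aE//; congr (lval _ (ltrunc N _) _ _).
  by apply/funext => j; rewrite aU// tT.
have Ha k : is_cder (a k) (fun t => 'i%C * sg%:C * k%:~R ^+ 2 * a k t + f k t).
  have [h _ _ _] := hp k; apply: is_cder_ext h => t //.
  by rewrite /f addrC subrK.
have Hb : exists M, forall t : R, 0 <= t <= T1 -> nb W 2 M (fun k => a k t).
  exists K => t ht; rewrite aE//; exact: (hK t (tT' t ht) (td1 t ht)).1.
have Hf e : 0 < e -> exists N0, forall N (t : R) k, (N0 <= N)%N -> 0 <= t <= T1 ->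
    cn (f k t - truncF F a N t k) <= e.
  move=> e0; have [D D0 hD] := fourier_nonlin_trunc F K.
  have [N0 hN0] := rate_small D0 e0; exists N0 => N t k hN ht.
  rewrite trE// fU ?tT//; apply: le_trans (hN0 N hN).
  exact: hD (hU (tT' t ht)).1 (hK t (tT' t ht) (td1 t ht)).2.
have Hg : exists N0, forall N (t : R), (N0 <= N)%N -> 0 <= t <= T1 ->
    g0 / 2 <= eta * Im (truncF G a N t 0).
  have [D D0 hD] := fourier_nonlin_trunc G K.
  have [N0 hN0] := rate_small D0 g4; exists N0 => N t hN ht.
  rewrite trE//; set z := lval _ _ _ _.
  have h1 := le_trans (hD _ N 0 (hU (tT' t ht)).1 (hK t (tT' t ht) (td1 t ht)).2) (hN0 N hN).
  have h2 := hd2 t 0 (tT' t ht) (td2 t ht).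
  move: h1 h2; rewrite -/z; set y := fourier (nonlin G (U t)) 0; set x := fourier _ 0 => h1 h2.
  have i1 := le_trans (ge_cn_Im _) h1; have i2 := le_trans (ge_cn_Im _) h2.
  have n (w : R) : eta * w <= `|w| by rewrite (le_trans (ler_norm _))// normrM eta1 mul1r.
  have j1 : eta * Im y - eta * Im z <= g0 / 4.
    by rewrite -mulrBr; apply: le_trans (n _) _; move: i1; rewrite cImD cImN.
  have j2 : eta * Im x - eta * Im y <= g0 / 4.
    by rewrite -mulrBr; apply: le_trans (n _) _; rewrite distrC; move: i2; rewrite cImD cImN.
  exact: gain_arith g0E j2 j1.
have [CC hCC] := @core_estimate R W F a f sg eta (g0 / 2) T1 sg2 eta2 (divr_gt0 g00 (ltr0Sn R 1))
  T10 Ha Hb Hf Hg.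
exists CC => ks uk hk; apply: le_trans (hCC ks uk hk).
by apply: ler_sum => k _; rewrite a0.
Qed.

End Gain.
End Assembly.

(** * The forward and the backward problem *)

Section Conclusion.
Variable R : realType.
Local Notation C := R[i].
Implicit Types (F : mpoly.mpoly 4 C) (phi : R -> C) (u : R -> R -> C).

Lemma C_Hs_eps (D : set R) (s : R) u (t e : R) : C_Hs D s u -> D t -> 0 < e ->
  exists2 d, 0 < d & forall t' : R, D t' -> `|t' - t| < d ->
    (Hs_norm s (fun x => u t' x - u t x)%R <= e%:E)%E.
Proof.
move=> [_ h] Dt e0.
have n0 : nbhs (0%E : \bar R) [set y | (y < e%:E)%E] by exact: (@nbhs_open_ereal_lt _ 0 (fun=> e)).
have /nbhs_ballP[d /= d0 hd] := h t Dt _ n0; exists d => // t' Dt' tt'.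
by apply: ltW; apply: hd Dt'; rewrite /ball /= distrC.
Qed.

Lemma nonlinN F (v : R -> C) x : nonlin (- F) v x = - nonlin F v x.
Proof. by rewrite /nonlin /polyval mpoly.mevalN. Qed.

Lemma F_betaN F (al be : C) : F_beta (- F) al be = - F_beta F al be.
Proof. by rewrite !F_betaE mpoly.mderivN /polyval mpoly.mevalN. Qed.

Lemma rmeanN (h : R -> R) : rint torus h -> rmean (fun x => - h x) = - rmean h.
Proof.
move=> ih; rewrite /rmean -mulrN; congr (_ * _).
rewrite -[RHS]mulN1r.
apply: etrans (@RintegralZl _ _ _ lebesgue_measure _ _ (-1) measurable_torus ih).
by apply: eq_Rintegral => x _; rewrite mulN1r.
Qed.

Lemma fourierN (f : R -> C) k : ci torus f -> fourier (fun x => - f x) k = - fourier f k.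
Proof.
move=> hf; rewrite /fourier -[RHS]mulN1r -meanZ; last by under eq_fun do rewrite -mulNr; exact: ci_expi.
by congr mean; apply/funext => x; rewrite mulN1r mulNr.
Qed.

Lemma P_minus_gain (s delta : R) phi CC : 5 / 2 < s -> delta < 1 / 2 -> Hs s phi ->
  (forall ks : seq int, uniq ks -> (forall k, k \in ks -> 1 * k%:~R < 0 :> R) ->
     \sum_(k <- ks) sobw (s - 2) k * `|k%:~R| * cn (k%:~R ^+ 2 * fourier phi k) ^+ 2 <= CC) ->
  Hs (s + delta) (P_minus phi).
Proof.
move=> hs hd [_ /Hs_norm_bound[M M0 hM]] hC; have [A A0 hA] := Hs_l1b hs.
have h1 := l1b_mono (leq0n 2) (hA phi M M0 hM); rewrite (P_minus_fseries h1).
apply: (Hs_fseries_restrict (CC := CC) hd h1) => [k|ks uk hk]; first by rewrite lt_neqAle => /andP[].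
by apply: hC => // k /hk; rewrite mul1r ltrz0.
Qed.

Lemma P_plus_gain (s delta : R) phi CC : 5 / 2 < s -> delta < 1 / 2 -> Hs s phi ->
  (forall ks : seq int, uniq ks -> (forall k, k \in ks -> -1 * k%:~R < 0 :> R) ->
     \sum_(k <- ks) sobw (s - 2) k * `|k%:~R| * cn (k%:~R ^+ 2 * fourier phi k) ^+ 2 <= CC) ->
  Hs (s + delta) (P_plus phi).
Proof.
move=> hs hd [_ /Hs_norm_bound[M M0 hM]] hC; have [A A0 hA] := Hs_l1b hs.
have h1 := l1b_mono (leq0n 2) (hA phi M M0 hM); rewrite (P_plus_fseries h1).
apply: (Hs_fseries_restrict (CC := CC) hd h1) => [k|ks uk hk]; first by rewrite lt_neqAle eq_sym => /andP[].
by apply: hC => // k /hk; rewrite mulN1r oppr_lt0 ltr0z.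
Qed.

Lemma ci_Hs_nonlin (s : R) F (v : R -> C) : 5 / 2 < s -> Hs s v -> ci torus (nonlin F v).
Proof.
move=> hs [lv /Hs_norm_bound[M M0 hM]]; have [A A0 hA] := Hs_l1b hs.
have h := l1b_mono (leqnSn 1) (hA v M M0 hM).
exact: (ci_nonlin F lv h).
Qed.

Lemma forward_gain (s T eta : R) F phi u : 5 / 2 < s -> 0 < T -> Hs s phi ->
  C_Hs `[0, T] s u -> solution_forward s T F phi u -> eta ^+ 2 = 1 ->
  0 < eta * rmean (fun x => Im (F_beta F (phi x) (dx phi x))) ->
  exists CC, forall ks : seq int, uniq ks -> (forall k, k \in ks -> eta * k%:~R < 0) ->
    \sum_(k <- ks) sobw (s - 2) k * `|k%:~R| * cn (k%:~R ^+ 2 * fourier phi k) ^+ 2 <= CC.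
Proof.
move=> hs T0 hphi hu sol eta2 hm.
have hU (t : R) : 0 <= t <= T -> Hs s (u t) by move=> ht; apply: hu.1; rewrite /= in_itv.
have hc (t e : R) : 0 <= t <= T -> 0 < e -> exists2 d, 0 < d & forall t' : R, 0 <= t' <= T ->
    `|t' - t| < d -> (Hs_norm s (fun x => u t' x - u t x)%R <= e%:E)%E.
  move=> ht e0; have [|d d0 hd] := C_Hs_eps (t := t) hu _ e0; first by rewrite /= in_itv.
  by exists d => // t' ht'; apply: hd; rewrite /= in_itv.
apply: (frequency_gain hs T0 hphi hU hc (sg := 1) _ _ eta2 hm); first by rewrite expr1n.
move=> k A f cA cf eA ef c T' c0 hT'; rewrite mulr1.
apply: (forward_identity T0 hphi.1 sol _ cA cf eA ef c0 hT') => t ht.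
by split; [exact: (hU t ht).1|exact: ci_Hs_nonlin hs (hU t ht)].
Qed.

(** Reversing time replaces [F] by [- F], so the mean changes sign and the growing frequencies
    change side. *)
Lemma backward_gain (s T eta : R) F phi u : 5 / 2 < s -> 0 < T -> Hs s phi ->
  C_Hs `[- T, 0] s u -> solution_backward s T F phi u -> eta ^+ 2 = 1 ->
  0 < - eta * rmean (fun x => Im (F_beta F (phi x) (dx phi x))) ->
  exists CC, forall ks : seq int, uniq ks -> (forall k, k \in ks -> eta * k%:~R < 0) ->
    \sum_(k <- ks) sobw (s - 2) k * `|k%:~R| * cn (k%:~R ^+ 2 * fourier phi k) ^+ 2 <= CC.
Proof.
move=> hs T0 hphi hu sol eta2 hm.
have neg (t : R) : 0 <= t <= T -> `[- T, 0]%classic (- t).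
  by move=> ht; rewrite /= in_itv /=; lra.
have hU (t : R) : 0 <= t <= T -> Hs s (u (- t)) by move=> ht; apply: hu.1; exact: neg.
have hc (t e : R) : 0 <= t <= T -> 0 < e -> exists2 d, 0 < d & forall t' : R, 0 <= t' <= T ->
    `|t' - t| < d -> (Hs_norm s (fun x => u (- t')%R x - u (- t)%R x)%R <= e%:E)%E.
  move=> ht e0; have [d d0 hd] := C_Hs_eps hu (neg t ht) e0; exists d => // t' ht' tt'.
  by apply: hd (neg t' ht') _; rewrite -opprD normrN.
have iF : rint torus (fun x => Im (F_beta F (phi x) (dx phi x))).
  have [_] := ci_Hs_nonlin (mpoly.mderiv (@ord4 1 isT) F) hs hphi.
  by rewrite (_ : (fun x => Im (F_beta _ _ _)) = fun x => Im (nonlin (mpoly.mderiv (@ord4 1 isT) F) phi x))//;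
    apply/funext => x; rewrite F_betaE.
have hm' : 0 < eta * rmean (fun x => Im (F_beta (- F) (phi x) (dx phi x))).
  rewrite (_ : (fun x => _) = fun x => - Im (F_beta F (phi x) (dx phi x))).
    by rewrite rmeanN// mulrN -mulNr.
  by apply/funext => x; rewrite F_betaN cImN.
have sg2 : (-1) ^+ 2 = 1 :> R by rewrite sqrrN expr1n.
apply: (@frequency_gain R s T (-1) eta (- F) phi (fun t => u (- t)) hs T0 hphi hU hc sg2 _ eta2 hm').
move=> k A f cA cf eA ef c T' c0 hT'.
have -> : 'i%C * (-1)%:C = - 'i%C :> C by rewrite rmorphN rmorph1 mulrN1.
have eN (t : R) : 0 <= t <= T -> f t = - fourier (nonlin F (u (- t))) k.
  move=> ht; rewrite ef// -fourierN; last exact: ci_Hs_nonlin hs (hU t ht).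
  by congr (fourier _ k); apply/funext => x; rewrite nonlinN.
apply: (backward_identity T0 hphi.1 sol _ cA cf eA eN c0 hT') => t ht.
by split; [exact: (hU t ht).1|exact: ci_Hs_nonlin hs (hU t ht)].
Qed.

End Conclusion.

Theorem theorem4p1 (R : realType) (s T : R) (F : mpoly.mpoly 4 R[i])
    (phi : R -> R[i]) (hs : 5 / 2 < s) (hT : 0 < T) (hphi : Hs s phi) :
  (forall u : R -> R -> R[i],
    C_Hs `[0, T] s u -> solution_forward s T F phi u ->
    (0 < rmean (fun x => Im (F_beta F (phi x) (dx phi x))) ->
       forall delta : R, 0 < delta < 1 / 2 -> Hs (s + delta) (P_minus phi)) /\
    (rmean (fun x => Im (F_beta F (phi x) (dx phi x))) < 0 ->
       forall delta : R, 0 < delta < 1 / 2 -> Hs (s + delta) (P_plus phi))) /\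
  (forall u : R -> R -> R[i],
    C_Hs `[- T, 0] s u -> solution_backward s T F phi u ->
    (0 < rmean (fun x => Im (F_beta F (phi x) (dx phi x))) ->
       forall delta : R, 0 < delta < 1 / 2 -> Hs (s + delta) (P_plus phi)) /\
    (rmean (fun x => Im (F_beta F (phi x) (dx phi x))) < 0 ->
       forall delta : R, 0 < delta < 1 / 2 -> Hs (s + delta) (P_minus phi))).
Proof.
have one : 1 ^+ 2 = 1 :> R by rewrite expr1n.
have mone : (-1) ^+ 2 = 1 :> R by rewrite sqrrN expr1n.
split=> u hu sol; split=> hm delta /andP[_ hd].
- have h : 0 < 1 * rmean (fun x => Im (F_beta F (phi x) (dx phi x))) by rewrite mul1r.
  have [CC hC] := forward_gain hs hT hphi hu sol one h.
  exact: P_minus_gain hs hd hphi hC.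
- have h : 0 < -1 * rmean (fun x => Im (F_beta F (phi x) (dx phi x))) by rewrite mulN1r oppr_gt0.
  have [CC hC] := forward_gain hs hT hphi hu sol mone h.
  exact: P_plus_gain hs hd hphi hC.
(* Backward in time [eta] is opposite to the sign of the mean, which exchanges the two
   projections. *)
- have h : 0 < - -1 * rmean (fun x => Im (F_beta F (phi x) (dx phi x))) by rewrite opprK mul1r.
  have [CC hC] := backward_gain hs hT hphi hu sol mone h.
  exact: P_plus_gain hs hd hphi hC.
- have h : 0 < - 1 * rmean (fun x => Im (F_beta F (phi x) (dx phi x))) by rewrite mulN1r oppr_gt0.
  have [CC hC] := backward_gain hs hT hphi hu sol one h.
  exact: P_minus_gain hs hd hphi hC.
Qed.
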